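(* Let $1<\alpha<2$, let $m\ge 0$ be an integer, let $\alpha>\alpha_1>\dots>\alpha_m>0$ with $\alpha-\alpha_m\le 1$, and let $c>0$, $c_j>0$ for $j=1,\dots,m$. Let $$\theta_0=\frac{(2-\alpha)\pi}{2\alpha}-\varepsilon,$$ where $\varepsilon>0$ is arbitrarily small. Then for any $\tau>0$ the function $\phi(t,\tau)$, as a function of $t$, admits an analytic extension to the sector $\Sigma(\theta_0)$ and is bounded on each sector $\overline{\Sigma(\theta)}$, $0<\theta<\theta_0$.
   Context: If $m=0$, the sums over $j$ are empty and the conditions on the $\alpha_j$ and $c_j$ are void. For $\theta\in(0,\pi)$, $\Sigma(\theta)=\{z\in\mathbb{C}\setminus\{0\}:\ |\arg z|<\theta\}$. Put $g(s)=c s^{\alpha}+\sum_{j=1}^m c_j s^{\alpha_j}$. Let $D_t^\beta$ denote the Caputo derivative of order $\beta>0$ in time. The propagation function $w(x,t)$ is the solution of $cD_t^{\alpha}w+\sum_{j=1}^m c_jD_t^{\alpha_j}w=w_{xx}$ for $x,t>0$, with $w(x,0)=w_t(x,0)=0$ for $x>0$, $w(0,t)=1$ for $t>0$, $w\to0$ as $x\to\infty$, obtained by Laplace transform: for each $x>0$, $\int_0^\infty e^{-st}w(x,t)\,\mathrm{d}t=\frac1s\exp(-x\sqrt{g(s)})$, $s>0$. The function $\phi$ is defined by $\phi(t,\tau)=-w_x(x,t)|_{x=\tau}$, $t,\tau>0$, so that $\int_0^\infty e^{-st}\phi(t,\tau)\,\mathrm{d}t=\frac{\sqrt{g(s)}}{s}\exp(-\tau\sqrt{g(s)})$.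 ''Arbitrarily small'' means that the assertion holds for every $\varepsilon>0$ small enough that $\theta_0>0$. *)

(* Defs.v *)
From Stdlib Require Import Reals.
From Coquelicot Require Import Coquelicot.
Open Scope R_scope.

Definition Gamma (z : R) : R :=
  RInt_gen (fun t => Rpower t (z - 1) * exp (- t))
    (at_right 0) (Rbar_locally p_infty).

(** [is_Caputo beta u t v]: the Caputo derivative of order [beta > 0] of [u] at
    [t > 0] exists and equals [v]; here [n] is the least integer [>= beta].
    Every order [k <= n] is listed because [ex_derive_n u n] only says that the
    total function [Derive_n u (n - 1)] is differentiable. *)
Definition is_Caputo (beta : R) (u : R -> R) (t v : R) : Prop :=
  exists n : nat,
    INR n - 1 < beta <= INR n /\
    (forall (k : nat) (s : R), (k <= n)%nat -> 0 < s -> ex_derive_n u k s) /\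
    ((beta = INR n /\ v = Derive_n u n t) \/
     (beta < INR n /\
      is_RInt_gen
        (fun s => Rpower (t - s) (INR n - beta - 1) / Gamma (INR n - beta)
                  * Derive_n u n s)
        (at_right 0) (at_left t) v)).

(** The families [cs] and [als] are only used at the indices [1, ..., m]; the
    sum is empty, hence [0], when [m = 0]. *)
Definition g (c alpha : R) (m : nat) (cs als : nat -> R) (s : R) : R :=
  c * Rpower s alpha + sum_n_m (fun j => cs j * Rpower s (als j)) 1 m.

(** [w] is a function on the open quadrant [x, t > 0] (its values elsewhere are
    irrelevant): initial and boundary values are one-sided limits.  Integrals
    over [(0, +oo)] are improper Riemann integrals. *)
Record is_propagation_function
  (c alpha : R) (m : nat) (cs als : nat -> R) (w : R -> R -> R) : Prop := {
  prop_x_regular : forall (x t : R) (k : nat), 0 < x -> 0 < t -> (k <= 2)%nat ->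
    ex_derive_n (fun y => w y t) k x;
  prop_equation : forall x t : R, 0 < x -> 0 < t ->
    exists (v : R) (vs : nat -> R),
      is_Caputo alpha (w x) t v /\
      (forall j : nat, (1 <= j <= m)%nat -> is_Caputo (als j) (w x) t (vs j)) /\
      c * v + sum_n_m (fun j => cs j * vs j) 1 m
        = Derive_n (fun y => w y t) 2 x;
  prop_initial : forall x : R, 0 < x ->
    filterlim (w x) (at_right 0) (locally 0);
  prop_initial_t : forall x : R, 0 < x ->
    filterlim (Derive (w x)) (at_right 0) (locally 0);
  prop_boundary : forall t : R, 0 < t ->
    filterlim (fun x => w x t) (at_right 0) (locally 1);
  prop_infinity : forall t : R, 0 < t ->
    is_lim (fun x => w x t) p_infty 0;
  prop_laplace : forall x s : R, 0 < x -> 0 < s ->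
    is_RInt_gen (fun t => exp (- s * t) * w x t)
      (at_right 0) (Rbar_locally p_infty)
      (1 / s * exp (- x * sqrt (g c alpha m cs als s)))
}.

Definition phi (w : R -> R -> R) (t tau : R) : R :=
  - Derive (fun x => w x t) tau.

(** Principal argument, in [(-PI, PI]]; only meaningful for [z <> 0]. *)
Definition Carg (z : C) : R :=
  if Rle_dec 0 (Im z) then acos (Re z / Cmod z) else - acos (Re z / Cmod z).

Definition Sigma (theta : R) (z : C) : Prop :=
  z <> RtoC 0 /\ Rabs (Carg z) < theta.

Definition closure {T : UniformSpace} (D : T -> Prop) (z : T) : Prop :=
  forall eps : posreal, exists y : T, ball z eps y /\ D y.

(** Complex differentiability: the field of scalars is [C_AbsRing], not [R]. *)
Definition analytic_on (D : C -> Prop) (F : C -> C) : Prop :=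
  forall z : C, D z -> @ex_derive C_AbsRing C_NormedModule F z.

Definition bounded_on (D : C -> Prop) (F : C -> C) : Prop :=
  exists M : R, forall z : C, D z -> Cmod (F z) <= M.

Definition theta0 (alpha eps : R) : R :=
  (2 - alpha) * PI / (2 * alpha) - eps.

(* Main.v *)
Require Import Defs.
From Stdlib Require Import Reals Lra Psatz Lia.
From Coquelicot Require Import Coquelicot.
Open Scope R_scope.

(** Put [psi = PI / 2 + theta0], so that [PI / 2 < psi] and [alpha * psi < PI].  For
    [s] with [0 <= arg s <= psi] every monomial of [g (s)] has its argument in
    [[0, alpha * psi]].  Hence [g (s)] stays off the negative half-line, [sqrt g] is
    holomorphic there, and both [Re (sqrt g)] and [|sqrt g|] are comparable to
    [sqrt (g (|s|))] ([root_Re_ge], [root_le]).  Therefore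
    [sqrt g * exp (- tau * sqrt g)] is dominated by a small positive power of [|s|] near
    [0] and by a small negative one near infinity ([root_decay]).  The inversion
    integral of [phi] over the two rays [arg s = psi] and [arg s = - psi],

      [F (t) = 1 / (2 PI i) int exp (s t) sqrt (g s) exp (- tau sqrt (g s)) ds / s],

    thus converges absolutely even without its exponential factor.  If
    [|arg t| < theta0] then [Re (s t) < 0] on both rays, so that [|exp (s t)| <= 1]:
    this bounds [F] at once ([extension_le]), and [F] is differentiated under the
    integral sign ([extension_deriv]).

    It remains to see that [F] is [phi] on the half-line.  Since the transform is known
    for [w] and not for its [x]-derivative, differences of [w] are inverted first: the
    transform of [w x1 - w x2] is [k (s) / s] with
    [k = exp (- x1 sqrt g) - exp (- x2 sqrt g)], and [k] decays at both ends of the ray.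
    The ray integral of [exp (s t) k (s) ds / s] has this same Laplace transform, by
    Cauchy's formula for a pole at a real point ([stieltjes],
    [laplace_inverse_laplace]); by Lerch's uniqueness theorem ([laplace_unique]) it is
    [w x1 - w x2] ([propagation_difference]).  Differentiating this formula in [x1]
    under the integral sign gives [phi] ([wave_kernel_deriv]).

    All integrals over rays are written in the variable [u = ln |s|]; a point of the
    plane of logarithms is the pair [(u, arg s)], and the half sector becomes the strip
    [0 <= y <= psi], in which [g] is a sum of exponentials. *)

(** * Complex exponential *)

Definition Cexp (z : C) : C := (exp (Re z) * cos (Im z), exp (Re z) * sin (Im z)).

Lemma Cexp_plus (z w : C) : Cexp (z + w) = (Cexp z * Cexp w)%C.
Proof.
  destruct z as [a b], w as [p q]; unfold Cexp, Cplus, Cmult, Re, Im; simpl.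
  rewrite exp_plus, cos_plus, sin_plus; f_equal; ring.
Qed.

Lemma Cexp_real (a : R) : Cexp (RtoC a) = RtoC (exp a).
Proof.
  unfold Cexp, RtoC, Re, Im; simpl; rewrite cos_0, sin_0; f_equal; ring.
Qed.

Lemma Cmod_Cexp (z : C) : Cmod (Cexp z) = exp (Re z).
Proof.
  unfold Cmod, Cexp; simpl.
  replace (_ + _) with (exp (Re z) ^ 2 * ((sin (Im z))² + (cos (Im z))²))
    by (unfold Rsqr; ring).
  rewrite sin2_cos2, Rmult_1_r, sqrt_pow2; [easy | left; apply exp_pos].
Qed.

Lemma Cmod_mul_self (v : C) : Cmod v * Cmod v = Re v * Re v + Im v * Im v.
Proof.
  unfold Cmod, Re, Im. rewrite sqrt_sqrt; [ring | nra].
Qed.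

Lemma Re_le_Cmod (z : C) : Re z <= Cmod z.
Proof. exact (Rle_trans _ _ _ (Rle_abs _) (re_le_Cmod z)). Qed.

Lemma im_le_Cmod (z : C) : Rabs (Im z) <= Cmod z.
Proof. exact (Rle_trans _ _ _ (Rmax_r _ _) (Rmax_Cmod z)). Qed.

Lemma Cdot_le (v w : C) : Re v * Re w + Im v * Im w <= Cmod v * Cmod w.
Proof.
  rewrite <- (Cmod_conj v), <- Cmod_mult.
  destruct v as [a b], w as [p q].
  eapply Rle_trans; [| apply (Rle_trans _ _ _ (Rle_abs _) (re_le_Cmod _))].
  unfold Cconj, Cmult, Re, Im; simpl; right; ring.
Qed.

(** The mean value inequality for a curve [f], obtained from the real mean
    value theorem by projecting [f] on the direction [f 1 - f 0]. *)
Lemma Cmod_increment_le (f df : R -> C) (M : R) :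
  (forall t, 0 <= t <= 1 -> is_derive (fun u => Re (f u)) t (Re (df t)) /\
     is_derive (fun u => Im (f u)) t (Im (df t)) /\ Cmod (df t) <= M) ->
  Cmod (f 1 - f 0)%C <= M.
Proof.
  intros H. set (v := (f 1 - f 0)%C).
  assert (Hd : forall t, 0 <= t <= 1 ->
    is_derive (fun u => Re v * Re (f u) + Im v * Im (f u)) t
      (Re v * Re (df t) + Im v * Im (df t))).
  { intros t Ht. destruct (H t Ht) as (H1 & H2 & _).
    apply (is_derive_plus (K := R_AbsRing) (V := R_NormedModule));
      apply is_derive_scal; assumption. }
  destruct (MVT_gen (fun u => Re v * Re (f u) + Im v * Im (f u)) 0 1
    (fun t => Re v * Re (df t) + Im v * Im (df t))) as (t & Ht & E).
  - rewrite Rmin_left, Rmax_right by lra. intros t Ht; apply Hd; lra.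
  - rewrite Rmin_left, Rmax_right by lra. intros t Ht.
    apply derivable_continuous_pt. eexists.
    apply is_derive_Reals, Hd, Ht.
  - rewrite Rmin_left, Rmax_right in Ht by lra.
    destruct (H t Ht) as (_ & _ & HM).
    pose proof (Cdot_le v (df t)). pose proof (Cmod_mul_self v) as Hv.
    assert (Ev : Re v * Re (f 1) + Im v * Im (f 1) - (Re v * Re (f 0) + Im v * Im (f 0))
       = Cmod v * Cmod v).
    { rewrite Hv; unfold v, Cminus, Cplus, Copp, Re, Im; simpl; ring. }
    rewrite Ev in E. pose proof (Cmod_ge_0 v).
    destruct (Req_dec (Cmod v) 0) as [E0 | N0].
    + rewrite E0. pose proof (Cmod_ge_0 (df t)); lra.
    + apply Rmult_le_reg_l with (Cmod v); nra.
Qed.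

Lemma is_derive_Cexp_ray (w : C) (t : R) :
  is_derive (fun u => Re (Cexp (RtoC u * w))) t (Re (w * Cexp (RtoC t * w))) /\
  is_derive (fun u => Im (Cexp (RtoC u * w))) t (Im (w * Cexp (RtoC t * w))).
Proof.
  destruct w as [a b]; unfold Cexp, Cmult, RtoC, Re, Im; simpl.
  split; auto_derive; trivial; unfold Rminus; ring_simplify;
   rewrite ?Ropp_0, ?Rmult_0_l, ?Rplus_0_r, ?Rplus_0_l; ring.
Qed.

Lemma exp_mono (a b : R) : a <= b -> exp a <= exp b.
Proof. intros [H | ->]; [left; apply exp_increasing, H | right; easy]. Qed.

(** The first- and second-order Taylor remainders of the exponential follow from
    the mean value inequality along the segment from [0] to [w]. *)
Lemma Cexp_minus_1_le (w : C) (m : R) :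
  0 <= m -> Re w <= m -> Cmod (Cexp w - 1) <= Cmod w * exp m.
Proof.
  intros Hm Hw.
  replace (Cexp w - 1)%C with (Cexp (RtoC 1 * w) - Cexp (RtoC 0 * w))%C.
  2: { replace (RtoC 1 * w)%C with w by ring.
       replace (RtoC 0 * w)%C with (RtoC 0) by ring.
       rewrite Cexp_real, exp_0; easy. }
  apply (Cmod_increment_le (fun t => Cexp (RtoC t * w))
    (fun t => w * Cexp (RtoC t * w))%C).
  intros t Ht. destruct (is_derive_Cexp_ray w t). split; [| split]; auto.
  rewrite Cmod_mult, Cmod_Cexp. apply Rmult_le_compat_l; [apply Cmod_ge_0 |].
  apply exp_mono. destruct w as [a b]; unfold Re in *; simpl in *. nra.
Qed.

Lemma RtoC_m1 : RtoC (-1) = (- RtoC 1)%C.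
Proof. unfold RtoC, Copp; simpl; f_equal; ring. Qed.

Lemma Cexp_taylor_le (w : C) :
  Cmod (Cexp w - 1 - w) <= Cmod w * Cmod w * exp (Cmod w).
Proof.
  replace (Cexp w - 1 - w)%C
    with ((Cexp (RtoC 1 * w) - RtoC 1 * w) - (Cexp (RtoC 0 * w) - RtoC 0 * w))%C.
  2: { replace (RtoC 1 * w)%C with w by ring.
       replace (RtoC 0 * w)%C with (RtoC 0) by ring.
       rewrite Cexp_real, exp_0; ring. }
  apply (Cmod_increment_le (fun t => Cexp (RtoC t * w) - RtoC t * w)
    (fun t => w * (Cexp (RtoC t * w) - 1)))%C.
  intros t Ht. destruct (is_derive_Cexp_ray w t) as [H1 H2]. split; [| split].
  - apply is_derive_ext with (fun u => Re (Cexp (RtoC u * w)) - u * Re w).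
    { intros u; destruct w; unfold Cminus, Cplus, Copp, RtoC, Cmult, Re; simpl; ring. }
    assert (H0 : is_derive (fun u => u * Re w) t (Re w))
      by (auto_derive; trivial; ring).
    evar_last. { apply @is_derive_minus; [apply H1 | apply H0]. }
    destruct w; unfold minus, plus, opp, scal, one, mult, Cmult, Cminus, Cplus, Copp, RtoC, Re; simpl;
    unfold mult; simpl; ring.
  - apply is_derive_ext with (fun u => Im (Cexp (RtoC u * w)) - u * Im w).
    { intros u; destruct w; unfold Cminus, Cplus, Copp, RtoC, Cmult, Im; simpl; ring. }
    assert (H0 : is_derive (fun u => u * Im w) t (Im w))
      by (auto_derive; trivial; ring).
    evar_last. { apply @is_derive_minus; [apply H2 | apply H0]. }
    destruct w; unfold minus, plus, opp, scal, one, mult, Cmult, Cminus, Cplus, Copp, RtoC, Im; simpl;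
    unfold mult; simpl; ring.
  - rewrite Cmod_mult, Rmult_assoc. apply Rmult_le_compat_l; [apply Cmod_ge_0 |].
    assert (Hm : Cmod (RtoC t * w) <= Cmod w).
    { rewrite Cmod_mult, Cmod_R, Rabs_pos_eq by lra.
      pose proof (Cmod_ge_0 w); nra. }
    eapply Rle_trans; [apply Cexp_minus_1_le with (m := Cmod w) |].
    + apply Cmod_ge_0.
    + eapply Rle_trans; [apply (Rle_trans _ _ _ (Rle_abs _) (re_le_Cmod _)) | easy].
    + apply Rmult_le_compat_r; [left; apply exp_pos | easy].
Qed.

(** * Complex differentiability *)

Lemma is_derive_C_eps (f : C -> C) (z l : C) :
  @is_derive C_AbsRing C_NormedModule f z l <->
  forall eps, 0 < eps -> exists d, 0 < d /\ forall h, Cmod h < d ->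
    Cmod (f (z + h) - f z - l * h)%C <= eps * Cmod h.
Proof.
  split.
  - intros [_ H] eps He.
    destruct (H z (fun P HP => HP) (mkposreal eps He)) as [d Hd].
    exists d; split; [apply cond_pos |]. intros h Hh.
    specialize (Hd (z + h)%C).
    assert (Hb : @AbsRing_ball C_AbsRing z d (z + h)%C).
    { unfold AbsRing_ball, abs, minus, plus, opp; simpl.
      replace (z + h + - z)%C with h by ring. exact Hh. }
    specialize (Hd Hb). simpl in Hd.
    unfold norm, minus, plus, opp, scal, mult in Hd; simpl in Hd.
    unfold mult in Hd; simpl in Hd.
    replace (z + h + - z)%C with h in Hd by ring.
    replace (f (z + h) - f z - l * h)%C with (f (z + h) + - f z + - (h * l))%C by ring.
    exact Hd.
  - intros H. split; [apply is_linear_scal_l |].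
    intros x Hx eps.
    replace x with z in * by (apply (@is_filter_lim_locally_unique C_AbsRing (AbsRing_NormedModule C_AbsRing)); exact Hx).
    destruct (H eps (cond_pos eps)) as (d & Hd & Hb).
    exists (mkposreal d Hd). refine (fun (y : C) Hy => _).
    unfold norm, minus, plus, opp, scal, mult; simpl.
    unfold mult; simpl.
    specialize (Hb (y + - z)%C Hy).
    replace (z + (y + - z))%C with y in Hb by ring.
    replace (f y + - f z + - ((y + - z) * l))%C with (f y - f z - l * (y + - z))%C by ring.
    exact Hb.
Qed.

Local Notation Cderiv := (@is_derive C_AbsRing C_NormedModule).
Local Notation Ccont := (@continuous (AbsRing_UniformSpace C_AbsRing) (AbsRing_UniformSpace C_AbsRing)).
Local Notation Clocally := (@locally (AbsRing_UniformSpace C_AbsRing)).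

Lemma Clocally_eps (P : C -> Prop) (z : C) :
  Clocally z P <-> exists d, 0 < d /\ forall h, Cmod h < d -> P (z + h)%C.
Proof.
  split.
  - intros [d Hd]. exists d; split; [apply cond_pos |]. intros h Hh. apply Hd.
    unfold ball; simpl. unfold AbsRing_ball, abs, minus, plus, opp; simpl.
    replace (z + h + - z)%C with h by ring. exact Hh.
  - intros (d & Hd & H). exists (mkposreal d Hd). refine (fun (y : C) Hy => _).
    replace y with (z + (y + - z))%C by ring. apply H. exact Hy.
Qed.

Lemma Ccont_eps (f : C -> C) (z : C) :
  Ccont f z <-> forall eps, 0 < eps -> exists d, 0 < d /\ forall h, Cmod h < d ->
    Cmod (f (z + h) - f z)%C < eps.
Proof.
  split.
  - intros H eps He. apply (Clocally_eps (fun w => Cmod (f w - f z)%C < eps)).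
    apply (H (fun w => Cmod (w - f z)%C < eps)).
    exists (mkposreal eps He). intros y Hy. exact Hy.
  - intros H P [e He].
    destruct (proj2 (Clocally_eps (fun w => Cmod (f w - f z)%C < e) z)
      (H e (cond_pos e))) as [d Hd].
    exists d. intros y Hy. apply He. exact (Hd y Hy).
Qed.

Lemma Cderiv_cont (f : C -> C) (z l : C) : Cderiv f z l -> Ccont f z.
Proof.
  intros H. rewrite is_derive_C_eps in H. apply Ccont_eps. intros eps He.
  destruct (H 1 Rlt_0_1) as (d & Hd & Hb). pose proof (Cmod_ge_0 l) as Hl.
  assert (He' : 0 < eps / (1 + Cmod l)) by (apply Rdiv_lt_0_compat; lra).
  exists (Rmin d (eps / (1 + Cmod l))). split; [apply Rmin_pos; easy |]. intros h Hh.
  specialize (Hb h (Rlt_le_trans _ _ _ Hh (Rmin_l _ _))).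
  pose proof (Rlt_le_trans _ _ _ Hh (Rmin_r _ _)) as Hh2.
  replace (f (z + h) - f z)%C with ((f (z + h) - f z - l * h) + l * h)%C by ring.
  eapply Rle_lt_trans; [apply Cmod_triangle |]. rewrite Cmod_mult.
  apply Rle_lt_trans with (Cmod h * (1 + Cmod l)); [lra |].
  apply Rmult_lt_reg_r with (/ (1 + Cmod l)); [apply Rinv_0_lt_compat; lra |].
  rewrite Rmult_assoc, Rinv_r by lra. unfold Rdiv in Hh2; lra.
Qed.

Lemma Cderiv_ext (f g : C -> C) (z l l' : C) :
  (forall w, f w = g w) -> l = l' -> Cderiv f z l -> Cderiv g z l'.
Proof.
  intros E <- H. apply (is_derive_ext f); [exact E | exact H].
Qed.

Lemma Cderiv_plus (f g : C -> C) (z l k : C) :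
  Cderiv f z l -> Cderiv g z k -> Cderiv (fun w => f w + g w)%C z (l + k)%C.
Proof. exact (fun H K => is_derive_plus (K := C_AbsRing) (V := C_NormedModule) f g z l k H K). Qed.

(** The two canonical structures of normed module on [C] have the same norm. *)
Lemma Cderiv_ring (f : C -> C) (z l : C) :
  Cderiv f z l <-> @is_derive C_AbsRing (AbsRing_NormedModule C_AbsRing) f z l.
Proof.
  split; intros [_ H]; split; try apply is_linear_scal_l; exact H.
Qed.

Lemma Cderiv_mult (f g : C -> C) (z l k : C) :
  Cderiv f z l -> Cderiv g z k -> Cderiv (fun w => f w * g w)%C z (l * g z + f z * k)%C.
Proof.
  intros H K; apply Cderiv_ring in H, K; apply Cderiv_ring.
  exact (is_derive_mult (K := C_AbsRing) f g z l k H K Cmult_comm).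
Qed.

Lemma Cderiv_comp (f g : C -> C) (z l k : C) :
  Cderiv f (g z) l -> Cderiv g z k -> Cderiv (fun w => f (g w)) z (k * l)%C.
Proof.
  intros H K; apply Cderiv_ring in K.
  exact (is_derive_comp (K := C_AbsRing) (V := C_NormedModule) f g z l k H K).
Qed.

Lemma Cderiv_const (a z : C) : Cderiv (fun _ => a) z (RtoC 0).
Proof. exact (is_derive_const (K := C_AbsRing) (V := C_NormedModule) a z). Qed.

Lemma Cderiv_id (z : C) : Cderiv (fun w => w) z (RtoC 1).
Proof. apply Cderiv_ring. exact (is_derive_id (K := C_AbsRing) z). Qed.

Lemma Cderiv_Cexp (z : C) : Cderiv Cexp z (Cexp z).
Proof.
  apply is_derive_C_eps. intros eps He.
  pose proof (exp_pos (Re z)) as Hz. pose proof (exp_pos 1) as H1.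
  set (K := exp (Re z) * exp 1). assert (HK : 0 < K) by (apply Rmult_lt_0_compat; easy).
  exists (Rmin 1 (eps / K)). split.
  { apply Rmin_pos; [lra | apply Rdiv_lt_0_compat; easy]. }
  intros h Hh.
  assert (Hh1 : Cmod h < 1) by (eapply Rlt_le_trans; [exact Hh | apply Rmin_l]).
  assert (Hh2 : Cmod h < eps / K) by (eapply Rlt_le_trans; [exact Hh | apply Rmin_r]).
  rewrite Cexp_plus.
  replace (Cexp z * Cexp h - Cexp z - Cexp z * h)%C
    with (Cexp z * (Cexp h - 1 - h))%C by ring.
  rewrite Cmod_mult, Cmod_Cexp.
  pose proof (Cexp_taylor_le h) as Ht. pose proof (Cmod_ge_0 h) as H0.
  assert (He1 : exp (Cmod h) <= exp 1) by (apply exp_mono; lra).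
  assert (HE : Cmod h * K <= eps).
  { apply Rmult_le_reg_r with (/ K); [apply Rinv_0_lt_compat; easy |].
    rewrite Rmult_assoc, Rinv_r, Rmult_1_r by lra. left; exact Hh2. }
  apply Rle_trans with (exp (Re z) * (Cmod h * Cmod h * exp 1)).
  - apply Rmult_le_compat_l; [lra |]. eapply Rle_trans; [exact Ht |].
    apply Rmult_le_compat_l; [nra | easy].
  - replace (exp (Re z) * (Cmod h * Cmod h * exp 1)) with (Cmod h * K * Cmod h)
      by (unfold K; ring).
    apply Rmult_le_compat_r; easy.
Qed.

Lemma Cderiv_inv (z : C) : z <> 0 -> Cderiv Cinv z (- (/ z * / z))%C.
Proof.
  intros Hz. apply is_derive_C_eps. intros eps He.
  assert (Hm : 0 < Cmod z) by (apply Cmod_gt_0; exact Hz).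
  set (K := 2 / (Cmod z * Cmod z * Cmod z)).
  assert (HK : 0 < K) by (apply Rdiv_lt_0_compat; [lra | repeat apply Rmult_lt_0_compat; easy]).
  exists (Rmin (Cmod z / 2) (eps / K)). split.
  { apply Rmin_pos; [lra | apply Rdiv_lt_0_compat; easy]. }
  intros h Hh.
  assert (Hh1 : Cmod h < Cmod z / 2) by (eapply Rlt_le_trans; [exact Hh | apply Rmin_l]).
  assert (Hh2 : Cmod h < eps / K) by (eapply Rlt_le_trans; [exact Hh | apply Rmin_r]).
  assert (Hzh : Cmod z / 2 <= Cmod (z + h)).
  { pose proof (Cmod_triangle (z + h) (- h)) as HT. rewrite Cmod_opp in HT.
    replace (z + h + - h)%C with z in HT by ring. lra. }
  assert (Nzh : (z + h)%C <> 0) by (apply Cmod_gt_0; lra).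
  replace (/ (z + h) - / z - - (/ z * / z) * h)%C
    with (h * h * (/ z * / z * / (z + h)))%C by (field; split; auto).
  rewrite !Cmod_mult, !Cmod_inv by auto.
  assert (HE : Cmod h * K <= eps).
  { apply Rmult_le_reg_r with (/ K); [apply Rinv_0_lt_compat; easy |].
    rewrite Rmult_assoc, Rinv_r, Rmult_1_r by lra. left; exact Hh2. }
  pose proof (Cmod_ge_0 h) as H0.
  apply Rle_trans with (Cmod h * Cmod h * K).
  - apply Rmult_le_compat_l; [nra |].
    replace K with (/ Cmod z * / Cmod z * / (Cmod z / 2)) by (unfold K; field; lra).
    apply Rmult_le_compat_l.
    + pose proof (Rinv_0_lt_compat _ Hm); nra.
    + apply Rinv_le_contravar; lra.
  - rewrite Rmult_assoc, (Rmult_comm eps). apply Rmult_le_compat_l; easy.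
Qed.

(** The principal branch; the half-angle formula for the real part makes sense
    off the cut [Cmod p + Re p = 0], the closed negative half-line. *)
Definition Csqrt (p : C) : C :=
  (sqrt ((Cmod p + Re p) / 2), Im p / (2 * sqrt ((Cmod p + Re p) / 2))).

Lemma Re_Csqrt_pos (p : C) : 0 < Cmod p + Re p -> 0 < Re (Csqrt p).
Proof. intros H. apply sqrt_lt_R0; lra. Qed.

Lemma Csqrt_sqr (p : C) : 0 < Cmod p + Re p -> (Csqrt p * Csqrt p)%C = p.
Proof.
  intros H. pose proof (Cmod_mul_self p) as Hm. destruct p as [a b].
  unfold Csqrt, Cmult; unfold Re, Im in *; simpl in *.
  set (r := sqrt ((Cmod (a, b) + a) / 2)).
  assert (Hr : 0 < r) by (apply sqrt_lt_R0; lra).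
  assert (Hrr : r * r = (Cmod (a, b) + a) / 2) by (apply sqrt_sqrt; lra).
  f_equal; [| field; lra].
  replace (r * r - b / (2 * r) * (b / (2 * r))) with (r * r - b * b / (4 * (r * r)))
    by (field; lra).
  rewrite Hrr. replace (b * b) with (Cmod (a, b) * Cmod (a, b) - a * a) by lra.
  field; lra.
Qed.

Lemma Cmod_Csqrt (p : C) : 0 < Cmod p + Re p -> Cmod (Csqrt p) = sqrt (Cmod p).
Proof.
  intros H. rewrite <- (Csqrt_sqr p H) at 2. rewrite Cmod_mult, sqrt_square; [easy | apply Cmod_ge_0].
Qed.

Lemma Csqrt_real (a : R) : 0 < a -> Csqrt (RtoC a) = RtoC (sqrt a).
Proof.
  intros Ha. unfold Csqrt. rewrite Cmod_R, Rabs_pos_eq by lra.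
  unfold RtoC, Re, Im; simpl. f_equal; [f_equal; lra | unfold Rdiv; ring].
Qed.

Lemma Csqrt_domain_open (p : C) : 0 < Cmod p + Re p -> Clocally p (fun q => 0 < Cmod q + Re q).
Proof.
  intros H. apply Clocally_eps. exists ((Cmod p + Re p) / 2). split; [lra |].
  intros h Hh. pose proof (Cmod_triangle (p + h) (- h)) as HT. rewrite Cmod_opp in HT.
  replace (p + h + - h)%C with p in HT by ring.
  pose proof (re_le_Cmod h) as Hr. apply Rabs_le_between in Hr.
  replace (Re (p + h)) with (Re p + Re h) by easy. lra.
Qed.

(** Continuity comes for free from [(S q - S p) (S q + S p) = q - p] and
    [Re (S q + S p) >= Re (S p) > 0]. *)
Lemma Csqrt_lipschitz (p q : C) : 0 < Cmod p + Re p -> 0 < Cmod q + Re q ->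
  Re (Csqrt p) * Cmod (Csqrt q - Csqrt p) <= Cmod (q - p).
Proof.
  intros Hp Hq. rewrite <- (Csqrt_sqr p Hp) at 3. rewrite <- (Csqrt_sqr q Hq) at 2.
  replace (Csqrt q * Csqrt q - Csqrt p * Csqrt p)%C
    with ((Csqrt q + Csqrt p) * (Csqrt q - Csqrt p))%C by ring.
  rewrite Cmod_mult. apply Rmult_le_compat_r; [apply Cmod_ge_0 |].
  pose proof (Re_Csqrt_pos q Hq).
  eapply Rle_trans; [| apply (Rle_trans _ _ _ (Rle_abs _) (re_le_Cmod _))].
  replace (Re (Csqrt q + Csqrt p)) with (Re (Csqrt q) + Re (Csqrt p)) by easy. lra.
Qed.

(** From [h = (S q - S p) (S q + S p)] with [q = p + h], the error term is
    [h (S q - S p)] divided by a quantity bounded below by [2 (Re (S p)) ^ 2]. *)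
Lemma Cderiv_Csqrt (p : C) : 0 < Cmod p + Re p ->
  Cderiv Csqrt p (/ (2 * Csqrt p))%C.
Proof.
  intros Hp. apply is_derive_C_eps. intros eps He.
  set (r := Re (Csqrt p)). assert (Hr : 0 < r) by (apply Re_Csqrt_pos, Hp).
  destruct (proj1 (Clocally_eps _ _) (Csqrt_domain_open p Hp)) as (d & Hd & Hcut).
  assert (Hr3 : 0 < r * (r * r)) by (repeat apply Rmult_lt_0_compat; easy).
  exists (Rmin d (eps * (r * (r * r)))). split.
  { apply Rmin_pos; [easy | apply Rmult_lt_0_compat; easy]. }
  intros h Hh.
  assert (Hh1 : Cmod h < d) by (eapply Rlt_le_trans; [exact Hh | apply Rmin_l]).
  assert (Hh2 : Cmod h < eps * (r * (r * r))) by (eapply Rlt_le_trans; [exact Hh | apply Rmin_r]).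
  specialize (Hcut h Hh1). set (q := (p + h)%C) in *.
  assert (HRe : forall z : C, Re z <= Cmod z).
  { intros z. exact (Rle_trans _ _ _ (Rle_abs _) (re_le_Cmod _)). }
  assert (H1 : r <= Cmod (Csqrt p)) by apply HRe.
  assert (H2 : r <= Cmod (Csqrt q + Csqrt p)).
  { eapply Rle_trans; [| apply HRe].
    replace (Re (Csqrt q + Csqrt p)) with (Re (Csqrt q) + Re (Csqrt p)) by easy.
    pose proof (Re_Csqrt_pos q Hcut). unfold r; lra. }
  assert (N1 : Csqrt p <> 0) by (apply Cmod_gt_0; lra).
  assert (N2 : (Csqrt q + Csqrt p)%C <> 0) by (apply Cmod_gt_0; lra).
  assert (Eh : h = ((Csqrt q + Csqrt p) * (Csqrt q - Csqrt p))%C).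
  { replace ((Csqrt q + Csqrt p) * (Csqrt q - Csqrt p))%C
      with (Csqrt q * Csqrt q - Csqrt p * Csqrt p)%C by ring.
    rewrite !Csqrt_sqr by easy. unfold q; ring. }
  replace (Csqrt q - Csqrt p - / (2 * Csqrt p) * h)%C
    with (- (h * (Csqrt q - Csqrt p) * / (2 * Csqrt p * (Csqrt q + Csqrt p))))%C.
  2: { rewrite Eh. field. repeat split; auto. }
  pose proof (Csqrt_lipschitz p q Hp Hcut) as HL.
  replace (q - p)%C with h in HL by (unfold q; ring). fold r in HL.
  rewrite Cmod_opp, !Cmod_mult, Cmod_inv, !Cmod_mult, Cmod_R. rewrite Rabs_pos_eq by lra.
  set (s := Cmod (Csqrt q - Csqrt p)) in *. pose proof (Cmod_ge_0 h) as H0.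
  assert (Hs : 0 <= s) by apply Cmod_ge_0.
  assert (HI : / (2 * Cmod (Csqrt p) * Cmod (Csqrt q + Csqrt p)) <= / (r * r)).
  { apply Rinv_le_contravar; nra. }
  assert (HS : s * / (r * r) <= eps).
  { apply Rmult_le_reg_r with (r * (r * r)); [easy |].
    replace (s * / (r * r) * (r * (r * r))) with (r * s) by (field; lra). lra. }
  apply Rle_trans with (Cmod h * (s * / (r * r))).
  - rewrite Rmult_assoc. apply Rmult_le_compat_l; [easy |]. apply Rmult_le_compat_l; easy.
  - rewrite (Rmult_comm eps). apply Rmult_le_compat_l; easy.
  - repeat apply Cmult_neq_0; auto. intros E; apply RtoC_inj in E; lra.
Qed.

(** Continuity of the derivative is part of the notion because Cauchy's theorem
    is obtained below by differentiating under the integral sign. *)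
Definition holo (f : C -> C) (z : C) : Prop :=
  exists df : C -> C, Clocally z (fun w => Cderiv f w (df w)) /\ Ccont df z.

Lemma holo_deriv (f : C -> C) (z : C) : holo f z -> exists l, Cderiv f z l.
Proof.
  intros (df & H & _). exists (df z).
  apply (@locally_singleton (AbsRing_UniformSpace C_AbsRing) z _ H).
Qed.

Lemma holo_cont (f : C -> C) (z : C) : holo f z -> Ccont f z.
Proof. intros H; destruct (holo_deriv f z H) as [l Hl]; apply (Cderiv_cont f z l Hl). Qed.

Lemma Ccont_const (a z : C) : Ccont (fun _ => a) z.
Proof.
  exact (continuous_const (U := AbsRing_UniformSpace C_AbsRing)
    (V := AbsRing_UniformSpace C_AbsRing) a z).
Qed.

Lemma holo_const (a z : C) : holo (fun _ => a) z.
Proof.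
  exists (fun _ => RtoC 0). split; [| apply Ccont_const].
  apply filter_forall. intros w; apply Cderiv_const.
Qed.

Lemma holo_id (z : C) : holo (fun w => w) z.
Proof.
  exists (fun _ => RtoC 1). split; [| apply Ccont_const].
  apply filter_forall. intros w; apply Cderiv_id.
Qed.

Lemma Ccont_plus (f g : C -> C) (z : C) :
  Ccont f z -> Ccont g z -> Ccont (fun w => f w + g w)%C z.
Proof.
  intros H K. apply Ccont_eps; intros eps He.
  destruct (proj1 (Ccont_eps f z) H (eps / 2) ltac:(lra)) as (d1 & Hd1 & H1).
  destruct (proj1 (Ccont_eps g z) K (eps / 2) ltac:(lra)) as (d2 & Hd2 & H2).
  exists (Rmin d1 d2). split; [apply Rmin_pos; easy |]. intros h Hh.
  specialize (H1 h (Rlt_le_trans _ _ _ Hh (Rmin_l _ _))).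
  specialize (H2 h (Rlt_le_trans _ _ _ Hh (Rmin_r _ _))).
  replace (f (z + h) + g (z + h) - (f z + g z))%C
    with ((f (z + h) - f z) + (g (z + h) - g z))%C by ring.
  eapply Rle_lt_trans; [apply Cmod_triangle | lra].
Qed.

Lemma Ccont_mult (f g : C -> C) (z : C) :
  Ccont f z -> Ccont g z -> Ccont (fun w => f w * g w)%C z.
Proof.
  exact (fun H K => continuous_mult (U := AbsRing_UniformSpace C_AbsRing) (K := C_AbsRing) f g z H K).
Qed.

Lemma Ccont_comp (f g : C -> C) (z : C) :
  Ccont g z -> Ccont f (g z) -> Ccont (fun w => f (g w)) z.
Proof. 
  exact (fun H K => continuous_comp (U := AbsRing_UniformSpace C_AbsRing)
    (V := AbsRing_UniformSpace C_AbsRing) (W := AbsRing_UniformSpace C_AbsRing) g f z H K). Qed.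

Lemma holo_plus (f g : C -> C) (z : C) : holo f z -> holo g z -> holo (fun w => f w + g w)%C z.
Proof.
  intros (df & Hf & Cf) (dg & Hg & Cg). exists (fun w => df w + dg w)%C. split.
  - generalize (filter_and _ _ Hf Hg). apply filter_imp. intros w [H K].
    apply Cderiv_plus; easy.
  - apply Ccont_plus; easy.
Qed.

Lemma holo_mult (f g : C -> C) (z : C) : holo f z -> holo g z -> holo (fun w => f w * g w)%C z.
Proof.
  intros HCf HCg. pose proof (holo_cont f z HCf). pose proof (holo_cont g z HCg).
  destruct HCf as (df & Hf & Cf), HCg as (dg & Hg & Cg).
  exists (fun w => df w * g w + f w * dg w)%C. split.
  - generalize (filter_and _ _ Hf Hg). apply filter_imp. intros w [H1 K1].
    apply Cderiv_mult; easy.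
  - apply Ccont_plus; apply Ccont_mult; easy.
Qed.

Lemma holo_comp (f g : C -> C) (z : C) : holo g z -> holo f (g z) -> holo (fun w => f (g w)) z.
Proof.
  intros HCg. pose proof (holo_cont g z HCg) as Hc.
  intros (df & Hf & Cf). destruct HCg as (dg & Hg & Cg).
  exists (fun w => dg w * df (g w))%C. split.
  - assert (Hfg : Clocally z (fun w => Cderiv f (g w) (df (g w)))) by exact (Hc _ Hf).
    generalize (filter_and _ _ Hfg Hg). apply filter_imp. intros w [H1 K1].
    apply Cderiv_comp; easy.
  - apply Ccont_mult; [easy |]. apply Ccont_comp; easy.
Qed.

Lemma holo_Cexp (z : C) : holo Cexp z.
Proof.
  exists Cexp. split; [apply filter_forall; apply Cderiv_Cexp |].
  eapply Cderiv_cont, Cderiv_Cexp.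
Qed.

Lemma holo_opp (f : C -> C) (z : C) : holo f z -> holo (fun w => - f w)%C z.
Proof.
  intros (df & Hf & Cf). exists (fun w => -1 * df w)%C. split.
  - revert Hf. apply filter_imp. intros w Hw.
    apply (Cderiv_ext (fun w => -1 * f w)%C _ w (0 * f w + -1 * df w)%C).
    + intros; ring.
    + ring.
    + apply Cderiv_mult; [apply Cderiv_const | easy].
  - apply Ccont_mult; [apply Ccont_const | easy].
Qed.

Lemma holo_minus (f g : C -> C) (z : C) : holo f z -> holo g z -> holo (fun w => f w - g w)%C z.
Proof. intros Hf Hg. apply holo_plus; [easy | apply holo_opp; easy]. Qed.

Lemma holo_Cinv (z : C) : z <> 0 -> holo Cinv z.
Proof.
  intros Hz. exists (fun w => - (/ w * / w))%C.
  pose proof (Cderiv_cont _ _ _ (Cderiv_inv z Hz)) as Hc. split.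
  - assert (Hm : 0 < Cmod z) by (apply Cmod_gt_0; exact Hz).
    apply Clocally_eps. exists (Cmod z); split; [easy |]. intros h Hh. apply Cderiv_inv.
    apply Cmod_gt_0. pose proof (Cmod_triangle (z + h) (- h)) as HT. rewrite Cmod_opp in HT.
    replace (z + h + - h)%C with z in HT by ring. lra.
  - apply (Ccont_comp Copp (fun w => / w * / w)%C).
    + apply Ccont_mult; exact Hc.
    + apply holo_cont, holo_opp, holo_id.
Qed.

Lemma holo_div (f g : C -> C) (z : C) : holo f z -> holo g z -> g z <> 0 ->
  holo (fun w => f w / g w)%C z.
Proof.
  intros Hf Hg N. apply holo_mult; [easy |]. apply (holo_comp Cinv g); [easy |].
  apply holo_Cinv, N.
Qed.

Lemma holo_Csqrt (p : C) : 0 < Cmod p + Re p -> holo Csqrt p.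
Proof.
  intros Hp. exists (fun w => / (2 * Csqrt w))%C. split.
  - generalize (Csqrt_domain_open p Hp). apply filter_imp. intros q; apply Cderiv_Csqrt.
  - apply (Ccont_comp Cinv (fun w => 2 * Csqrt w)%C).
    + apply Ccont_mult; [apply Ccont_const |].
      eapply Cderiv_cont, Cderiv_Csqrt, Hp.
    + apply holo_cont, holo_Cinv. apply Cmod_gt_0. rewrite Cmod_mult, Cmod_R, Rabs_pos_eq by lra.
      rewrite Cmod_Csqrt by easy. apply Rmult_lt_0_compat; [lra |]. apply sqrt_lt_R0.
      pose proof (Rle_trans _ _ _ (Rle_abs _) (re_le_Cmod p)). lra.
Qed.

Lemma Cderiv_line (f : C -> C) (z v l : C) (t : R) : Cderiv f (z + RtoC t * v)%C l ->
  is_derive (fun u : R => Re (f (z + RtoC u * v)%C)) t (Re (l * v)) /\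
  is_derive (fun u : R => Im (f (z + RtoC u * v)%C)) t (Im (l * v)).
Proof.
  intros H. rewrite is_derive_C_eps in H.
  assert (HE : forall eps, 0 < eps -> exists d : posreal, forall h, h <> 0 -> Rabs h < d ->
    Cmod ((f (z + RtoC (t + h) * v) - f (z + RtoC t * v)) / h - l * v)%C < eps).
  { intros eps He. pose proof (Cmod_ge_0 v) as Hv.
    destruct (H (eps / (2 * (Cmod v + 1)))) as (d & Hd & Hb).
    { apply Rdiv_lt_0_compat; lra. }
    assert (Hd' : 0 < d / (Cmod v + 1)) by (apply Rdiv_lt_0_compat; lra).
    exists (mkposreal _ Hd'). simpl. intros h Nh Hh.
    assert (Hm : Cmod (RtoC h * v) = Rabs h * Cmod v) by (rewrite Cmod_mult, Cmod_R; easy).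
    pose proof (Rabs_pos_lt h Nh) as Hp.
    assert (Hhv : Cmod (RtoC h * v) < d).
    { rewrite Hm. apply Rle_lt_trans with (Rabs h * (Cmod v + 1)); [nra |].
      apply Rmult_lt_reg_r with (/ (Cmod v + 1)); [apply Rinv_0_lt_compat; lra |].
      rewrite Rmult_assoc, Rinv_r by lra. unfold Rdiv in Hh; lra. }
    specialize (Hb _ Hhv). rewrite Hm in Hb.
    replace (z + RtoC t * v + RtoC h * v)%C with (z + RtoC (t + h) * v)%C in Hb
      by (rewrite RtoC_plus; ring).
    assert (NhC : RtoC h <> RtoC 0) by (intros E; apply Nh, RtoC_inj, E).
    replace ((f (z + RtoC (t + h) * v) - f (z + RtoC t * v)) / h - l * v)%C
      with ((f (z + RtoC (t + h) * v) - f (z + RtoC t * v) - l * (RtoC h * v)) / h)%C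
      by (field; exact NhC).
    rewrite Cmod_div, Cmod_R by exact NhC.
    apply Rle_lt_trans with (eps / (2 * (Cmod v + 1)) * Cmod v).
    - apply Rmult_le_reg_r with (Rabs h); [easy |].
      unfold Rdiv at 1. rewrite (Rmult_assoc _ (/ Rabs h)), Rinv_l by lra. lra.
    - apply Rmult_lt_reg_r with (2 * (Cmod v + 1)); [lra |].
      replace (eps / (2 * (Cmod v + 1)) * Cmod v * (2 * (Cmod v + 1))) with (eps * Cmod v)
        by (field; lra). nra. }
  split; apply is_derive_Reals; intros eps He; destruct (HE eps He) as [d Hd];
    exists d; intros h Nh Hh; specialize (Hd h Nh Hh);
    eapply Rle_lt_trans; try exact Hd.
  - eapply Rle_trans; [| apply re_le_Cmod]. right. f_equal.
    destruct (f (z + RtoC (t + h) * v)%C) as [a b], (f (z + RtoC t * v)%C) as [p q].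
    destruct (l * v)%C as [m n].
    unfold Cdiv, Cinv, Cminus, Cplus, Cmult, Copp, RtoC, Re, Im; simpl. field. easy.
  - eapply Rle_trans; [| apply im_le_Cmod]. right. f_equal.
    destruct (f (z + RtoC (t + h) * v)%C) as [a b], (f (z + RtoC t * v)%C) as [p q].
    destruct (l * v)%C as [m n].
    unfold Cdiv, Cinv, Cminus, Cplus, Cmult, Copp, RtoC, Re, Im; simpl. field. easy.
Qed.

Lemma Ccont_2d (f : C -> C) (u y : R) : Ccont f (u, y) ->
  continuity_2d_pt (fun a b => Re (f (a, b))) u y /\
  continuity_2d_pt (fun a b => Im (f (a, b))) u y.
Proof.
  intros H. rewrite Ccont_eps in H.
  assert (HE : forall eps : posreal, exists d : posreal, forall a b,
    Rabs (a - u) < d -> Rabs (b - y) < d -> Cmod (f (a, b) - f (u, y))%C < eps).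
  { intros eps. destruct (H eps (cond_pos eps)) as (d & Hd & Hb).
    assert (Hd2 : 0 < d / 2) by lra. exists (mkposreal _ Hd2). simpl. intros a b Ha Hb'.
    specialize (Hb (a - u, b - y)).
    replace (Cplus (u, y) (a - u, b - y)) with (a, b) in Hb
      by (unfold Cplus; simpl; f_equal; ring).
    apply Hb.
    replace (a - u, b - y) with (RtoC (a - u) + Ci * RtoC (b - y))%C
      by (unfold Cplus, Cmult, Ci, RtoC; simpl; f_equal; ring).
    eapply Rle_lt_trans; [apply Cmod_triangle |].
    rewrite Cmod_mult, !Cmod_R, Cmod_Ci. lra. }
  split; intros eps; destruct (HE eps) as [d Hd]; exists d; intros a b Ha Hb;
    (eapply Rle_lt_trans; [| apply (Hd a b Ha Hb)]).
  - eapply Rle_trans; [| apply re_le_Cmod]. right; easy.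
  - eapply Rle_trans; [| apply im_le_Cmod]. right; easy.
Qed.

Local Notation Rcont := (@continuous R_UniformSpace (AbsRing_UniformSpace C_AbsRing)).

Lemma Rcont_parts (f : R -> C) (u : R) : Rcont f u ->
  continuous (fun t => Re (f t)) u /\ continuous (fun t => Im (f t)) u.
Proof.
  intros H.
  assert (HE : forall eps : posreal, locally u (fun t => Cmod (f t - f u)%C < eps)).
  { intros eps. apply (H (fun w => Cmod (w - f u)%C < eps)). exists eps. intros w Hw; exact Hw. }
  split; intros P [eps He]; refine (filter_imp _ _ _ (HE eps)); intros t Ht; apply He;
    (eapply Rle_lt_trans; [| exact Ht]).
  - eapply Rle_trans; [| apply re_le_Cmod]. right; easy.
  - eapply Rle_trans; [| apply im_le_Cmod]. right; easy.
Qed.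

Lemma Rcont_comp (F : C -> C) (f : R -> C) (u : R) :
  Rcont f u -> Ccont F (f u) -> Rcont (fun t => F (f t)) u.
Proof.
  exact (fun H K => continuous_comp (U := R_UniformSpace)
    (V := AbsRing_UniformSpace C_AbsRing) (W := AbsRing_UniformSpace C_AbsRing) f F u H K).
Qed.

Lemma Rcont_mult (f g : R -> C) (u : R) :
  Rcont f u -> Rcont g u -> Rcont (fun t => f t * g t)%C u.
Proof.
  exact (fun H K => continuous_mult (U := R_UniformSpace) (K := C_AbsRing) f g u H K).
Qed.

Lemma Rcont_plus (f g : R -> C) (u : R) :
  Rcont f u -> Rcont g u -> Rcont (fun t => f t + g t)%C u.
Proof.
  exact (fun H K => continuous_plus (U := R_UniformSpace)
    (V := AbsRing_NormedModule C_AbsRing) f g u H K).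
Qed.

Lemma Rcont_const (a : C) (u : R) : Rcont (fun _ => a) u.
Proof.
  exact (continuous_const (U := R_UniformSpace) (V := AbsRing_UniformSpace C_AbsRing) a u).
Qed.

Lemma Rcont_horizontal (y u : R) : Rcont (fun t => (t, y) : C) u.
Proof.
  intros P [eps He]. exists eps. intros t Ht. apply He.
  change (Cmod (Cplus (t, y) (Copp (u, y))) < eps).
  assert (E : Cplus (t, y) (Copp (u, y)) = RtoC (t - u))
    by (unfold Cplus, Copp, RtoC; simpl; f_equal; ring).
  rewrite E, Cmod_R. exact Ht.
Qed.

(** * Absolutely convergent integrals over the line *)

(** Symmetric truncations are harmless here, because only absolutely convergent
    integrals occur. *)
Definition line_int (f : R -> R) : R := real (Lim_seq (fun n => RInt f (- INR n) (INR n))).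

Definition line_cint (f : R -> C) : C := (line_int (fun u => Re (f u)), line_int (fun u => Im (f u))).

Lemma RInt_symm (f : R -> R) (a : R) : (forall u, continuous f u) -> 0 <= a ->
  RInt f (- a) a = RInt (fun u => f u + f (- u)) 0 a.
Proof.
  intros Hf Ha.
  assert (Ho : forall u, continuous (fun u => f (- u)) u).
  { intros u. apply (continuous_comp Ropp f); [| apply Hf].
    apply (continuous_opp (fun u : R => u)), continuous_id. }
  assert (Hex : forall g x y, (forall u, continuous g u) -> ex_RInt g x y)
    by (intros g x y Hg; apply (@ex_RInt_continuous R_CompleteNormedModule); intros; apply Hg).
  rewrite (RInt_plus (V := R_CompleteNormedModule) f (fun u => f (- u))) by (apply Hex; easy).
  rewrite <- (RInt_Chasles f (- a) 0 a) by (apply Hex; easy).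
  assert (E : RInt f (- a) 0 = RInt (fun u => f (- u)) 0 a).
  { assert (H1 : is_RInt f (- a) (- 0) (RInt f (- a) 0)).
    { rewrite Ropp_0. apply (RInt_correct (V := R_CompleteNormedModule) f), Hex; easy. }
    apply is_RInt_comp_opp, is_RInt_opp, is_RInt_swap in H1.
    rewrite <- (opp_opp (RInt f (- a) 0)). symmetry.
    apply (is_RInt_unique (V := R_CompleteNormedModule)).
    apply (is_RInt_ext (fun y => opp (opp (f (- y))))); [| exact H1].
    intros u _; apply opp_opp. }
  rewrite E. unfold plus; simpl. ring.
Qed.

Lemma RInt_exp_le (f : R -> R) (b M x y : R) : 0 < b -> 0 <= x <= y ->
  (forall u, continuous f u) -> (forall u, 0 <= u -> Rabs (f u) <= M * exp (- b * u)) ->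
  Rabs (RInt f x y) <= M / b * exp (- b * x).
Proof.
  intros Hb Hxy Hf HM.
  assert (HM0 : 0 <= M).
  { specialize (HM 0 (Rle_refl 0)). rewrite Rmult_0_r, exp_0 in HM.
    pose proof (Rabs_pos (f 0)); lra. }
  assert (HI : is_RInt (fun u => M * exp (- b * u)) x y
    (minus (- M / b * exp (- b * y)) (- M / b * exp (- b * x)))).
  { apply (is_RInt_derive (fun u => - M / b * exp (- b * u))).
    - intros u _. auto_derive; trivial. field; lra.
    - intros u _. apply (ex_derive_continuous (V := R_NormedModule)). auto_derive; trivial. }
  eapply Rle_trans.
  - apply (abs_RInt_le f x y (proj2 Hxy)).
    apply (@ex_RInt_continuous R_CompleteNormedModule); intros; apply Hf.
  - eapply Rle_trans.
    + apply (RInt_le _ (fun u => M * exp (- b * u)) x y); [easy | | |].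
      * apply (@ex_RInt_continuous R_CompleteNormedModule); intros.
        apply (continuous_comp f Rabs); [apply Hf | apply continuous_Rabs].
      * eexists; apply HI.
      * intros u Hu. apply HM. lra.
    + rewrite (is_RInt_unique _ _ _ _ HI). unfold minus, plus, opp; simpl.
      pose proof (exp_pos (- b * y)) as Hp.
      assert (0 <= M / b) by (apply Rmult_le_pos; [easy | left; apply Rinv_0_lt_compat; easy]).
      assert (0 <= M / b * exp (- b * y)) by (apply Rmult_le_pos; lra).
      unfold Rdiv in *; lra.
Qed.

Lemma exp_INR_small (b eps : R) : 0 < b -> 0 < eps -> exists N, forall n, (N <= n)%nat -> exp (- b * INR n) < eps.
Proof.
  intros Hb He.
  destruct (INR_unbounded (- ln eps / b)) as [N HN]. exists N. intros n Hn.
  rewrite <- (exp_ln eps He). apply exp_increasing.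
  apply le_INR in Hn.
  assert (HN' : - ln eps / b < INR n) by lra.
  apply (Rmult_lt_compat_l b) in HN'; [| easy].
  replace (b * (- ln eps / b)) with (- ln eps) in HN' by (field; lra). lra.
Qed.

Section RealLine.
Variables (b M : R) (f : R -> R).
Hypothesis (Hb : 0 < b) (Hf : forall u, continuous f u)
  (HM : forall u, Rabs (f u) <= M * exp (- b * Rabs u)).

Let h u := f u + f (- u).

Local Lemma sym_cont u : continuous h u.
Proof.
  apply (continuous_plus (V := R_NormedModule) f (fun u => f (- u))); [apply Hf |].
  apply (continuous_comp Ropp f); [| apply Hf].
  apply (continuous_opp (fun u : R => u)), continuous_id.
Qed.

Local Lemma sym_le u : 0 <= u -> Rabs (h u) <= 2 * M * exp (- b * u).
Proof.
  intros Hu. unfold h. pose proof (HM u) as H1. pose proof (HM (- u)) as H2.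
  rewrite Rabs_Ropp in H2. rewrite (Rabs_pos_eq u) in H1, H2 by easy.
  pose proof (Rabs_triang (f u) (f (- u))). lra.
Qed.

Lemma line_int_correct : is_lim_seq (fun n => RInt f (- INR n) (INR n)) (line_int f).
Proof.
  assert (Hc : ex_finite_lim_seq (fun n => RInt f (- INR n) (INR n))).
  { apply ex_lim_seq_cauchy_corr. intros [eps He]; simpl.
    assert (HM0 : 0 <= M).
    { specialize (HM 0). rewrite Rabs_R0, Rmult_0_r, exp_0 in HM.
      pose proof (Rabs_pos (f 0)); lra. }
    assert (HK : 0 < 2 * M / b + 1).
    { assert (0 <= 2 * M / b) by (apply Rmult_le_pos; [lra | left; apply Rinv_0_lt_compat; easy]). lra. }
    destruct (exp_INR_small b (eps / (2 * M / b + 1)) Hb) as [N HN].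
    { apply Rdiv_lt_0_compat; easy. }
    exists N.
    assert (HW : forall n m, (N <= n)%nat -> (n <= m)%nat ->
      Rabs (RInt f (- INR m) (INR m) - RInt f (- INR n) (INR n)) < eps).
    { intros n m Hn Hnm.
      rewrite !RInt_symm by (try apply pos_INR; apply Hf). fold h.
      rewrite <- (RInt_Chasles h 0 (INR n) (INR m))
        by (apply (@ex_RInt_continuous R_CompleteNormedModule); intros; apply sym_cont).
      assert (Ep : forall p q : R, plus p q - p = q) by (intros p q; unfold plus; simpl; ring).
      rewrite Ep.
      eapply Rle_lt_trans.
      - apply (RInt_exp_le h b (2 * M)); [easy | | apply sym_cont | apply sym_le].
        split; [apply pos_INR | apply le_INR; easy].
      - specialize (HN n Hn). pose proof (exp_pos (- b * INR n)).
        apply (Rmult_lt_compat_r (2 * M / b + 1)) in HN; [| easy].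
        replace (eps / (2 * M / b + 1) * (2 * M / b + 1)) with eps in HN by (unfold Rdiv; rewrite Rmult_assoc, Rinv_l by (unfold Rdiv in HK; lra); ring).
        lra. }
    intros n m Hn Hm. destruct (Nat.le_ge_cases n m) as [L | L].
    - rewrite Rabs_minus_sym. apply HW; easy.
    - apply HW; easy. }
  apply Lim_seq_correct' in Hc. exact Hc.
Qed.

Lemma line_int_le : Rabs (line_int f) <= 2 * M / b.
Proof.
  pose proof (is_lim_seq_abs _ _ line_int_correct) as HL. simpl in HL.
  assert (HS : Rbar_le (Rabs (line_int f)) (2 * M / b)).
  { eapply is_lim_seq_le; [| exact HL | apply is_lim_seq_const].
    intros n; simpl. rewrite RInt_symm by (try apply pos_INR; apply Hf). fold h.
    eapply Rle_trans.
    - apply (RInt_exp_le h b (2 * M)); [easy | | apply sym_cont | apply sym_le].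
      split; [lra | apply pos_INR].
    - rewrite Rmult_0_r, exp_0. lra. }
  exact HS.
Qed.
End RealLine.

Lemma line_int_unique (f : R -> R) (l : R) :
  is_lim_seq (fun n => RInt f (- INR n) (INR n)) l -> line_int f = l.
Proof. intros H. unfold line_int. rewrite (is_lim_seq_unique _ _ H). easy. Qed.

(** With [u = ln |s|] the weight [exp (- b |u|)] is [min (|s|^b, |s|^-b)]: an
    integrand in this class is absolutely integrable against [ds / s] near [0] and
    near infinity. *)
Record dominated (b M : R) (f : R -> C) : Prop := {
  dom_rate : 0 < b;
  dom_cont : forall u, Rcont f u;
  dom_le : forall u, Cmod (f u) <= M * exp (- b * Rabs u)
}.

Lemma dom_Re (b M : R) (f : R -> C) : dominated b M f ->
  is_lim_seq (fun n => RInt (fun u => Re (f u)) (- INR n) (INR n)) (line_int (fun u => Re (f u))).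
Proof.
  intros [Hb Hc Hl]. apply (line_int_correct b M); [easy | |].
  - intros u; apply (Rcont_parts f u (Hc u)).
  - intros u; eapply Rle_trans; [apply re_le_Cmod | apply Hl].
Qed.

Lemma dom_Im (b M : R) (f : R -> C) : dominated b M f ->
  is_lim_seq (fun n => RInt (fun u => Im (f u)) (- INR n) (INR n)) (line_int (fun u => Im (f u))).
Proof.
  intros [Hb Hc Hl]. apply (line_int_correct b M); [easy | |].
  - intros u; apply (Rcont_parts f u (Hc u)).
  - intros u; eapply Rle_trans; [apply im_le_Cmod | apply Hl].
Qed.

Lemma Cmod_le_parts (z : C) : Cmod z <= Rabs (Re z) + Rabs (Im z).
Proof.
  destruct z as [x y]; simpl.
  assert (E : (x, y) = (RtoC x + Ci * RtoC y)%C)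
    by (unfold Cplus, Cmult, Ci, RtoC; simpl; f_equal; ring).
  apply Rle_trans with (Cmod (RtoC x) + Cmod (Ci * RtoC y)).
  - rewrite E at 1. apply Cmod_triangle.
  - rewrite Cmod_mult, Cmod_Ci, !Cmod_R. unfold Re, Im; simpl. lra.
Qed.

Lemma line_cint_le (b M : R) (f : R -> C) : dominated b M f -> Cmod (line_cint f) <= 4 * M / b.
Proof.
  intros [Hb Hc Hl]. eapply Rle_trans; [apply Cmod_le_parts |].
  assert (H1 : Rabs (line_int (fun u => Re (f u))) <= 2 * M / b).
  { apply line_int_le; [easy | |].
    - intros u; apply (Rcont_parts f u (Hc u)).
    - intros u; eapply Rle_trans; [apply re_le_Cmod | apply Hl]. }
  assert (H2 : Rabs (line_int (fun u => Im (f u))) <= 2 * M / b).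
  { apply line_int_le; [easy | |].
    - intros u; apply (Rcont_parts f u (Hc u)).
    - intros u; eapply Rle_trans; [apply im_le_Cmod | apply Hl]. }
  unfold line_cint; simpl. unfold Rdiv in *; lra.
Qed.

Lemma line_int_ext (f g : R -> R) : (forall u, f u = g u) -> line_int f = line_int g.
Proof.
  intros E. unfold line_int. f_equal. apply Lim_seq_ext; intros n.
  apply RInt_ext; intros; apply E.
Qed.

Lemma line_cint_ext (f g : R -> C) : (forall u, f u = g u) -> line_cint f = line_cint g.
Proof.
  intros E. unfold line_cint. f_equal; apply line_int_ext; intros u; rewrite E; easy.
Qed.

Lemma dom_ex (b M : R) (f : R -> C) (x y : R) : dominated b M f ->
  ex_RInt (fun u => Re (f u)) x y /\ ex_RInt (fun u => Im (f u)) x y.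
Proof.
  intros [Hb Hc Hl]. split; apply (@ex_RInt_continuous R_CompleteNormedModule);
    intros u _; apply (Rcont_parts f u (Hc u)).
Qed.

Lemma line_int_lin (f g : R -> R) (p q lf lg : R) :
  (forall x y, ex_RInt f x y) -> (forall x y, ex_RInt g x y) ->
  is_lim_seq (fun n => RInt f (- INR n) (INR n)) lf ->
  is_lim_seq (fun n => RInt g (- INR n) (INR n)) lg ->
  line_int (fun u => p * f u + q * g u) = p * lf + q * lg.
Proof.
  intros Ef Eg Hf Hg. apply line_int_unique.
  apply is_lim_seq_ext with
    (fun n => p * RInt f (- INR n) (INR n) + q * RInt g (- INR n) (INR n)).
  - intros n. symmetry.
    rewrite (RInt_plus (V := R_CompleteNormedModule) (fun u => p * f u) (fun u => q * g u)).
    + rewrite (RInt_scal (V := R_CompleteNormedModule) f) by apply Ef.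
      rewrite (RInt_scal (V := R_CompleteNormedModule) g) by apply Eg. easy.
    + apply (ex_RInt_scal (V := R_NormedModule) f), Ef.
    + apply (ex_RInt_scal (V := R_NormedModule) g), Eg.
  - apply (is_lim_seq_plus' _ _ (p * lf) (q * lg)).
    + apply (is_lim_seq_scal_l _ p lf Hf).
    + apply (is_lim_seq_scal_l _ q lg Hg).
Qed.

Lemma line_cint_plus (b M b' M' : R) (f g : R -> C) : dominated b M f -> dominated b' M' g ->
  line_cint (fun u => f u + g u)%C = (line_cint f + line_cint g)%C.
Proof.
  intros Hf Hg. unfold line_cint, Cplus; simpl.
  f_equal.
  - rewrite (line_int_ext _ (fun u => 1 * Re (f u) + 1 * Re (g u))) by (intros; unfold Re, Cplus; simpl; ring).
    rewrite (line_int_lin (fun u => Re (f u)) (fun u => Re (g u)) 1 1 _ _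
      (fun x y => proj1 (dom_ex _ _ f x y Hf)) (fun x y => proj1 (dom_ex _ _ g x y Hg))
      (dom_Re _ _ f Hf) (dom_Re _ _ g Hg)). ring.
  - rewrite (line_int_ext _ (fun u => 1 * Im (f u) + 1 * Im (g u))) by (intros; unfold Im, Cplus; simpl; ring).
    rewrite (line_int_lin (fun u => Im (f u)) (fun u => Im (g u)) 1 1 _ _
      (fun x y => proj2 (dom_ex _ _ f x y Hf)) (fun x y => proj2 (dom_ex _ _ g x y Hg))
      (dom_Im _ _ f Hf) (dom_Im _ _ g Hg)). ring.
Qed.

Lemma line_cint_scal (b M : R) (a : C) (f : R -> C) : dominated b M f ->
  line_cint (fun u => a * f u)%C = (a * line_cint f)%C.
Proof.
  intros Hf. unfold line_cint, Cmult; simpl.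
  f_equal.
  - rewrite (line_int_ext _ (fun u => fst a * Re (f u) + - snd a * Im (f u)))
      by (intros; unfold Re, Im, Cmult; simpl; ring).
    rewrite (line_int_lin (fun u => Re (f u)) (fun u => Im (f u)) _ _ _ _
      (fun x y => proj1 (dom_ex _ _ f x y Hf)) (fun x y => proj2 (dom_ex _ _ f x y Hf))
      (dom_Re _ _ f Hf) (dom_Im _ _ f Hf)). ring.
  - rewrite (line_int_ext _ (fun u => fst a * Im (f u) + snd a * Re (f u)))
      by (intros; unfold Re, Im, Cmult; simpl; ring).
    rewrite (line_int_lin (fun u => Im (f u)) (fun u => Re (f u)) _ _ _ _
      (fun x y => proj2 (dom_ex _ _ f x y Hf)) (fun x y => proj1 (dom_ex _ _ f x y Hf))
      (dom_Im _ _ f Hf) (dom_Re _ _ f Hf)). ring.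
Qed.

Lemma dom_M_pos (b M : R) (f : R -> C) : dominated b M f -> 0 <= M.
Proof.
  intros [_ _ H]. specialize (H 0). rewrite Rabs_R0, Rmult_0_r, exp_0 in H.
  pose proof (Cmod_ge_0 (f 0)); lra.
Qed.

Lemma dom_mult (b M K : R) (f g : R -> C) : dominated b M f ->
  (forall u, Rcont g u) -> (forall u, Cmod (g u) <= K) ->
  dominated b (K * M) (fun u => g u * f u)%C.
Proof.
  intros [Hb Hc Hl] Hg HK. split; [easy | |].
  - intros u. apply Rcont_mult; auto.
  - intros u. rewrite Cmod_mult, Rmult_assoc.
    apply Rmult_le_compat; auto using Cmod_ge_0.
Qed.

Lemma dom_plus (b M M' : R) (f g : R -> C) : dominated b M f -> dominated b M' g ->
  dominated b (M + M') (fun u => f u + g u)%C.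
Proof.
  intros [Hb Hc Hl] [_ Hc' Hl']. split; [easy | |].
  - intros u. apply Rcont_plus; auto.
  - intros u. eapply Rle_trans; [apply Cmod_triangle |].
    specialize (Hl u); specialize (Hl' u); lra.
Qed.

(** * Laplace integrals along a ray *)

(** The ray is parametrized by [u = ln |s|], which turns [ds / s] into [du]. *)
Definition ray (psi u : R) : C := Cexp (u, psi).

Definition ray_int (psi : R) (H : R -> C) (t : C) : C :=
  line_cint (fun u => Cexp (ray psi u * t) * H u)%C.

Lemma Cmod_ray (psi u : R) : Cmod (ray psi u) = exp u.
Proof. apply Cmod_Cexp. Qed.

Lemma Rcont_ray (psi u : R) : Rcont (ray psi) u.
Proof.
  apply (Rcont_comp Cexp (fun t => (t, psi))); [apply Rcont_horizontal |].
  apply holo_cont, holo_Cexp.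
Qed.

Lemma Re_ray_mult (psi u : R) (t : C) : Re (ray psi u * t) = exp u * Re (ray psi 0 * t).
Proof.
  destruct t as [a b]. unfold ray, Cexp, Cmult, Re, Im; simpl. rewrite exp_0. ring.
Qed.

Lemma Rcont_Cexp_ray (psi : R) (t : C) (u : R) : Rcont (fun u => Cexp (ray psi u * t)) u.
Proof.
  apply (Rcont_comp Cexp (fun u => ray psi u * t)%C); [| apply holo_cont, holo_Cexp].
  apply Rcont_mult; [apply Rcont_ray | apply Rcont_const].
Qed.

Lemma Cmod_Cexp_ray_le (psi u : R) (t : C) : Re (ray psi 0 * t) <= 0 ->
  Cmod (Cexp (ray psi u * t)) <= 1.
Proof.
  intros H. rewrite Cmod_Cexp, Re_ray_mult, <- exp_0. apply exp_mono.
  pose proof (exp_pos u). nra.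
Qed.

Lemma dom_ray (psi b M : R) (H : R -> C) (t : C) : dominated b M H ->
  Re (ray psi 0 * t) <= 0 -> dominated b M (fun u => Cexp (ray psi u * t) * H u)%C.
Proof.
  intros HH Ht. rewrite <- (Rmult_1_l M).
  apply (dom_mult b M 1 H (fun u => Cexp (ray psi u * t))); [easy | |].
  - intros u; apply Rcont_Cexp_ray.
  - intros u; apply Cmod_Cexp_ray_le, Ht.
Qed.

Lemma ray_int_le (psi b M : R) (H : R -> C) (t : C) : dominated b M H ->
  Re (ray psi 0 * t) <= 0 -> Cmod (ray_int psi H t) <= 4 * M / b.
Proof. intros HH Ht. apply line_cint_le, dom_ray; easy. Qed.

Lemma sqr_le_exp (x : R) : 0 <= x -> x * x <= 4 * exp x.
Proof.
  intros Hx. pose proof (exp_ineq1_le (x / 2)) as H.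
  replace x with (x / 2 + x / 2) at 3 by field. rewrite exp_plus. nra.
Qed.

Lemma lin_le_exp (x : R) : x <= exp x.
Proof. pose proof (exp_ineq1_le x). lra. Qed.

Lemma dom_ray_deriv (psi b M : R) (H : R -> C) (t : C) : dominated b M H ->
  Re (ray psi 0 * t) < 0 -> exists M',
  dominated b M' (fun u => Cexp (ray psi u * t) * (ray psi u * H u))%C.
Proof.
  intros HH Ht. set (eta := - Re (ray psi 0 * t)). assert (He : 0 < eta) by (unfold eta; lra).
  exists (/ eta * M).
  assert (HD : dominated b (/ eta * M) (fun u => (Cexp (ray psi u * t) * ray psi u) * H u)%C).
  { apply dom_mult; [easy | |].
    - intros u. apply Rcont_mult; [apply Rcont_Cexp_ray | apply Rcont_ray].
    - intros u. rewrite Cmod_mult, Cmod_ray, Cmod_Cexp, Re_ray_mult.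
      set (r := exp u). pose proof (exp_pos u) as Hr. fold r in Hr.
      replace (r * Re (ray psi 0 * t)) with (- (eta * r)) by (unfold eta; ring).
      rewrite exp_Ropp. pose proof (lin_le_exp (eta * r)) as HL.
      pose proof (exp_pos (eta * r)) as Hp.
      apply Rmult_le_reg_l with (eta * exp (eta * r)); [apply Rmult_lt_0_compat; easy |].
      replace (eta * exp (eta * r) * (/ exp (eta * r) * r)) with (eta * r) by (field; lra).
      replace (eta * exp (eta * r) * / eta) with (exp (eta * r)) by (field; lra). easy. }
  destruct HD as [H1 H2 H3]. split; [easy | |].
  - intros u. apply Rcont_mult; [apply Rcont_Cexp_ray |].
    apply Rcont_mult; [apply Rcont_ray | apply HH].
  - intros u. rewrite Cmult_assoc. apply H3.
Qed.

(** Differentiation under the integral sign: by Taylor's formula the remainder is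
    at most [|h|^2 |s|^2 exp (- (eta - |h|) |s|)] with [eta = - Re (exp (i psi) t)],
    hence [O (|h|^2)] uniformly along the ray. *)
Lemma ray_int_deriv (psi b M : R) (H : R -> C) (t : C) : dominated b M H ->
  Re (ray psi 0 * t) < 0 ->
  Cderiv (ray_int psi H) t (ray_int psi (fun u => ray psi u * H u)%C t).
Proof.
  intros HH Ht. destruct (dom_ray_deriv psi b M H t HH Ht) as [M' HD].
  set (eta := - Re (ray psi 0 * t)). assert (He : 0 < eta) by (unfold eta; lra).
  pose proof (dom_M_pos b M H HH) as HM. pose proof (dom_rate b M H HH) as Hb.
  (* A bound for [r^2 exp (- eta r / 2)] over all [r >= 0]. *)
  set (K := 16 / (eta * eta)). assert (HK : 0 < K).
  { apply Rdiv_lt_0_compat; [lra | nra]. }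
  apply is_derive_C_eps. intros eps Heps.
  assert (HKM : 0 <= 4 * (K * M) / b).
  { apply Rmult_le_pos; [nra | left; apply Rinv_0_lt_compat; easy]. }
  assert (Hd : 0 < eps / (4 * (K * M) / b + 1)) by (apply Rdiv_lt_0_compat; lra).
  exists (Rmin (eta / 2) (eps / (4 * (K * M) / b + 1))). split; [apply Rmin_pos; lra |].
  intros h Hh.
  pose proof (Rlt_le_trans _ _ _ Hh (Rmin_l _ _)) as Hh1.
  pose proof (Rlt_le_trans _ _ _ Hh (Rmin_r _ _)) as Hh2.
  pose proof (Cmod_ge_0 h) as Hh0.
  assert (Hr0 : Cmod (ray psi 0) = 1) by (rewrite Cmod_ray; apply exp_0).
  assert (Hth : Re (ray psi 0 * (t + h)) <= 0).
  { replace (Re (ray psi 0 * (t + h))) with (Re (ray psi 0 * t) + Re (ray psi 0 * h)).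
    - pose proof (Re_le_Cmod (ray psi 0 * h)) as Hm. rewrite Cmod_mult, Hr0 in Hm.
      unfold eta in *; lra.
    - unfold Cmult, Cplus, Re; simpl; ring. }
  pose proof (dom_ray psi b M H (t + h) HH Hth) as D1.
  pose proof (dom_ray psi b M H t HH (Rlt_le _ _ Ht)) as D2.
  assert (D2' : dominated b (1 * M) (fun u => RtoC (-1) * (Cexp (ray psi u * t) * H u))%C).
  { apply dom_mult; [easy | intros; apply Rcont_const |].
    intros _. rewrite Cmod_R, Rabs_left; lra. }
  assert (D3' : dominated b (Cmod h * M')
    (fun u => - h * (Cexp (ray psi u * t) * (ray psi u * H u)))%C).
  { apply dom_mult; [easy | intros; apply Rcont_const |].
    intros _. rewrite Cmod_opp; lra. }
  assert (E : (ray_int psi H (t + h) - ray_int psi H t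
      - ray_int psi (fun u => ray psi u * H u) t * h)%C
    = line_cint (fun u => (Cexp (ray psi u * t) * (Cexp (ray psi u * h) - 1 - ray psi u * h)) * H u)%C).
  { unfold ray_int.
    transitivity (line_cint (fun u => (Cexp (ray psi u * (t + h)) * H u
      + RtoC (-1) * (Cexp (ray psi u * t) * H u)) + - h * (Cexp (ray psi u * t) * (ray psi u * H u)))%C).
    - rewrite (line_cint_plus _ _ _ _ _ _ (dom_plus _ _ _ _ _ D1 D2') D3').
      rewrite (line_cint_plus _ _ _ _ _ _ D1 D2').
      rewrite (line_cint_scal _ _ _ _ D2), (line_cint_scal _ _ _ _ HD). ring.
    - apply line_cint_ext. intros u.
      replace (ray psi u * (t + h))%C with (ray psi u * t + ray psi u * h)%C by ring.
      rewrite Cexp_plus. ring. }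
  rewrite E.
  assert (DD : dominated b (K * (Cmod h * Cmod h) * M)
    (fun u => (Cexp (ray psi u * t) * (Cexp (ray psi u * h) - 1 - ray psi u * h)) * H u)%C).
  { apply dom_mult; [easy | |].
    - intros u. apply Rcont_mult; [apply Rcont_Cexp_ray |].
      apply Rcont_plus; [apply Rcont_plus; [apply Rcont_Cexp_ray | apply Rcont_const] |].
      apply (Rcont_comp Copp (fun u => ray psi u * h)%C).
      + apply Rcont_mult; [apply Rcont_ray | apply Rcont_const].
      + apply holo_cont, holo_opp, holo_id.
    - intros u. rewrite Cmod_mult, Cmod_Cexp, Re_ray_mult.
      pose proof (Cexp_taylor_le (ray psi u * h)) as HT.
      rewrite Cmod_mult, Cmod_ray in HT.
      set (r := exp u) in *. pose proof (exp_pos u) as Hr. fold r in Hr.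
      replace (r * Re (ray psi 0 * t)) with (- (eta * r)) by (unfold eta; ring).
      eapply Rle_trans; [apply Rmult_le_compat_l; [left; apply exp_pos | apply HT] |].
      assert (Hx : exp (- (eta * r)) * exp (r * Cmod h) <= exp (- (eta / 2 * r))).
      { rewrite <- exp_plus. apply exp_mono. nra. }
      assert (Hs : r * r * exp (- (eta / 2 * r)) <= K).
      { pose proof (sqr_le_exp (eta / 2 * r) ltac:(nra)) as Hq.
        rewrite exp_Ropp. pose proof (exp_pos (eta / 2 * r)) as Hp.
        apply Rmult_le_reg_r with (exp (eta / 2 * r)); [easy |].
        rewrite Rmult_assoc, Rinv_l, Rmult_1_r by lra.
        unfold K. apply Rmult_le_reg_l with (eta * eta); [nra |].
        replace (eta * eta * (16 / (eta * eta) * exp (eta / 2 * r))) with (16 * exp (eta / 2 * r))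
          by (field; lra). nra. }
      replace (exp (- (eta * r)) * (r * Cmod h * (r * Cmod h) * exp (r * Cmod h)))
        with ((r * r * (exp (- (eta * r)) * exp (r * Cmod h))) * (Cmod h * Cmod h)) by ring.
      apply Rmult_le_compat_r; [nra |].
      eapply Rle_trans; [| apply Hs]. apply Rmult_le_compat_l; [nra | easy]. }
  eapply Rle_trans; [apply (line_cint_le _ _ _ DD) |].
  replace (4 * (K * (Cmod h * Cmod h) * M) / b) with ((4 * (K * M) / b * Cmod h) * Cmod h)
    by (field; lra).
  apply Rmult_le_compat_r; [easy |].
  apply Rle_trans with ((4 * (K * M) / b + 1) * Cmod h); [nra |].
  apply Rmult_le_reg_r with (/ (4 * (K * M) / b + 1)); [apply Rinv_0_lt_compat; lra |].
  replace ((4 * (K * M) / b + 1) * Cmod h * / (4 * (K * M) / b + 1)) with (Cmod h).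
  - left; exact Hh2.
  - generalize (4 * (K * M) / b) HKM; intros x Hx. field; lra.
Qed.

(** * Cauchy's theorem on a rectangle *)

Lemma holo_C_derive (f : C -> C) (z : C) : holo f z ->
  Clocally z (fun w => Cderiv f w (C_derive f w)) /\ Ccont (C_derive f) z.
Proof.
  intros (df & Hf & Cf).
  assert (HE : Clocally z (fun w => C_derive f w = df w)).
  { revert Hf. apply filter_imp. intros w Hw. apply is_C_derive_unique. exact Hw. }
  split.
  - generalize (filter_and _ _ Hf HE). apply filter_imp. intros w [H1 H2]. rewrite H2. exact H1.
  - refine (continuous_ext_loc (T := AbsRing_UniformSpace C_AbsRing)
      (U := AbsRing_UniformSpace C_AbsRing) _ df _ _ Cf).
    revert HE. apply filter_imp. intros w Hw; symmetry; exact Hw.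
Qed.

Lemma Cderiv_vertical (f : C -> C) (u y : R) (l : C) : Cderiv f (u, y) l ->
  is_derive (fun v => Im (f (u, v))) y (Re l).
Proof.
  intros H.
  assert (E : forall v, ((u, 0) + RtoC v * Ci)%C = (u, v)).
  { intros v. unfold Cplus, Cmult, RtoC, Ci; simpl. f_equal; ring. }
  rewrite <- (E y) in H. apply Cderiv_line in H. destruct H as [_ H].
  replace (Re l) with (Im (l * Ci)) by (unfold Im, Re, Cmult, Ci; simpl; ring).
  revert H. apply is_derive_ext. intros v. rewrite E. easy.
Qed.

Lemma Cderiv_horizontal (f : C -> C) (u y : R) (l : C) : Cderiv f (u, y) l ->
  is_derive (fun v => Re (f (v, y))) u (Re l) /\ is_derive (fun v => Im (f (v, y))) u (Im l).
Proof.
  intros H.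
  assert (E : forall v, ((0, y) + RtoC v * RtoC 1)%C = (v, y)).
  { intros v. unfold Cplus, Cmult, RtoC; simpl. f_equal; ring. }
  rewrite <- (E u) in H. apply Cderiv_line in H. destruct H as [H1 H2].
  rewrite Cmult_1_r in H1, H2.
  split; [revert H1 | revert H2]; apply is_derive_ext; intros v; rewrite E; easy.
Qed.

Lemma Ccont_horizontal (f : C -> C) (y : R) (u : R) : Ccont f (u, y) ->
  continuous (fun v => Re (f (v, y))) u /\ continuous (fun v => Im (f (v, y))) u.
Proof.
  intros H. apply (Rcont_parts (fun v => f (v, y))).
  apply (Rcont_comp f (fun v => (v, y))); [apply Rcont_horizontal | easy].
Qed.

Lemma continuity_2d_pt_swap (f : R -> R -> R) (x y : R) :
  continuity_2d_pt f x y -> continuity_2d_pt (fun u v => f v u) y x.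
Proof.
  intros H eps. destruct (H eps) as [d Hd]. exists d. intros u v Hu Hv. apply Hd; easy.
Qed.

Section Rectangle.
Variables (q : C -> C) (Y N : R).
Hypothesis (HY : 0 < Y) (HN : 0 <= N)
  (Hq : forall u y, 0 < y < Y -> holo q (u, y))
  (Hc : forall u y, 0 <= y <= Y -> Ccont q (u, y))
  (H0 : forall u, Im (q (u, 0)) = 0).

Let F y := RInt (fun u => Im (q (u, y))) (- N) N.

(** By the Cauchy-Riemann equations the [y]-derivative of the integral over a
    horizontal segment is a boundary term. *)
Local Lemma rect_deriv y : 0 < y < Y -> is_derive F y (Re (q (N, y)) - Re (q (- N, y))).
Proof.
  intros Hy.
  assert (Hloc : locally y (fun v => 0 < v < Y)).
  { apply (open_and (fun v => 0 < v) (fun v => v < Y)); [apply open_gt | apply open_lt | easy]. }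
  assert (HD : forall v u, 0 < v < Y ->
    is_derive (fun z => Im (q (u, z))) v (Re (C_derive q (u, v)))).
  { intros v u Hv. apply Cderiv_vertical.
    apply (@locally_singleton (AbsRing_UniformSpace C_AbsRing) _ _ (proj1 (holo_C_derive q (u, v) (Hq u v Hv)))). }
  assert (E : RInt (fun u => Derive (fun v => Im (q (u, v))) y) (- N) N
     = Re (q (N, y)) - Re (q (- N, y))).
  { rewrite (RInt_ext _ (fun u => Re (C_derive q (u, y)))).
    2: { intros u _. apply is_derive_unique, HD, Hy. }
    apply is_RInt_unique.
    apply (is_RInt_derive (fun u => Re (q (u, y))) (fun u => Re (C_derive q (u, y)))).
    - intros u _. apply Cderiv_horizontal.
      apply (@locally_singleton (AbsRing_UniformSpace C_AbsRing) _ _ (proj1 (holo_C_derive q (u, y) (Hq u y Hy)))).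
    - intros u _. apply Ccont_horizontal. apply (holo_C_derive q (u, y) (Hq u y Hy)). }
  rewrite <- E. apply (is_derive_RInt_param (fun y u => Im (q (u, y)))).
  - revert Hloc. apply filter_imp. intros v Hv u _. eexists. apply HD, Hv.
  - intros u _.
    apply continuity_2d_pt_ext_loc with (fun v t => Re (C_derive q (t, v))).
    + destruct Hloc as [d Hd]. exists d. intros v t Hv Ht. symmetry.
      apply is_derive_unique, HD, Hd, Hv.
    + apply (continuity_2d_pt_swap (fun a b => Re (C_derive q (a, b)))).
      apply Ccont_2d. apply (holo_C_derive q (u, y) (Hq u y Hy)).
  - revert Hloc. apply filter_imp. intros v Hv.
    apply (@ex_RInt_continuous R_CompleteNormedModule). intros u _.
    apply Ccont_horizontal, Hc. lra.
Qed.

(* Clamping to [0, Y] gives a function that is continuous on both sides of the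
   end points, as the mean value theorem asks. *)
Let cl y := Rmax 0 (Rmin y Y).

Local Lemma rect_cont y : continuity_pt (fun y => F (cl y)) y.
Proof.
  assert (Hcl : forall y, 0 <= cl y <= Y).
  { intros v. unfold cl, Rmax, Rmin. repeat destruct Rle_dec; lra. }
  assert (Hlip : forall a b, Rabs (cl a - cl b) <= Rabs (a - b)).
  { intros a b. unfold cl, Rmax, Rmin. repeat destruct Rle_dec;
     unfold Rabs; repeat destruct Rcase_abs; lra. }
  assert (HI : forall v, ex_RInt (fun u => Im (q (u, cl v))) (- N) N).
  { intros v. apply (@ex_RInt_continuous R_CompleteNormedModule). intros u _.
    apply Ccont_horizontal, Hc, Hcl. }
  apply continuity_pt_locally. intros eps.
  assert (He : 0 < eps / (2 * N + 1)) by (apply Rdiv_lt_0_compat; [apply cond_pos | lra]).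
  destruct (uniform_continuity_2d_1d (fun a b => Im (q (a, b))) (- N) N (cl y)) with (mkposreal _ He)
    as [d Hd].
  { intros x _. apply Ccont_2d, Hc, Hcl. }
  simpl in Hd. exists d. intros v Hv.
  assert (Hv' : Rabs (cl v - cl y) < d) by (eapply Rle_lt_trans; [apply Hlip | exact Hv]).
  apply Rabs_lt_between in Hv'.
  unfold F. rewrite <- (RInt_minus (V := R_CompleteNormedModule)
    (fun u => Im (q (u, cl v))) (fun u => Im (q (u, cl y)))) by apply HI.
  eapply Rle_lt_trans.
  - apply (abs_RInt_le_const _ (- N) N (eps / (2 * N + 1))); [lra | |].
    + apply (ex_RInt_minus (V := R_NormedModule) (fun u => Im (q (u, cl v)))); apply HI.
    + intros u Hu. left. pose proof (cond_pos d) as Hd0.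
      apply Hd; try lra. rewrite Rminus_diag, Rabs_R0. exact Hd0.
  - replace (N - - N) with (2 * N) by ring.
    apply Rmult_lt_reg_r with (2 * N + 1); [lra |].
    replace (2 * N * (eps / (2 * N + 1)) * (2 * N + 1)) with (2 * N * eps) by (field; lra).
    pose proof (cond_pos eps); lra.
Qed.

(** Cauchy's theorem for the imaginary part: the bottom edge contributes
    nothing, and the vertical edges are controlled by the mean value theorem. *)
Lemma rectangle : exists y, 0 <= y <= Y /\
  RInt (fun u => Im (q (u, Y))) (- N) N = (Re (q (N, y)) - Re (q (- N, y))) * Y.
Proof.
  assert (Hin : forall v, 0 <= v <= Y -> cl v = v).
  { intros v Hv. unfold cl, Rmax, Rmin. repeat destruct Rle_dec; lra. }
  destruct (MVT_gen (fun y => F (cl y)) 0 Y (fun y => Re (q (N, y)) - Re (q (- N, y))))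
    as (y & Hy & E); rewrite ?Rmin_left, ?Rmax_right in * by lra.
  - intros v Hv. apply (is_derive_ext_loc F); [| apply rect_deriv, Hv].
    assert (Hloc : locally v (fun v => 0 < v < Y)).
    { apply (open_and (fun v => 0 < v) (fun v => v < Y)); [apply open_gt | apply open_lt | easy]. }
    revert Hloc. apply filter_imp. intros x Hx. rewrite Hin by lra. easy.
  - intros v _. apply rect_cont.
  - exists y. split; [easy |]. rewrite !Hin in E by lra.
    assert (F0 : F 0 = 0).
    { unfold F. rewrite (RInt_ext _ (fun _ => 0)) by (intros; apply H0).
      rewrite (RInt_const (V := R_CompleteNormedModule)). unfold scal; simpl; unfold mult; simpl; ring. }
    rewrite F0 in E. unfold F in E. lra.
Qed.
End Rectangle.

(** * Removable singularities *)

(** Filling the difference quotient in at [z] makes the quotient of two slopes a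
    continuous substitute for [(f w - f z) / (g w - g z)]. *)
Definition slope (f : C -> C) (l z w : C) : C :=
  if Ceq_dec w z then l else ((f w - f z) / (w - z))%C.

Lemma slope_neq (f : C -> C) (l z w : C) : w <> z -> slope f l z w = ((f w - f z) / (w - z))%C.
Proof. intros H. unfold slope. destruct (Ceq_dec w z); easy. Qed.

Lemma Ccont_slope (f : C -> C) (l z : C) : Cderiv f z l -> Ccont (slope f l z) z.
Proof.
  intros H. rewrite is_derive_C_eps in H. apply Ccont_eps. intros eps He.
  destruct (H (eps / 2) ltac:(lra)) as (d & Hd & Hb). exists d. split; [easy |]. intros h Hh.
  unfold slope at 2. destruct (Ceq_dec z z) as [_ | N]; [| easy].
  unfold slope. destruct (Ceq_dec (z + h) z) as [E | N].
  - replace (l - l)%C with (RtoC 0) by ring. rewrite Cmod_0. easy.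
  - assert (Nh : h <> 0) by (intros E; apply N; rewrite E; ring).
    replace ((f (z + h) - f z) / (z + h - z) - l)%C with ((f (z + h) - f z - l * h) / h)%C.
    2: { replace (z + h - z)%C with h by ring. field. exact Nh. }
    rewrite Cmod_div by exact Nh. assert (Hm : 0 < Cmod h) by (apply Cmod_gt_0; exact Nh).
    apply Rle_lt_trans with (eps / 2); [| lra].
    apply Rmult_le_reg_r with (Cmod h); [easy |].
    unfold Rdiv at 1. rewrite Rmult_assoc, Rinv_l by lra. rewrite Rmult_1_r. apply Hb, Hh.
Qed.

Lemma holo_ext_loc (f g : C -> C) (z : C) : Clocally z (fun w => f w = g w) -> holo f z -> holo g z.
Proof.
  intros E (df & Hf & Cf). exists df. split; [| easy].
  apply Clocally_eps in E. destruct E as (d & Hd & E).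
  apply Clocally_eps in Hf. destruct Hf as (d' & Hd' & Hf).
  apply Clocally_eps. exists (Rmin d' (d / 2)). split; [apply Rmin_pos; lra |].
  intros h Hh. pose proof (Rlt_le_trans _ _ _ Hh (Rmin_l _ _)) as H1.
  pose proof (Rlt_le_trans _ _ _ Hh (Rmin_r _ _)) as H2.
  specialize (Hf h H1). apply is_derive_C_eps. rewrite is_derive_C_eps in Hf.
  intros eps He. destruct (Hf eps He) as (e & He' & Hb).
  exists (Rmin e (d / 2)). split; [apply Rmin_pos; lra |]. intros x Hx.
  pose proof (Rlt_le_trans _ _ _ Hx (Rmin_l _ _)) as H3.
  pose proof (Rlt_le_trans _ _ _ Hx (Rmin_r _ _)) as H4.
  rewrite <- (E h) by lra. rewrite <- Cplus_assoc, <- E.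
  - rewrite Cplus_assoc. apply Hb, H3.
  - eapply Rle_lt_trans; [apply Cmod_triangle | lra].
Qed.

Lemma Cminus_0_eq (z w : C) : (z - w)%C = 0 -> z = w.
Proof. intros E. replace z with (z - w + w)%C by ring. rewrite E. ring. Qed.

Lemma holo_slope (f : C -> C) (l z w : C) : w <> z -> holo f w -> holo (slope f l z) w.
Proof.
  intros N Hf. apply holo_ext_loc with (fun w => (f w - f z) / (w - z))%C.
  - assert (Hm : 0 < Cmod (w - z)) by (apply Cmod_gt_0; intros E; apply N, Cminus_0_eq, E).
    apply Clocally_eps. exists (Cmod (w - z)). split; [easy |]. intros h Hh.
    symmetry. apply slope_neq. intros E.
    replace (w - z)%C with (- h)%C in Hh by (rewrite <- E; ring).
    rewrite Cmod_opp in Hh. lra.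
  - apply holo_div; [apply holo_minus; [easy | apply holo_const] |
      apply holo_minus; [apply holo_id | apply holo_const] |].
    intros E; apply N, Cminus_0_eq, E.
Qed.

(** * Cauchy's formula for the Stieltjes kernel *)

Lemma atan_seq_lim (x : nat -> R) : is_lim_seq x p_infty ->
  is_lim_seq (fun n => atan (x n)) (PI / 2).
Proof.
  intros Hx. apply is_lim_seq_spec. intros eps. apply is_lim_seq_spec in Hx.
  pose proof PI_RGT_0 as HP. pose proof (cond_pos eps) as He.
  set (a := PI / 2 - Rmin (eps / 2) (PI / 2)).
  assert (Ha : - (PI / 2) < a < PI / 2).
  { unfold a, Rmin; destruct Rle_dec; lra. }
  destruct (Hx (tan a)) as [N HN]. exists N. intros n Hn. specialize (HN n Hn).
  apply atan_increasing in HN. rewrite atan_tan in HN by easy.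
  pose proof (atan_bound (x n)). apply Rabs_lt_between.
  unfold a, Rmin in HN; destruct Rle_dec; lra.
Qed.

Lemma half_le_sinh (v : R) : 0 <= v -> v / 2 <= sinh v.
Proof.
  intros Hv. unfold sinh. pose proof (exp_ineq1_le v).
  assert (exp (- v) <= 1) by (rewrite <- exp_0; apply exp_mono; lra). lra.
Qed.

Lemma sinh_opp (v : R) : sinh (- v) = - sinh v.
Proof. unfold sinh. rewrite Ropp_involutive. lra. Qed.

Lemma is_lim_seq_exp_INR (b : R) : 0 < b -> is_lim_seq (fun n => exp (- b * INR n)) 0.
Proof.
  intros Hb. apply is_lim_seq_spec. intros eps.
  destruct (exp_INR_small b eps Hb (cond_pos eps)) as [N HN]. exists N. intros n Hn.
  rewrite Rminus_0_r, Rabs_pos_eq by (left; apply exp_pos). apply HN, Hn.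
Qed.

Section Stieltjes.
Variables (k : C -> C) (psi b M sigma : R).
Hypothesis (Hpsi : 0 < psi < PI) (Hb : 0 < b)
  (Hk : forall u y, 0 <= y <= psi -> holo k (u, y))
  (Hreal : forall u, Im (k (u, 0)) = 0)
  (HM : forall u y, 0 <= y <= psi -> Cmod (k (u, y)) <= M * exp (- b * Rabs u)).

Let s := exp sigma.
Let kappa := Re (k (sigma, 0)).
(* The function [2 e^z / (s + e^z)] is holomorphic in the strip, is real on the real
   axis, tends to [0] on the left, and equals [1] at the pole [sg] of [1 / Den]. *)
Let Num (z : C) : C := (k z - RtoC kappa * (2 * Cexp z / (RtoC s + Cexp z)))%C.
Let Den (z : C) : C := (RtoC s - Cexp z)%C.
Let sg : C := (sigma, 0).
Let q (z : C) : C := (slope Num (C_derive Num sg) sg z / slope Den (- RtoC s)%C sg z)%C.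

Local Lemma s_pos : 0 < s. Proof. apply exp_pos. Qed.

Local Lemma s_plus_neq u y : 0 <= y <= psi -> (RtoC s + Cexp (u, y))%C <> 0.
Proof.
  intros Hy E. pose proof s_pos as Hs. pose proof (exp_pos u) as Hu.
  unfold Cexp, Cplus, RtoC, Re, Im in E; simpl in E. injection E as E1 E2.
  destruct (Req_dec y 0) as [-> | N].
  - rewrite cos_0 in E1. lra.
  - assert (0 < sin y) by (apply sin_gt_0; lra). nra.
Qed.

Local Lemma s_minus_neq u y : 0 <= y <= psi -> (u, y) <> sg -> Den (u, y) <> 0.
Proof.
  intros Hy Nu E. pose proof s_pos as Hs. pose proof (exp_pos u) as Hu.
  unfold Den, Cexp, Cminus, Copp, Cplus, RtoC, Re, Im in E; simpl in E. injection E as E1 E2.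
  destruct (Req_dec y 0) as [-> | N].
  - apply Nu. unfold sg. f_equal. rewrite cos_0 in E1.
    apply exp_inv. fold s. lra.
  - assert (0 < sin y) by (apply sin_gt_0; lra). nra.
Qed.

Local Lemma sg_exp : Cexp sg = RtoC s.
Proof. apply Cexp_real. Qed.

Local Lemma k_sg : k sg = RtoC kappa.
Proof.
  unfold kappa, sg. generalize (Hreal sigma). destruct (k (sigma, 0)) as [a c].
  unfold Re, Im, RtoC; simpl. intros ->; easy.
Qed.

Local Lemma Den_sg : Den sg = 0.
Proof. unfold Den. rewrite sg_exp. ring. Qed.

Local Lemma Num_sg : Num sg = 0.
Proof.
  pose proof s_pos as Hs. assert (RtoC s <> 0) by (intros E; apply RtoC_inj in E; lra).
  unfold Num. rewrite sg_exp, k_sg. field.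
  replace (RtoC s + RtoC s)%C with (RtoC (s + s)) by (rewrite RtoC_plus; easy).
  intros E; apply RtoC_inj in E; lra.
Qed.

Local Lemma Num_holo u y : 0 <= y <= psi -> holo Num (u, y).
Proof.
  intros Hy. unfold Num. apply holo_minus; [apply Hk, Hy |].
  apply holo_mult; [apply holo_const |]. apply holo_div.
  - apply holo_mult; [apply holo_const | apply holo_Cexp].
  - apply holo_plus; [apply holo_const | apply holo_Cexp].
  - apply s_plus_neq, Hy.
Qed.

Local Lemma Den_holo z : holo Den z.
Proof. apply holo_minus; [apply holo_const | apply holo_Cexp]. Qed.

Local Lemma q_eq u y : 0 <= y <= psi -> (u, y) <> sg -> q (u, y) = (Num (u, y) / Den (u, y))%C.
Proof.
  intros Hy N. unfold q. rewrite !slope_neq by easy. rewrite Num_sg, Den_sg.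
  pose proof (s_minus_neq u y Hy N).
  assert (((u, y) : C) - sg <> 0)%C by (intros E; apply N, Cminus_0_eq, E).
  generalize dependent ((u, y) - sg)%C. intros d Nd. field. auto.
Qed.

Local Lemma q_holo u y : 0 <= y <= psi -> (u, y) <> sg -> holo q (u, y).
Proof.
  intros Hy N. unfold q. apply holo_div.
  - apply holo_slope; [easy | apply Num_holo, Hy].
  - apply holo_slope; [easy | apply Den_holo].
  - rewrite slope_neq, Den_sg by easy. pose proof (s_minus_neq u y Hy N).
    assert (((u, y) : C) - sg <> 0)%C by (intros E; apply N, Cminus_0_eq, E).
    replace (Den (u, y) - 0)%C with (Den (u, y)) by ring.
    unfold Cdiv. apply Cmult_neq_0; [easy |]. intros E.
    apply (f_equal (fun w => w * ((u, y) - sg))%C) in E.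
    rewrite Cinv_l in E by easy. rewrite Cmult_0_l in E.
    apply RtoC_inj in E; lra.
Qed.

Local Lemma Num_deriv : Cderiv Num sg (C_derive Num sg).
Proof.
  apply (@locally_singleton (AbsRing_UniformSpace C_AbsRing) _ _
    (proj1 (holo_C_derive Num sg (Num_holo sigma 0 ltac:(lra))))).
Qed.

Local Lemma Den_deriv : Cderiv Den sg (- RtoC s)%C.
Proof.
  apply (Cderiv_ext (fun w => RtoC s + (RtoC (-1)) * Cexp w)%C Den sg
    (RtoC 0 + (RtoC 0 * Cexp sg + RtoC (-1) * Cexp sg))%C).
  - intros w. unfold Den. rewrite RtoC_m1. ring.
  - rewrite sg_exp, RtoC_m1. ring.
  - apply Cderiv_plus; [apply Cderiv_const |].
    apply Cderiv_mult; [apply Cderiv_const | apply Cderiv_Cexp].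
Qed.

Local Lemma q_cont u y : 0 <= y <= psi -> Ccont q (u, y).
Proof.
  intros Hy. destruct (Ceq_dec (u, y) sg) as [E | N].
  - rewrite E. unfold q. apply Ccont_mult; [apply Ccont_slope, Num_deriv |].
    apply (Ccont_comp Cinv (slope Den (- RtoC s)%C sg)); [apply Ccont_slope, Den_deriv |].
    apply holo_cont, holo_Cinv. unfold slope. destruct (Ceq_dec sg sg); [| easy].
    pose proof s_pos. rewrite <- RtoC_opp. intros E'; apply RtoC_inj in E'; lra.
  - apply holo_cont, q_holo; easy.
Qed.

Lemma Im_div_real (z w : C) : Im z = 0 -> Im w = 0 -> Im (z / w) = 0.
Proof.
  destruct z as [a c], w as [p r]; unfold Cdiv, Cinv, Cmult, Im; simpl; intros -> ->.
  unfold Rdiv; ring.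
Qed.

Lemma Im_mult_real (z w : C) : Im z = 0 -> Im w = 0 -> Im (z * w) = 0.
Proof.
  destruct z as [a c], w as [p r]; unfold Cmult, Im; simpl; intros -> ->. ring.
Qed.

Lemma Im_minus_real (z w : C) : Im z = 0 -> Im w = 0 -> Im (z - w) = 0.
Proof.
  destruct z as [a c], w as [p r]; unfold Cminus, Cplus, Copp, Im; simpl; intros -> ->. ring.
Qed.

Lemma Im_Cexp_real u : Im (Cexp (u, 0)) = 0.
Proof. unfold Cexp, Im; simpl. rewrite sin_0; ring. Qed.

Local Lemma Num_real u : Im (Num (u, 0)) = 0.
Proof.
  unfold Num. apply Im_minus_real; [apply Hreal |].
  apply Im_mult_real; [easy |]. apply Im_div_real.
  - apply Im_mult_real; [easy | apply Im_Cexp_real].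
  - unfold Cplus, Im. simpl snd. change (0 + Im (Cexp (u, 0)) = 0).
    rewrite Im_Cexp_real. ring.
Qed.

Local Lemma Den_real u : Im (Den (u, 0)) = 0.
Proof. apply Im_minus_real; [easy | apply Im_Cexp_real]. Qed.

Local Lemma q_real u : Im (q (u, 0)) = 0.
Proof.
  unfold q. apply Im_div_real.
  - unfold slope. destruct (Ceq_dec (u, 0) sg).
    + destruct (Cderiv_horizontal Num sigma 0 _ Num_deriv) as [_ H].
      apply is_derive_unique in H. rewrite <- H.
      rewrite (Derive_ext _ (fun _ => 0)) by (intros; apply Num_real).
      apply Derive_const.
    + apply Im_div_real; apply Im_minus_real; try apply Num_real; easy.
  - unfold slope. destruct (Ceq_dec (u, 0) sg).
    + unfold Copp, RtoC, Im; simpl; ring.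
    + apply Im_div_real; apply Im_minus_real; try apply Den_real; easy.
Qed.

(** [D] is a lower bound for the distance to the poles [s] and [- s]; it is of the
    order of [exp u] on the right and of [s] on the left. *)
Local Lemma q_le u y B D : 0 <= y <= psi -> (u, y) <> sg -> 0 < D ->
  D <= Cmod (RtoC s - Cexp (u, y)) -> D <= Cmod (RtoC s + Cexp (u, y)) ->
  Cmod (k (u, y)) <= B ->
  Rabs (Re (q (u, y))) <= (B + Rabs kappa * (2 * exp u / D)) / D.
Proof.
  intros Hy N HD H1 H2 HB. eapply Rle_trans; [apply re_le_Cmod |].
  rewrite q_eq by easy. rewrite Cmod_div by (apply s_minus_neq; easy).
  unfold Rdiv at 1. apply Rmult_le_compat.
  - apply Cmod_ge_0.
  - left. apply Rinv_0_lt_compat. unfold Den. lra.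
  - unfold Num. eapply Rle_trans; [apply Cmod_triangle |]. rewrite Cmod_opp.
    apply Rplus_le_compat; [easy |].
    rewrite Cmod_mult, Cmod_R. apply Rmult_le_compat_l; [apply Rabs_pos |].
    rewrite Cmod_div by (apply s_plus_neq; easy).
    rewrite Cmod_mult, Cmod_Cexp, Cmod_R, Rabs_pos_eq by lra.
    change (Re (u, y)) with u. pose proof (exp_pos u).
    apply Rmult_le_compat_l; [lra |]. apply Rinv_le_contravar; lra.
  - apply Rinv_le_contravar; unfold Den; lra.
Qed.

Local Lemma Cmod_s_exp u y D : (s + D <= exp u \/ exp u + D <= s) ->
  D <= Cmod (RtoC s - Cexp (u, y)) /\ D <= Cmod (RtoC s + Cexp (u, y)).
Proof.
  intros HD. pose proof s_pos as Hs.
  assert (Hm : Cmod (Cexp (u, y)) = exp u) by apply Cmod_Cexp.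
  assert (Hms : Cmod (RtoC s) = s) by (rewrite Cmod_R, Rabs_pos_eq; lra).
  set (e := Cexp (u, y)) in *.
  assert (T1 : forall a c : C, Cmod a - Cmod c <= Cmod (a + c)).
  { intros a c. pose proof (Cmod_triangle (a + c) (- c)) as HT. rewrite Cmod_opp in HT.
    replace (a + c + - c)%C with a in HT by ring. lra. }
  split.
  - pose proof (T1 (RtoC s) (- e)%C) as A1. pose proof (T1 (- e)%C (RtoC s)) as A2.
    rewrite Cmod_opp in A1, A2. rewrite Cplus_comm in A2.
    unfold Cminus. lra.
  - pose proof (T1 (RtoC s) e) as A1. pose proof (T1 e (RtoC s)) as A2.
    rewrite Cplus_comm in A2. lra.
Qed.

Local Lemma q_edge : exists K N, forall n y, (N <= n)%nat -> 0 <= y <= psi ->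
  Rabs (Re (q (INR n, y))) <= K * exp (- INR n) /\
  Rabs (Re (q (- INR n, y))) <= K * exp (- b * INR n) + K * exp (- INR n).
Proof.
  pose proof s_pos as Hs.
  assert (HM0 : 0 <= M).
  { specialize (HM 0 0 ltac:(lra)). rewrite Rabs_R0, Rmult_0_r, exp_0 in HM.
    pose proof (Cmod_ge_0 (k (0, 0))); lra. }
  destruct (exp_INR_small 1 (Rmin (s / 2) (/ (2 * s))) Rlt_0_1) as [N HN].
  { apply Rmin_pos; [lra | apply Rinv_0_lt_compat; lra]. }
  set (ka := Rabs kappa). assert (Hka : 0 <= ka) by apply Rabs_pos.
  set (K1 := 2 * (M + 4 * ka)). set (K2 := 2 * M / s). set (K3 := 8 * ka / (s * s)).
  assert (P1 : 0 <= K1) by (unfold K1; lra).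
  assert (P2 : 0 <= K2).
  { apply Rmult_le_pos; [lra | left; apply Rinv_0_lt_compat; lra]. }
  assert (P3 : 0 <= K3).
  { apply Rmult_le_pos; [lra | left; apply Rinv_0_lt_compat; nra]. }
  exists (K1 + K2 + K3), N. intros n y Hn Hy.
  specialize (HN n Hn). replace (- (1) * INR n) with (- INR n) in HN by ring.
  pose proof (exp_pos (- INR n)) as Hr. pose proof (exp_pos (- b * INR n)) as Hr'.
  pose proof (Rlt_le_trans _ _ _ HN (Rmin_l _ _)) as Ha.
  pose proof (Rlt_le_trans _ _ _ HN (Rmin_r _ _)) as Hc.
  assert (Hexp : exp (INR n) = / exp (- INR n)) by (rewrite exp_Ropp, Rinv_inv; easy).
  assert (HE : 2 * s < exp (INR n)).
  { rewrite Hexp, <- (Rinv_inv (2 * s)). apply Rinv_lt_contravar; [| easy].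
    apply Rmult_lt_0_compat; [easy | apply Rinv_0_lt_compat; lra]. }
  pose proof (pos_INR n) as Hn0.
  split.
  - assert (Ns : (INR n, y) <> sg).
    { unfold sg. intros E. injection E as E1 E2. rewrite E1 in HE. fold s in HE. lra. }
    destruct (Cmod_s_exp (INR n) y (exp (INR n) / 2) ltac:(left; lra)) as [D1 D2].
    eapply Rle_trans; [apply (q_le (INR n) y M (exp (INR n) / 2)); try easy |].
    + pose proof (exp_pos (INR n)); lra.
    + eapply Rle_trans; [apply HM, Hy |].
      rewrite <- (Rmult_1_r M) at 2. apply Rmult_le_compat_l; [easy |].
      rewrite <- exp_0. apply exp_mono. rewrite Rabs_pos_eq by easy. nra.
    + fold ka. rewrite Hexp.
      replace ((M + ka * (2 * / exp (- INR n) / (/ exp (- INR n) / 2))) / (/ exp (- INR n) / 2))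
        with (K1 * exp (- INR n)) by (unfold K1; field; lra).
      apply Rmult_le_compat_r; lra.
  - assert (Ns : (- INR n, y) <> sg).
    { unfold sg. intros E. injection E as E1 E2. rewrite E1 in Ha. fold s in Ha. lra. }
    destruct (Cmod_s_exp (- INR n) y (s / 2) ltac:(right; lra)) as [D1 D2].
    eapply Rle_trans; [apply (q_le (- INR n) y (M * exp (- b * INR n)) (s / 2)); try easy |].
    + lra.
    + eapply Rle_trans; [apply HM, Hy |]. rewrite Rabs_Ropp, Rabs_pos_eq by easy. lra.
    + fold ka.
      replace ((M * exp (- b * INR n) + ka * (2 * exp (- INR n) / (s / 2))) / (s / 2))
        with (K2 * exp (- b * INR n) + K3 * exp (- INR n)) by (unfold K2, K3; field; lra).
      apply Rplus_le_compat; apply Rmult_le_compat_r; lra.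
Qed.

(** The bottom edge is real and the vertical edges recede to infinity, where [q]
    decays. *)
Local Lemma q_int : is_lim_seq (fun n => RInt (fun u => Im (q (u, psi))) (- INR n) (INR n)) 0.
Proof.
  destruct q_edge as (K & N & HK).
  apply is_lim_seq_abs_0.
  apply is_lim_seq_le_le_loc with (fun _ => 0)
    (fun n => psi * (2 * K * exp (- INR n) + K * exp (- b * INR n))).
  - exists N. intros n Hn. split; [apply Rabs_pos |].
    destruct (rectangle q psi (INR n)) as (y & Hy & E).
    + lra.
    + apply pos_INR.
    + intros u y Hy. apply q_holo; [lra |]. intros E. injection E as _ E. lra.
    + intros u y Hy. apply q_cont, Hy.
    + apply q_real.
    + rewrite E, Rabs_mult, (Rabs_pos_eq psi), Rmult_comm by lra.
      apply Rmult_le_compat_l; [lra |].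
      destruct (HK n y Hn Hy) as [A1 A2].
      unfold Rminus. eapply Rle_trans; [apply Rabs_triang |]. rewrite Rabs_Ropp. lra.
  - apply is_lim_seq_const.
  - replace (Finite 0) with (Rbar_mult psi (Finite (2 * K * 0 + K * 0)))
      by (simpl; f_equal; ring).
    apply is_lim_seq_scal_l. apply is_lim_seq_plus'.
    + apply (is_lim_seq_scal_l _ (2 * K) 0).
      apply is_lim_seq_ext with (fun n => exp (- (1) * INR n)).
      * intros n; f_equal; ring.
      * apply is_lim_seq_exp_INR, Rlt_0_1.
    + apply (is_lim_seq_scal_l _ K 0), is_lim_seq_exp_INR, Hb.
Qed.

Let T u := / s * atan (sinh (u - sigma) / sin psi).

(** The subtracted kernel is [2 z / (s^2 - z^2)], which is
    [1 / (s sinh (sigma - zeta))] at [z = exp zeta]; its imaginary part on the ray has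
    an elementary primitive. *)
Local Lemma kernel_deriv u :
  is_derive T u (Im (2 * ray psi u / ((RtoC s + ray psi u) * (RtoC s - ray psi u)))).
Proof.
  pose proof s_pos as Hs. assert (Hsin : 0 < sin psi) by (apply sin_gt_0; lra).
  set (r := exp u). assert (Hr : 0 < r) by apply exp_pos.
  assert (Hsh : sinh (u - sigma) = (r / s - s / r) / 2).
  { unfold sinh, r, s. rewrite Ropp_minus_distr. unfold Rminus.
    rewrite !exp_plus, !exp_Ropp. unfold Rdiv. ring. }
  assert (Hch : cosh (u - sigma) = (r / s + s / r) / 2).
  { unfold cosh, r, s. rewrite Ropp_minus_distr. unfold Rminus.
    rewrite !exp_plus, !exp_Ropp. unfold Rdiv. ring. }
  assert (HD : is_derive T u
    (/ s * (cosh (u - sigma) / sin psi * / (1 + (sinh (u - sigma) / sin psi) ^ 2)))).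
  { unfold T. apply is_derive_scal.
    apply (is_derive_comp atan (fun u => sinh (u - sigma) / sin psi)).
    - evar_last; [apply is_derive_atan |]. unfold Rsqr; simpl; f_equal; ring.
    - apply (is_derive_ext (fun t => / sin psi * sinh (t - sigma))).
      { intros t; unfold Rdiv; apply Rmult_comm. }
      evar_last.
      + apply is_derive_scal. apply (is_derive_comp sinh (fun t => t - sigma)).
        * apply is_derive_Reals, derivable_pt_lim_sinh.
        * auto_derive; trivial.
      + unfold scal; simpl; unfold mult; simpl. unfold Rdiv; ring. }
  evar_last; [exact HD |]. rewrite Hsh, Hch.
  assert (EI : forall a c : C, Im (a / c)
    = (Im a * Re c - Re a * Im c) / (Re c * Re c + Im c * Im c)).
  { intros [a a'] [c c']. unfold Cdiv, Cmult, Cinv, Re, Im; simpl. unfold Rdiv.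
    rewrite !Rmult_1_r. ring. }
  rewrite EI. unfold ray, Cexp. simpl Re. simpl Im. fold r.
  set (S := sin psi) in *. set (c := cos psi).
  assert (HC : c * c = 1 - S * S).
  { generalize (sin2_cos2 psi). unfold Rsqr. fold S c. lra. }
  set (Q := 4 * (r * r) * (s * s) * (S * S) + (r * r - s * s) * (r * r - s * s)).
  assert (HQ : 0 < Q).
  { assert (0 < r * r) by nra. assert (0 < s * s) by nra. assert (0 < S * S) by nra.
    assert (0 < 4 * (r * r) * (s * s) * (S * S)) by (repeat apply Rmult_lt_0_compat; lra).
    pose proof (Rle_0_sqr (r * r - s * s)) as H4. unfold Rsqr in H4. unfold Q. lra. }
  transitivity (2 * r * S * (r * r + s * s) / Q).
  - unfold Q in *. field. repeat split; lra.
  - unfold Re, Im, Cmult, Cminus, Cplus, Copp, RtoC; simpl. f_equal.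
    + ring_simplify. replace (c ^ 2) with (1 - S * S) by (rewrite <- HC; ring). ring.
    + unfold Q. ring_simplify.
      replace (c ^ 4) with ((1 - S * S) * (1 - S * S)) by (rewrite <- HC; ring).
      replace (c ^ 2) with (1 - S * S) by (rewrite <- HC; ring). ring.
Qed.

Local Lemma kernel_int : is_lim_seq (fun n => RInt (fun u =>
   Im (2 * ray psi u / ((RtoC s + ray psi u) * (RtoC s - ray psi u)))) (- INR n) (INR n))
   (PI / s).
Proof.
  pose proof s_pos as Hs. assert (Hsin : 0 < sin psi) by (apply sin_gt_0; lra).
  apply is_lim_seq_ext with (fun n => T (INR n) - T (- INR n)).
  { intros n. symmetry. apply is_RInt_unique.
    apply (is_RInt_derive T).
    - intros u _. apply kernel_deriv.
    - intros u _. apply (Ccont_horizontal (fun z =>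
        2 * Cexp z / ((RtoC s + Cexp z) * (RtoC s - Cexp z)))%C psi u).
      apply holo_cont, holo_div.
      + apply holo_mult; [apply holo_const | apply holo_Cexp].
      + apply holo_mult; [| apply Den_holo].
        apply holo_plus; [apply holo_const | apply holo_Cexp].
      + apply Cmult_neq_0; [apply s_plus_neq; lra | apply s_minus_neq; [lra |]].
        intros E. injection E as _ E. lra. }
  assert (Hinf : forall a : R, is_lim_seq (fun n => sinh (INR n + a) / sin psi) p_infty).
  { intros a. apply is_lim_seq_spec. intros B.
    destruct (INR_unbounded (2 * sin psi * Rabs B + Rabs a)) as [N HN]. exists N.
    intros n Hn. apply le_INR in Hn. pose proof (Rle_abs (- a)) as H1. rewrite Rabs_Ropp in H1.
    pose proof (Rabs_pos B) as HB. pose proof (Rle_abs B) as HB'.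
    assert (0 <= sin psi * Rabs B) by (apply Rmult_le_pos; lra).
    pose proof (half_le_sinh (INR n + a) ltac:(lra)) as H2.
    apply Rmult_lt_reg_r with (sin psi); [easy |].
    unfold Rdiv. rewrite Rmult_assoc, Rinv_l, Rmult_1_r by lra.
    assert (B * sin psi <= sin psi * Rabs B) by nra. lra. }
  unfold T. replace (PI / s) with (/ s * (PI / 2) - / s * - (PI / 2)) by (field; lra).
  apply is_lim_seq_minus'.
  - apply (is_lim_seq_scal_l _ (/ s) (PI / 2)).
    apply (atan_seq_lim (fun n => sinh (INR n - sigma) / sin psi)), Hinf.
  - apply (is_lim_seq_scal_l _ (/ s) (- (PI / 2))).
    apply is_lim_seq_ext with (fun n => - atan (sinh (INR n + sigma) / sin psi)).
    + intros n. rewrite <- atan_opp. f_equal.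
      replace (- INR n - sigma) with (- (INR n + sigma)) by ring.
      rewrite sinh_opp. unfold Rdiv; ring.
    + apply (is_lim_seq_opp _ (PI / 2)). apply (atan_seq_lim (fun n => sinh (INR n + sigma) / sin psi)), Hinf.
Qed.

(** Cauchy's formula for [k (z) / (s - z)] on the contour formed by the rays
    [arg z = psi] and [arg z = - psi]: by symmetry the two rays together give twice
    the imaginary part below.  The pole [s] lies on the real edge of the half sector;
    subtracting a multiple of an explicit kernel removes it, and the remaining
    function [q] is real on that edge, so that its imaginary part integrates to [0]
    on every ray of the half sector. *)
Theorem stieltjes :
  line_int (fun u => Im (k (u, psi) / (RtoC s - ray psi u))) = kappa * PI / s.
Proof.
  assert (Nsg : forall u, (u, psi) <> sg) by (intros u E; injection E as _ E; lra).
  apply line_int_unique.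
  apply is_lim_seq_ext with (fun n => RInt (fun u => Im (q (u, psi))) (- INR n) (INR n)
    + kappa * RInt (fun u => Im (2 * ray psi u / ((RtoC s + ray psi u) * (RtoC s - ray psi u))))
        (- INR n) (INR n)).
  - intros n. symmetry.
    assert (E1 : ex_RInt (fun u => Im (q (u, psi))) (- INR n) (INR n)).
    { apply (@ex_RInt_continuous R_CompleteNormedModule). intros u _.
      apply Ccont_horizontal, q_cont. lra. }
    assert (E2 : ex_RInt (fun u => Im (2 * ray psi u / ((RtoC s + ray psi u) * (RtoC s - ray psi u))))
        (- INR n) (INR n)).
    { apply (@ex_RInt_continuous R_CompleteNormedModule). intros u _.
      apply (Ccont_horizontal (fun z =>
        2 * Cexp z / ((RtoC s + Cexp z) * (RtoC s - Cexp z)))%C psi u).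
      apply holo_cont, holo_div.
      + apply holo_mult; [apply holo_const | apply holo_Cexp].
      + apply holo_mult; [| apply Den_holo].
        apply holo_plus; [apply holo_const | apply holo_Cexp].
      + apply Cmult_neq_0; [apply s_plus_neq; lra | apply s_minus_neq; [lra |]].
        apply Nsg. }
    rewrite <- (RInt_scal (V := R_CompleteNormedModule) _ _ _ kappa) by exact E2.
    rewrite <- (RInt_plus (V := R_CompleteNormedModule) (fun u => Im (q (u, psi)))).
    2: exact E1. 2: apply (ex_RInt_scal (V := R_NormedModule) (fun u => Im _)), E2.
    apply RInt_ext. intros u _. rewrite q_eq by (try lra; apply Nsg).
    pose proof (s_plus_neq u psi ltac:(lra)) as N1.
    pose proof (s_minus_neq u psi ltac:(lra) (Nsg u)) as N2.
    unfold Num, Den in *. unfold ray.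
    replace (k (u, psi) / (RtoC s - Cexp (u, psi)))%C with
      ((k (u, psi) - RtoC kappa * (2 * Cexp (u, psi) / (RtoC s + Cexp (u, psi)))) / (RtoC s - Cexp (u, psi))
       + RtoC kappa * (2 * Cexp (u, psi) / ((RtoC s + Cexp (u, psi)) * (RtoC s - Cexp (u, psi)))))%C
      by (field; auto).
    match goal with |- Im (?a + RtoC kappa * ?b)%C = _ =>
      change (Im a + Im (RtoC kappa * b) = Im a + kappa * Im b) end.
    f_equal. unfold Im, Cmult, RtoC; simpl; ring.
  - replace (kappa * PI / s) with (0 + kappa * (PI / s)) by (field; pose proof s_pos; lra).
    apply is_lim_seq_plus'; [apply q_int |].
    apply (is_lim_seq_scal_l _ kappa (PI / s)), kernel_int.
Qed.
End Stieltjes.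

(** * Uniqueness of the Laplace transform *)

Definition null_integral (h : R -> R) : Prop :=
  forall eps, 0 < eps -> exists d X, 0 < d /\ forall a b, 0 < a < d -> X < b -> 0 < b ->
    Rabs (RInt h a b) <= eps.

Definition pos_continuous (h : R -> R) : Prop := forall t, 0 < t -> continuous h t.

Lemma pos_ex_RInt (h : R -> R) (a b : R) : pos_continuous h -> 0 < a -> 0 < b -> ex_RInt h a b.
Proof.
  intros Hh Ha Hb. apply (@ex_RInt_continuous R_CompleteNormedModule). intros t Ht. apply Hh.
  eapply Rlt_le_trans; [| apply Ht]. apply Rmin_pos; easy.
Qed.

Lemma null_integral_gen (h : R -> R) :
  is_RInt_gen h (at_right 0) (Rbar_locally p_infty) 0 -> null_integral h.
Proof.
  intros H eps He.
  destruct (H (fun v => Rabs v <= eps)) as [A B [d Hd] [X HX] HAB].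
  { exists (mkposreal eps He). intros v Hv. change (Rabs (v - 0) < eps) in Hv.
    rewrite Rminus_0_r in Hv. left; exact Hv. }
  exists d, X. split; [apply cond_pos |]. intros a b Ha Hb _.
  destruct (HAB a b) as (v & Hv & Hv').
  - apply Hd; [| lra]. change (Rabs (a - 0) < d).
    rewrite Rminus_0_r, Rabs_pos_eq; lra.
  - apply HX, Hb.
  - simpl in Hv. rewrite (is_RInt_unique _ _ _ _ Hv). exact Hv'.
Qed.

Lemma null_integral_lin (h k : R -> R) (p q : R) : pos_continuous h -> pos_continuous k ->
  null_integral h -> null_integral k -> null_integral (fun t => p * h t + q * k t).
Proof.
  intros Ch Ck Hh Hk eps He.
  assert (Hm : 0 < Rabs p + Rabs q + 1) by (pose proof (Rabs_pos p); pose proof (Rabs_pos q); lra).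
  assert (He' : 0 < eps / (Rabs p + Rabs q + 1)) by (apply Rdiv_lt_0_compat; easy).
  destruct (Hh _ He') as (d1 & X1 & Hd1 & H1). destruct (Hk _ He') as (d2 & X2 & Hd2 & H2).
  exists (Rmin d1 d2), (Rmax X1 X2). split; [apply Rmin_pos; easy |]. intros a b [Ha Ha'] Hb Hb0.
  specialize (H1 a b (conj Ha (Rlt_le_trans _ _ _ Ha' (Rmin_l _ _))) (Rle_lt_trans _ _ _ (Rmax_l _ _) Hb) Hb0).
  specialize (H2 a b (conj Ha (Rlt_le_trans _ _ _ Ha' (Rmin_r _ _))) (Rle_lt_trans _ _ _ (Rmax_r _ _) Hb) Hb0).
  rewrite (RInt_plus (V := R_CompleteNormedModule) (fun t => p * h t) (fun t => q * k t)).
  2: apply (ex_RInt_scal (V := R_NormedModule) h), pos_ex_RInt; easy.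
  2: apply (ex_RInt_scal (V := R_NormedModule) k), pos_ex_RInt; easy.
  rewrite (RInt_scal (V := R_CompleteNormedModule) h) by (apply pos_ex_RInt; easy).
  rewrite (RInt_scal (V := R_CompleteNormedModule) k) by (apply pos_ex_RInt; easy).
  change (Rabs (p * RInt h a b + q * RInt k a b) <= eps).
  eapply Rle_trans; [apply Rabs_triang |]. rewrite !Rabs_mult.
  set (e := eps / (Rabs p + Rabs q + 1)) in *.
  assert (E : (Rabs p + Rabs q + 1) * e = eps) by (unfold e; field; lra).
  pose proof (Rabs_pos p); pose proof (Rabs_pos q). nra.
Qed.

Lemma null_integral_ext (h k : R -> R) : (forall t, 0 < t -> h t = k t) ->
  null_integral h -> null_integral k.
Proof.
  intros E H eps He. destruct (H eps He) as (d & X & Hd & Hb). exists d, X. split; [easy |].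
  intros a b Ha HX Hb0. rewrite <- (RInt_ext h); [apply Hb; easy |].
  intros t Ht. apply E. eapply Rle_lt_trans; [| apply Ht]. left. apply Rmin_pos; lra.
Qed.

Lemma pos_continuous_exp_mult (p : R) (V : R -> R) :
  pos_continuous V -> pos_continuous (fun t => exp (p * t) * V t).
Proof.
  intros HV t Ht. apply (continuous_mult (K := R_AbsRing) (fun t => exp (p * t)) V); [| apply HV, Ht].
  apply (ex_derive_continuous (V := R_NormedModule)). auto_derive; trivial.
Qed.

(** With [X = exp (- t)] the hypothesis is orthogonality to all polynomials in [X]
    without constant term.  If [V t0 > 0], test [V] against [X (A - (X - X0)^2)^n], where
    the power grows geometrically next to [X0 = exp (- t0)] and stays below [1] away
    from it: the integral would tend to infinity with [n]. *)
Lemma orthogonal_nonpos (V : R -> R) (B : R) : pos_continuous V ->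
  (forall t, 0 < t -> Rabs (V t) <= B) ->
  (forall j : nat, null_integral (fun t => exp (- INR (S j) * t) * V t)) ->
  forall t0, 0 < t0 -> V t0 <= 0.
Proof.
  intros CV HB HV t0 Ht0. apply Rnot_lt_le. intros Hpos. set (eta := V t0) in *.
  set (X0 := exp (- t0)).
  assert (HX0 : 0 < X0 < 1).
  { split; [apply exp_pos |]. unfold X0. rewrite <- exp_0. apply exp_increasing; lra. }
  (* Expanding one factor [A - (X - X0)^2] raises the exponent of [X] by at most 2. *)
  assert (HP : forall A n j, null_integral
    (fun t => exp (- INR (S j) * t) * (A - (exp (- t) - X0) ^ 2) ^ n * V t)).
  { intros A n. induction n as [| n IH]; intros j.
    - apply (null_integral_ext (fun t => exp (- INR (S j) * t) * V t)); [| apply HV].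
      intros t _; simpl; ring.
    - assert (HC : forall j, pos_continuous
        (fun t => exp (- INR (S j) * t) * (A - (exp (- t) - X0) ^ 2) ^ n * V t)).
      { intros i t Ht.
        apply (continuous_mult (K := R_AbsRing)
          (fun t => exp (- INR (S i) * t) * (A - (exp (- t) - X0) ^ 2) ^ n) V); [| apply CV, Ht].
        apply (ex_derive_continuous (V := R_NormedModule)). auto_derive; trivial. }
      assert (HC2 : pos_continuous (fun t =>
        (A - X0 ^ 2) * (exp (- INR (S j) * t) * (A - (exp (- t) - X0) ^ 2) ^ n * V t) +
        (2 * X0) * (exp (- INR (S (S j)) * t) * (A - (exp (- t) - X0) ^ 2) ^ n * V t))).
      { intros t Ht. apply (continuous_plus (V := R_NormedModule)
          (fun t => (A - X0 ^ 2) * (exp (- INR (S j) * t) * (A - (exp (- t) - X0) ^ 2) ^ n * V t))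
          (fun t => (2 * X0) * (exp (- INR (S (S j)) * t) * (A - (exp (- t) - X0) ^ 2) ^ n * V t)));
        apply (continuous_mult (K := R_AbsRing) (fun _ => _)); try apply continuous_const; apply HC, Ht. }
      eapply null_integral_ext; [| apply (null_integral_lin _ _ 1 (- 1) HC2 (HC (S (S j)))
        (null_integral_lin _ _ (A - X0 ^ 2) (2 * X0) (HC j) (HC (S j)) (IH j) (IH (S j))) (IH (S (S j))))].
      intros t Ht. cbv beta.
      assert (E1 : exp (- INR (S (S j)) * t) = exp (- INR (S j) * t) * exp (- t)).
      { rewrite <- exp_plus. f_equal. rewrite (S_INR (S j)). ring. }
      assert (E2 : exp (- INR (S (S (S j))) * t) = exp (- INR (S j) * t) * exp (- t) * exp (- t)).
      { rewrite <- !exp_plus. f_equal. rewrite (S_INR (S (S j))), (S_INR (S j)). ring. }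
      rewrite E1, E2. simpl pow. ring. }
  (* [V >= eta / 2] as soon as [exp (- t)] is within [dl] of [X0]. *)
  destruct (proj1 (continuity_pt_locally V t0)
    (proj2 (continuity_pt_filterlim V t0) (CV t0 Ht0)) (mkposreal (eta / 2) ltac:(lra))) as [rho Hrho].
  simpl in Hrho.
  set (rh := Rmin rho t0). assert (Hrh : 0 < rh) by (apply Rmin_pos; [apply cond_pos | easy]).
  assert (HVnear : forall t, Rabs (t - t0) < rh -> eta / 2 <= V t).
  { intros t Ht. assert (Ht' : Rabs (t - t0) < rho) by (eapply Rlt_le_trans; [exact Ht | apply Rmin_l]).
    specialize (Hrho t Ht'). apply Rabs_lt_between in Hrho. fold eta in Hrho. lra. }
  set (dl := Rmin (X0 - exp (- (t0 + rh))) (exp (- (t0 - rh)) - X0)).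
  assert (Hdl : 0 < dl).
  { apply Rmin_pos; apply Rlt_0_minus; apply exp_increasing; lra. }
  assert (HdlX : dl < X0).
  { eapply Rle_lt_trans; [apply Rmin_l |]. pose proof (exp_pos (- (t0 + rh))). lra. }
  assert (Hnear : forall t, Rabs (exp (- t) - X0) < dl -> eta / 2 <= V t).
  { intros t Ht. apply HVnear. apply Rabs_lt_between in Ht.
    pose proof (Rmin_l (X0 - exp (- (t0 + rh))) (exp (- (t0 - rh)) - X0)) as M1. fold dl in M1.
    pose proof (Rmin_r (X0 - exp (- (t0 + rh))) (exp (- (t0 - rh)) - X0)) as M2. fold dl in M2.
    apply Rabs_lt_between'. split.
    - apply Ropp_lt_cancel, exp_lt_inv. lra.
    - apply Ropp_lt_cancel, exp_lt_inv. lra. }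
  (* [Q] is at most [1] at distance [dl] from [X0], and at least [qq > 1] at
     distance [dl / 2], which is reached at [t2]. *)
  set (A := 1 + dl * dl / 2). set (Q := fun t => A - (exp (- t) - X0) ^ 2).
  set (t2 := - ln (X0 - dl / 2)).
  assert (Et2 : exp (- t2) = X0 - dl / 2) by (unfold t2; rewrite Ropp_involutive, exp_ln; lra).
  assert (Ht2 : t0 < t2).
  { apply Ropp_lt_cancel, exp_lt_inv. fold X0. rewrite Et2. lra. }
  assert (HB0 : 0 <= B) by (eapply Rle_trans; [apply Rabs_pos | apply (HB t0 Ht0)]).
  assert (HQpos : forall t, 0 < t -> 0 <= Q t).
  { intros t Ht. pose proof (exp_pos (- t)) as He.
    assert (exp (- t) < 1) by (rewrite <- exp_0; apply exp_increasing; lra).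
    unfold Q, A. assert (0 < dl * dl) by nra. simpl.
    assert (Rabs (exp (- t) - X0) <= 1) by (apply Rabs_le; lra).
    assert ((exp (- t) - X0) * (exp (- t) - X0) <= 1).
    { apply Rabs_le_between in H1. nra. }
    lra. }
  assert (Hlow : forall n t, 0 < t -> - B * exp (- t) <= exp (- 1 * t) * Q t ^ n * V t).
  { intros n t Ht. replace (- 1 * t) with (- t) by ring. pose proof (exp_pos (- t)) as He.
    pose proof (pow_le (Q t) n (HQpos t Ht)) as HQn.
    destruct (Rlt_le_dec (Rabs (exp (- t) - X0)) dl) as [L | L].
    - pose proof (Hnear t L). apply Rle_trans with 0; [nra |].
      apply Rmult_le_pos; [apply Rmult_le_pos |]; lra.
    - assert (HQ1 : Q t <= 1).
      { unfold Q, A. simpl. rewrite Rmult_1_r.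
        assert (dl * dl <= (exp (- t) - X0) * (exp (- t) - X0)).
        { revert L. unfold Rabs. destruct Rcase_abs; nra. }
        nra. }
      assert (HQn1 : Q t ^ n <= 1).
      { rewrite <- (pow1 n). apply pow_incr. split; [apply HQpos, Ht | easy]. }
      pose proof (HB t Ht) as HBt. apply Rabs_le_between in HBt.
      assert (- B <= Q t ^ n * V t) by nra.
      rewrite Rmult_assoc. nra. }
  set (c1 := X0 / 2 * (eta / 2)). set (qq := 1 + dl * dl / 4).
  assert (Hhigh : forall n t, t0 <= t <= t2 -> c1 * qq ^ n <= exp (- 1 * t) * Q t ^ n * V t).
  { intros n t [Ht Ht']. replace (- 1 * t) with (- t) by ring.
    assert (He1 : exp (- t) <= X0) by (apply exp_mono; lra).
    assert (He2 : X0 - dl / 2 <= exp (- t)) by (rewrite <- Et2; apply exp_mono; lra).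
    assert (HVt : eta / 2 <= V t).
    { apply Hnear. apply Rabs_lt_between. lra. }
    assert (HQt : qq <= Q t).
    { unfold qq, Q, A. simpl. rewrite Rmult_1_r.
      assert ((exp (- t) - X0) * (exp (- t) - X0) <= dl / 2 * (dl / 2)) by nra. lra. }
    assert (HQn : qq ^ n <= Q t ^ n).
    { apply pow_incr. split; [unfold qq; nra | easy]. }
    assert (Hqn : 0 <= qq ^ n) by (apply pow_le; unfold qq; nra).
    replace (c1 * qq ^ n) with (X0 / 2 * qq ^ n * (eta / 2)) by (unfold c1; ring).
    apply Rmult_le_compat; try lra.
    - apply Rmult_le_pos; lra.
    - apply Rmult_le_compat; lra. }
  assert (Hbound : forall n, (t2 - t0) * (c1 * qq ^ n) <= 2 * B + 1).
  { intros n. destruct (HP A n O 1 Rlt_0_1) as (d & X & Hd & HX).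
    set (a := Rmin d t0 / 2). assert (Hm : 0 < Rmin d t0) by (apply Rmin_pos; lra).
    pose proof (Rmin_l d t0). pose proof (Rmin_r d t0).
    set (b := Rmax X t2 + 1). pose proof (Rmax_l X t2). pose proof (Rmax_r X t2).
    specialize (HX a b ltac:(unfold a; lra) ltac:(unfold b; lra) ltac:(unfold b; lra)).
    simpl INR in HX. fold Q in HX.
    set (h := fun t => exp (- (1) * t) * Q t ^ n * V t) in *.
    change (Rabs (RInt h a b) <= 1) in HX.
    assert (Ch : pos_continuous h).
    { intros t Ht. apply (continuous_mult (K := R_AbsRing) (fun t => exp (- (1) * t) * Q t ^ n) V).
      - apply (ex_derive_continuous (V := R_NormedModule)). unfold Q. auto_derive; trivial.
      - apply CV, Ht. }
    assert (Hlo : forall x y, 0 < x <= y -> - B <= RInt h x y).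
    { intros x y Hxy.
      assert (HI : is_RInt (fun t => - B * exp (- t)) x y (minus (B * exp (- y)) (B * exp (- x)))).
      { apply (is_RInt_derive (fun t => B * exp (- t))).
        - intros t _. auto_derive; trivial. ring.
        - intros t _. apply (ex_derive_continuous (V := R_NormedModule)). auto_derive; trivial. }
      apply Rle_trans with (RInt (fun t => - B * exp (- t)) x y).
      - rewrite (is_RInt_unique _ _ _ _ HI). unfold minus, plus, opp; simpl.
        pose proof (exp_pos (- y)). assert (exp (- x) <= 1) by (rewrite <- exp_0; apply exp_mono; lra). nra.
      - apply RInt_le; [lra | eexists; apply HI | apply pos_ex_RInt; try easy; lra |].
        intros t Ht. apply Hlow. lra. }
    assert (Hhi : (t2 - t0) * (c1 * qq ^ n) <= RInt h t0 t2).
    { replace ((t2 - t0) * (c1 * qq ^ n)) with (RInt (fun _ => c1 * qq ^ n) t0 t2)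
        by (rewrite RInt_const; easy).
      apply RInt_le; [lra | apply ex_RInt_const | apply pos_ex_RInt; try easy; lra |].
      intros t Ht. apply Hhigh. lra. }
    assert (Hab : a < t0 /\ t2 < b /\ 0 < a) by (unfold a, b; lra).
    pose proof (Hlo a t0 ltac:(lra)). pose proof (Hlo t2 b ltac:(lra)).
    assert (E : RInt h a b = RInt h a t0 + (RInt h t0 t2 + RInt h t2 b)).
    { rewrite <- (RInt_Chasles h a t0 b) by (apply pos_ex_RInt; try easy; lra).
      rewrite <- (RInt_Chasles h t0 t2 b) by (apply pos_ex_RInt; try easy; lra). easy. }
    rewrite E in HX. apply Rabs_le_between in HX. lra. }
  assert (Hq1 : Rabs qq > 1).
  { unfold qq. rewrite Rabs_pos_eq by nra. nra. }
  assert (Hc1 : 0 < (t2 - t0) * c1).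
  { unfold c1. apply Rmult_lt_0_compat; [lra |]. apply Rmult_lt_0_compat; lra. }
  destruct (Pow_x_infinity qq Hq1 ((2 * B + 2) / ((t2 - t0) * c1))) as [n Hn].
  specialize (Hn n (Nat.le_refl n)). rewrite Rabs_pos_eq in Hn by (apply pow_le; unfold qq; nra).
  specialize (Hbound n). apply Rge_le in Hn.
  apply (Rmult_le_compat_l ((t2 - t0) * c1)) in Hn; [| lra].
  replace ((t2 - t0) * c1 * ((2 * B + 2) / ((t2 - t0) * c1))) with (2 * B + 2) in Hn by (field; split; nra).
  lra.
Qed.

Lemma pos_continuous_opp (V : R -> R) : pos_continuous V -> pos_continuous (fun t => - V t).
Proof. intros H t Ht. apply (continuous_opp V), H, Ht. Qed.

Lemma null_integral_exp_0 (V : R -> R) (B : R) : pos_continuous V ->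
  (forall t, 0 < t -> Rabs (V t) <= B) ->
  (forall j : nat, null_integral (fun t => exp (- INR (S j) * t) * V t)) ->
  forall t, 0 < t -> V t = 0.
Proof.
  intros CV HB HV t Ht. apply Rle_antisym.
  - apply (orthogonal_nonpos V B); easy.
  - enough (- V t <= 0) by lra.
    apply (orthogonal_nonpos (fun t => - V t) B); [apply pos_continuous_opp, CV | | | easy].
    + intros u Hu. rewrite Rabs_Ropp. apply HB, Hu.
    + intros j. pose proof (pos_continuous_exp_mult (- INR (S j)) V CV) as C.
      eapply null_integral_ext; [| apply (null_integral_lin _ _ (-1) 0 C C (HV j) (HV j))].
      intros u _; cbv beta; ring.
Qed.

Lemma Rabs_lim_le (u : nat -> R) (L x e : R) : is_lim_seq u L ->
  (exists N, forall n, (N <= n)%nat -> Rabs (x - u n) <= e) -> Rabs (x - L) <= e.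
Proof.
  intros Hu HN.
  assert (H : is_lim_seq (fun n => Rabs (x - u n)) (Rabs (x - L))).
  { apply (is_lim_seq_abs (fun n => x - u n) (x - L)).
    apply is_lim_seq_minus'; [apply is_lim_seq_const | easy]. }
  exact (is_lim_seq_le_loc _ (fun _ => e) _ _ HN H (is_lim_seq_const e)).
Qed.

Lemma inv_INR_small (d : R) : 0 < d -> exists N, forall n, (N <= n)%nat -> 0 < / (INR n + 1) < d.
Proof.
  intros Hd. destruct (INR_unbounded (/ d)) as [N HN]. exists N. intros n Hn.
  apply le_INR in Hn. pose proof (pos_INR n). split.
  - apply Rinv_0_lt_compat; lra.
  - rewrite <- (Rinv_inv d). pose proof (Rinv_0_lt_compat d Hd).
    apply Rinv_lt_contravar; [apply Rmult_lt_0_compat |]; lra.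
Qed.

(** Cauchy's criterion shows that the primitive [t |-> int_1^t h] has a limit at both
    ends; the two limits agree because the integral is null, and are subtracted. *)
Lemma null_integral_primitive (h : R -> R) : pos_continuous h -> null_integral h ->
  exists V, (forall t, 0 < t -> is_derive V t (h t)) /\
    (forall eps, 0 < eps -> exists d X, 0 < d /\
      (forall a, 0 < a < d -> Rabs (V a) <= eps) /\
      (forall b, X < b -> 0 < b -> Rabs (V b) <= eps)).
Proof.
  intros Ch Hh. set (U := fun t => RInt h 1 t).
  assert (EU : forall a b, 0 < a -> 0 < b -> RInt h a b = U b - U a).
  { intros a b Ha Hb. unfold U.
    rewrite <- (RInt_Chasles h 1 a b) by (apply pos_ex_RInt; try easy; lra).
    assert (Ep : forall p q : R, q = plus p q - p) by (intros p q; unfold plus; simpl; ring).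
    apply Ep. }
  assert (HL : ex_finite_lim_seq (fun n => U (/ (INR n + 1)))).
  { apply ex_lim_seq_cauchy_corr. intros eps.
    assert (He : 0 < eps / 3) by (pose proof (cond_pos eps); lra).
    destruct (Hh (eps / 3) He) as (d & X & Hd & HX).
    destruct (inv_INR_small d Hd) as [N HN]. exists N. intros n m Hn Hm.
    set (b := Rmax X 0 + 1). pose proof (Rmax_l X 0). pose proof (Rmax_r X 0).
    pose proof (HN n Hn) as An. pose proof (HN m Hm) as Am.
    pose proof (HX _ b An ltac:(unfold b; lra) ltac:(unfold b; lra)) as Bn.
    pose proof (HX _ b Am ltac:(unfold b; lra) ltac:(unfold b; lra)) as Bm.
    rewrite EU in Bn, Bm by (try apply An; try apply Am; unfold b; lra).
    apply Rabs_le_between in Bn, Bm. apply Rabs_lt_between. lra. }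
  destruct HL as [L HL]. exists (fun t => U t - L). split.
  - intros t Ht. apply is_derive_ext with (fun t => U t + - L); [easy |].
    evar_last.
    + apply (is_derive_plus (V := R_NormedModule) U (fun _ => - L));
        [| apply (is_derive_const (V := R_NormedModule))].
      apply (is_derive_RInt h U 1).
      * assert (Hloc : locally t (fun y => 0 < y)) by (apply open_gt; exact Ht).
        revert Hloc. apply filter_imp. intros y Hy. apply (RInt_correct h).
        apply pos_ex_RInt; try easy; lra.
      * apply Ch, Ht.
    + apply Rplus_0_r.
  - intros eps He. destruct (Hh (eps / 2) ltac:(lra)) as (d & X & Hd & HX).
    assert (HB : forall b, X < b -> 0 < b -> Rabs (U b - L) <= eps / 2).
    { intros b Hb Hb0. apply (Rabs_lim_le _ L (U b) (eps / 2) HL).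
      destruct (inv_INR_small d Hd) as [N HN]. exists N. intros n Hn.
      pose proof (HN n Hn) as An. rewrite <- EU by (try apply An; lra). apply HX; easy. }
    exists d, X. split; [easy |]. split.
    + intros a Ha. set (b := Rmax X 0 + 1). pose proof (Rmax_l X 0). pose proof (Rmax_r X 0).
      specialize (HB b ltac:(unfold b; lra) ltac:(unfold b; lra)).
      specialize (HX a b Ha ltac:(unfold b; lra) ltac:(unfold b; lra)).
      rewrite EU in HX by (unfold b; lra).
      apply Rabs_le_between in HB, HX. apply Rabs_le. lra.
    + intros b Hb Hb0. specialize (HB b Hb Hb0). lra.
Qed.

Lemma bounded_of_ends (V : R -> R) : pos_continuous V ->
  (exists d X, 0 < d /\ (forall a, 0 < a < d -> Rabs (V a) <= 1) /\
      (forall b, X < b -> 0 < b -> Rabs (V b) <= 1)) ->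
  exists B, forall t, 0 < t -> Rabs (V t) <= B.
Proof.
  intros CV (d & X & Hd & Ha & Hb).
  set (x := d / 2). set (y := Rmax X x). pose proof (Rmax_l X x). pose proof (Rmax_r X x).
  destruct (continuity_ab_maj (fun t => Rabs (V t)) x y) as (c & Hc & Hc').
  - unfold y; lra.
  - intros t Ht. apply continuity_pt_filterlim.
    apply (continuous_comp V Rabs); [apply CV; unfold x in *; lra | apply continuous_Rabs].
  - exists (Rabs (V c) + 1). pose proof (Rabs_pos (V c)). intros t Ht.
    destruct (Rlt_le_dec t d) as [L | L]; [specialize (Ha t ltac:(lra)); lra |].
    destruct (Rlt_le_dec X t) as [L' | L']; [specialize (Hb t L' Ht); lra |].
    specialize (Hc t ltac:(unfold y, x in *; lra)). lra.
Qed.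

(** Lerch's theorem.  Integration by parts replaces the possibly conditionally
    convergent integrals of [f] by those of a bounded primitive of
    [exp (- t) * f t]. *)
Theorem laplace_unique (f : R -> R) : pos_continuous f ->
  (forall s, 0 < s -> null_integral (fun t => exp (- s * t) * f t)) ->
  forall t, 0 < t -> f t = 0.
Proof.
  intros Cf Hf.
  assert (Ch := fun s => pos_continuous_exp_mult (- s) f Cf).
  destruct (null_integral_primitive _ (Ch 1) (Hf 1 Rlt_0_1)) as (V & DV & EV).
  assert (CV : pos_continuous V).
  { intros t Ht. apply (ex_derive_continuous (V := R_NormedModule)). eexists; apply DV, Ht. }
  destruct (bounded_of_ends V CV (EV 1 Rlt_0_1)) as [B HB].
  assert (HV : forall j : nat, null_integral (fun t => exp (- INR (S j) * t) * V t)).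
  { intros j. set (p := INR (S j)).
    assert (Hp : 1 <= p) by (unfold p; rewrite S_INR; pose proof (pos_INR j); lra).
    intros eps He.
    destruct (Hf (1 + p) ltac:(lra) (eps / 3) ltac:(lra)) as (d1 & X1 & Hd1 & H1).
    destruct (EV (eps / 3) ltac:(lra)) as (d2 & X2 & Hd2 & H2 & H3).
    exists (Rmin d1 d2), (Rmax X1 X2). split; [apply Rmin_pos; easy |].
    intros a b [Ha Ha'] Hb Hb0.
    specialize (H1 a b (conj Ha (Rlt_le_trans _ _ _ Ha' (Rmin_l _ _)))
      (Rle_lt_trans _ _ _ (Rmax_l _ _) Hb) Hb0).
    specialize (H2 a (conj Ha (Rlt_le_trans _ _ _ Ha' (Rmin_r _ _)))).
    specialize (H3 b (Rle_lt_trans _ _ _ (Rmax_r _ _) Hb) Hb0).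
    assert (Hpos : forall t, Rmin a b <= t -> 0 < t).
    { intros t Ht. eapply Rlt_le_trans; [| exact Ht]. apply Rmin_pos; easy. }
    assert (HI : is_RInt (fun t => exp (- (1 + p) * t) * f t - p * (exp (- p * t) * V t)) a b
      (minus (exp (- p * b) * V b) (exp (- p * a) * V a))).
    { apply (is_RInt_derive (fun t => exp (- p * t) * V t)).
      - intros t [Ht _]. specialize (Hpos t Ht). specialize (DV t Hpos).
        evar_last.
        + apply (is_derive_mult (K := R_AbsRing) (fun t => exp (- p * t)) V t (- p * exp (- p * t)));
            [auto_derive; trivial; ring | exact DV | intros; apply Rmult_comm].
        + unfold plus, mult; simpl.
          replace (- (1 + p) * t) with (- p * t + - (1) * t) by ring. rewrite exp_plus. ring.
      - intros t [Ht _]. specialize (Hpos t Ht).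
        apply (continuous_minus (V := R_NormedModule) (fun t => exp (- (1 + p) * t) * f t)
          (fun t => p * (exp (- p * t) * V t))); [apply Ch, Hpos |].
        apply (continuous_mult (K := R_AbsRing) (fun _ => p)); [apply continuous_const |].
        apply pos_continuous_exp_mult; easy. }
    apply (is_RInt_unique (V := R_CompleteNormedModule)) in HI.
    pose proof (pos_ex_RInt _ a b (Ch (1 + p)) Ha Hb0) as X3.
    pose proof (pos_ex_RInt _ a b (pos_continuous_exp_mult (- p) V CV) Ha Hb0) as X4.
    rewrite (RInt_minus (V := R_CompleteNormedModule) (fun t => exp (- (1 + p) * t) * f t)
      (fun t => p * (exp (- p * t) * V t))) in HI.
    2: exact X3. 2: apply (ex_RInt_scal (V := R_NormedModule) (fun t => exp (- p * t) * V t)), X4.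
    rewrite (RInt_scal (V := R_CompleteNormedModule) (fun t => exp (- p * t) * V t)) in HI by exact X4.
    set (I1 := RInt (fun t => exp (- (1 + p) * t) * f t) a b) in *.
    set (I2 := RInt (fun t => exp (- p * t) * V t) a b) in *.
    change (I1 - p * I2 = exp (- p * b) * V b - exp (- p * a) * V a) in HI.
    assert (He1 : forall x y, 0 < x -> Rabs (exp (- p * x) * y) <= Rabs y).
    { intros x y Hx. rewrite Rabs_mult, (Rabs_pos_eq (exp _)) by (left; apply exp_pos).
      rewrite <- (Rmult_1_l (Rabs y)) at 2. apply Rmult_le_compat_r; [apply Rabs_pos |].
      rewrite <- exp_0. apply exp_mono. nra. }
    pose proof (He1 b (V b) Hb0) as G1. pose proof (He1 a (V a) Ha) as G2.
    assert (G : Rabs (p * I2) <= eps).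
    { replace (p * I2) with (I1 - exp (- p * b) * V b + exp (- p * a) * V a) by lra.
      eapply Rle_trans; [apply Rabs_triang |].
      eapply Rle_trans; [apply Rplus_le_compat_r, Rabs_triang |]. rewrite Rabs_Ropp. lra. }
    rewrite Rabs_mult, (Rabs_pos_eq p) in G by lra. pose proof (Rabs_pos I2). nra. }
  intros t Ht. pose proof (null_integral_exp_0 V B CV HB HV) as HV0.
  assert (E : exp (- (1) * t) * f t = 0).
  { rewrite <- (is_derive_unique _ _ _ (DV t Ht)).
    rewrite (Derive_ext_loc V (fun _ => 0)); [apply Derive_const |].
    assert (Hloc : locally t (fun y => 0 < y)) by (apply open_gt; exact Ht).
    revert Hloc. apply filter_imp. exact HV0. }
  apply Rmult_integral in E. destruct E as [E | E]; [| easy].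
  pose proof (exp_pos (- (1) * t)). lra.
Qed.

(** * The symbol in logarithmic coordinates *)

(** In the variable [z = ln s] the fractional powers in [g] become exponentials:
    no branch has to be chosen and the symbol is entire. *)
Fixpoint symbol (c alpha : R) (cs als : nat -> R) (m : nat) (z : C) : C :=
  match m with
  | O => (RtoC c * Cexp (RtoC alpha * z))%C
  | S m' => (symbol c alpha cs als m' z + RtoC (cs m) * Cexp (RtoC (als m) * z))%C
  end.

Lemma g_0 (c alpha : R) (cs als : nat -> R) (s : R) : g c alpha 0 cs als s = c * Rpower s alpha.
Proof. unfold g. rewrite sum_n_m_zero by lia. unfold zero; simpl. ring. Qed.

Lemma g_S (c alpha : R) (m : nat) (cs als : nat -> R) (s : R) :
  g c alpha (S m) cs als s = g c alpha m cs als s + cs (S m) * Rpower s (als (S m)).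
Proof. unfold g. rewrite sum_n_Sm by lia. unfold plus; simpl. ring. Qed.

Lemma Rpower_exp (u a : R) : Rpower (exp u) a = exp (a * u).
Proof. unfold Rpower. rewrite ln_exp. easy. Qed.

Lemma Cexp_scal (a u y : R) :
  Cexp (RtoC a * (u, y)) = (exp (a * u) * cos (a * y), exp (a * u) * sin (a * y)).
Proof.
  unfold Cexp, Cmult, RtoC, Re, Im; simpl.
  replace (a * u - 0 * y) with (a * u) by ring.
  replace (a * y + 0 * u) with (a * y) by ring. easy.
Qed.

Lemma symbol_real (c alpha : R) (cs als : nat -> R) (m : nat) (u : R) :
  symbol c alpha cs als m (u, 0) = RtoC (g c alpha m cs als (exp u)).
Proof.
  induction m as [| m IH].
  - rewrite g_0, Rpower_exp. simpl. rewrite Cexp_scal, Rmult_0_r, cos_0, sin_0.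
    unfold Cmult, RtoC; simpl; f_equal; ring.
  - rewrite g_S, Rpower_exp. simpl. rewrite IH, Cexp_scal, Rmult_0_r, cos_0, sin_0.
    unfold Cplus, Cmult, RtoC; simpl; f_equal; ring.
Qed.

Lemma holo_symbol (c alpha : R) (cs als : nat -> R) (m : nat) (z : C) :
  holo (symbol c alpha cs als m) z.
Proof.
  assert (HE : forall a d w, holo (fun z => RtoC a * Cexp (RtoC d * z))%C w).
  { intros a d w. apply holo_mult; [apply holo_const |].
    apply (holo_comp Cexp (fun z => RtoC d * z)%C); [| apply holo_Cexp].
    apply holo_mult; [apply holo_const | apply holo_id]. }
  induction m as [| m IH]; [apply HE |].
  apply (holo_plus (symbol c alpha cs als m)); [apply IH | apply HE].
Qed.

Section Symbol.
Variables (c alpha : R) (cs als : nat -> R) (m : nat) (beta chi : R).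
Hypothesis (Hc : 0 < c) (Hcs : forall j, (1 <= j <= m)%nat -> 0 < cs j)
  (Hals : forall j, (1 <= j <= m)%nat -> 2 * beta <= als j <= alpha)
  (Hbeta : 0 < beta) (Hal : 2 * beta <= alpha) (Hchi : 0 < chi < PI / 2).

Let gam n u := g c alpha n cs als (exp u).

(** Each monomial lies in the sector of half-opening [chi] around the direction
    [exp (i chi)]; this convex cone then contains the whole sum. *)
Lemma symbol_cone_n n u y : (n <= m)%nat -> 0 <= y -> alpha * y <= 2 * chi ->
  Cmod (symbol c alpha cs als n (u, y)) <= gam n u /\
  cos chi * gam n u <= Re (symbol c alpha cs als n (u, y)) * cos chi
    + Im (symbol c alpha cs als n (u, y)) * sin chi.
Proof.
  intros Hn Hy Hay.
  assert (HT : forall a d, 0 < a -> 0 <= d <= alpha ->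
    Cmod (RtoC a * Cexp (RtoC d * (u, y))) <= a * exp (d * u) /\
    cos chi * (a * exp (d * u)) <= Re (RtoC a * Cexp (RtoC d * (u, y))) * cos chi
      + Im (RtoC a * Cexp (RtoC d * (u, y))) * sin chi).
  { intros a d Ha Hd. split.
    - rewrite Cmod_mult, Cmod_R, Cmod_Cexp, Rabs_pos_eq by lra.
      replace (Re (RtoC d * (u, y))) with (d * u)
        by (unfold Re, Cmult, RtoC; simpl; ring). lra.
    - rewrite Cexp_scal. unfold Cmult, RtoC, Re, Im; simpl.
      replace ((a * (exp (d * u) * cos (d * y)) - 0 * (exp (d * u) * sin (d * y))) * cos chi
        + (a * (exp (d * u) * sin (d * y)) + 0 * (exp (d * u) * cos (d * y))) * sin chi)
        with (cos (d * y - chi) * (a * exp (d * u))) by (rewrite cos_minus; ring).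
      apply Rmult_le_compat_r.
      { apply Rmult_le_pos; [lra | left; apply exp_pos]. }
      assert (0 <= d * y <= 2 * chi) by nra.
      destruct (Rle_lt_dec 0 (d * y - chi)) as [L | L].
      + apply cos_decr_1; lra.
      + rewrite <- (cos_neg (d * y - chi)). apply cos_decr_1; lra. }
  induction n as [| n IH].
  - unfold gam. rewrite g_0, Rpower_exp. apply HT; lra.
  - destruct (IH ltac:(lia)) as [I1 I2].
    destruct (HT (cs (S n)) (als (S n))) as [T1 T2].
    { apply Hcs; lia. } { specialize (Hals (S n) ltac:(lia)); lra. }
    unfold gam in *. rewrite g_S, Rpower_exp. simpl symbol.
    set (p := symbol c alpha cs als n (u, y)) in *.
    set (t := (RtoC (cs (S n)) * Cexp (RtoC (als (S n)) * (u, y)))%C) in *. split.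
    + eapply Rle_trans; [apply Cmod_triangle | lra].
    + replace (Re (p + t)) with (Re p + Re t) by easy.
      replace (Im (p + t)) with (Im p + Im t) by easy. lra.
Qed.

Lemma gam_bounds n u : (n <= m)%nat ->
  c * exp (alpha * u) <= gam n u /\ (u <= 0 -> gam n u <= gam n 0 * exp (2 * beta * u)).
Proof.
  intros Hn. unfold gam. induction n as [| n IH].
  - rewrite !g_0, !Rpower_exp. split; [lra |]. intros Hu.
    rewrite Rmult_0_r, exp_0, Rmult_1_r. apply Rmult_le_compat_l; [lra |]. apply exp_mono. nra.
  - destruct (IH ltac:(lia)) as [I1 I2]. rewrite !g_S, !Rpower_exp.
    pose proof (Hcs (S n) ltac:(lia)) as H1. pose proof (Hals (S n) ltac:(lia)) as H2. split.
    + pose proof (exp_pos (als (S n) * u)). nra.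
    + intros Hu. specialize (I2 Hu). rewrite exp_0 in I2. rewrite Rmult_0_r, exp_0, Rmult_1_r.
      assert (exp (als (S n) * u) <= exp (2 * beta * u)).
      { apply exp_mono. rewrite (Rmult_comm (als _)), (Rmult_comm (2 * beta)).
        apply Rmult_le_compat_neg_l; lra. }
      nra.
Qed.

Lemma gam_pos u : 0 < gam m u.
Proof.
  destruct (gam_bounds m u (le_n m)) as [H _]. pose proof (exp_pos (alpha * u)).
  assert (0 < c * exp (alpha * u)) by (apply Rmult_lt_0_compat; easy). lra.
Qed.

(** The value of the root at the real point [exp u]; in the strip it is comparable to
    the modulus and to the real part of the root at every point above [u]. *)
Definition root_modulus u := sqrt (gam m u).
Definition root (z : C) : C := Csqrt (symbol c alpha cs als m z).

Lemma cos_chi : 0 < cos chi <= 1.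
Proof. split; [apply cos_gt_0; lra | apply COS_bound]. Qed.

(** If [p] has argument in [[0, 2 chi]] then [Re p >= |p| cos (2 chi)], which is the
    second bound.  Algebraically: square [Q sin chi >= cos chi (|p| - P)], where
    [p = P + i Q], and divide by [|p| - P]. *)
Lemma symbol_cut u y : 0 <= y -> alpha * y <= 2 * chi ->
  let p := symbol c alpha cs als m (u, y) in
  cos chi * gam m u <= Cmod p <= gam m u /\
  2 * (cos chi * cos chi) * Cmod p <= Cmod p + Re p.
Proof.
  intros Hy Hay p. destruct (symbol_cone_n m u y (le_n m) Hy Hay) as [H1 H2].
  fold p in H1, H2. pose proof cos_chi as HC. pose proof (gam_pos u) as Hg.
  assert (HS : 0 < sin chi) by (apply sin_gt_0; lra).
  assert (Hsc : sin chi * sin chi = 1 - cos chi * cos chi).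
  { generalize (sin2_cos2 chi). unfold Rsqr. lra. }
  pose proof (Cmod_mul_self p) as Hm. pose proof (Cmod_ge_0 p) as Hp0.
  pose proof (Cdot_le p (cos chi, sin chi)) as Hd.
  assert (Hcs1 : Cmod (cos chi, sin chi) = 1).
  { unfold Cmod, fst, snd. replace (cos chi ^ 2 + sin chi ^ 2) with 1 by (simpl; lra). apply sqrt_1. }
  rewrite Hcs1 in Hd. change (Re (cos chi, sin chi)) with (cos chi) in Hd.
  change (Im (cos chi, sin chi)) with (sin chi) in Hd.
  split; [split; lra |].
  set (rho := Cmod p) in *. set (P := Re p) in *. set (Q := Im p) in *.
  set (C := cos chi) in *. set (S := sin chi) in *.
  assert (HP : P <= rho) by apply Re_le_Cmod.
  assert (HQ : C * (rho - P) <= Q * S) by nra.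
  assert (HQ2 : (C * (rho - P)) * (C * (rho - P)) <= (Q * S) * (Q * S)).
  { assert (0 <= C * (rho - P)) by nra. nra. }
  replace (Q * S * (Q * S)) with ((rho - P) * (rho + P) * (1 - C * C)) in HQ2.
  2: { rewrite <- Hsc. replace ((rho - P) * (rho + P)) with (Q * Q) by nra. ring. }
  destruct (Req_dec rho P) as [E | N].
  - rewrite <- E. nra.
  - assert (Hlt : 0 < rho - P) by lra.
    assert (C * C * (rho - P) <= (rho + P) * (1 - C * C)).
    { apply Rmult_le_reg_l with (rho - P); [easy |]. lra. }
    lra.
Qed.

Lemma symbol_off_cut u y : 0 <= y -> alpha * y <= 2 * chi ->
  0 < Cmod (symbol c alpha cs als m (u, y)) + Re (symbol c alpha cs als m (u, y)).
Proof.
  intros Hy Hay. destruct (symbol_cut u y Hy Hay) as [[H1 _] H2].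
  pose proof cos_chi as HC. pose proof (gam_pos u) as Hg.
  assert (0 < cos chi * gam m u) by (apply Rmult_lt_0_compat; lra).
  assert (0 < cos chi * cos chi) by (apply Rmult_lt_0_compat; lra). nra.
Qed.

Lemma root_holo u y : 0 <= y -> alpha * y <= 2 * chi -> holo root (u, y).
Proof.
  intros Hy Hay. apply (holo_comp Csqrt (symbol c alpha cs als m)); [apply holo_symbol |].
  apply holo_Csqrt, symbol_off_cut; easy.
Qed.

Lemma root_real u : root (u, 0) = RtoC (root_modulus u).
Proof. unfold root, root_modulus. rewrite symbol_real. apply Csqrt_real, gam_pos. Qed.

Lemma root_le u y : 0 <= y -> alpha * y <= 2 * chi -> Cmod (root (u, y)) <= root_modulus u.
Proof.
  intros Hy Hay. unfold root. rewrite Cmod_Csqrt by (apply symbol_off_cut; easy).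
  apply sqrt_le_1_alt. apply (symbol_cut u y Hy Hay).
Qed.

Lemma root_Re_ge u y : 0 <= y -> alpha * y <= 2 * chi ->
  cos chi * cos chi * root_modulus u <= Re (root (u, y)).
Proof.
  intros Hy Hay. destruct (symbol_cut u y Hy Hay) as [[H1 _] H2].
  pose proof cos_chi as HC. pose proof (gam_pos u) as Hg.
  unfold root, root_modulus, Csqrt. simpl Re.
  set (p := symbol c alpha cs als m (u, y)) in *.
  change (Re (?a, ?b)) with a.
  rewrite <- (sqrt_square (cos chi * cos chi)) by nra.
  rewrite <- sqrt_mult by nra. apply sqrt_le_1_alt.
  set (C := cos chi) in *.
  assert (C * C * Cmod p <= (Cmod p + Re p) / 2) by lra.
  assert (C * C * (C * gam m u) <= C * C * Cmod p) by (apply Rmult_le_compat_l; nra).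
  assert (C * C * (C * C) * gam m u <= C * C * (C * gam m u)).
  { assert (C * C * C * (1 - C) * gam m u >= 0).
    { apply Rle_ge. repeat apply Rmult_le_pos; lra. } lra. }
  lra.
Qed.

(** The weight [x exp (- a x)] is at most [x], which decays on the left, and at most
    a multiple of [1 / x], which decays on the right. *)
Lemma root_decay a : 0 < a -> exists M, forall u,
  root_modulus u * exp (- a * root_modulus u) <= M * exp (- beta * Rabs u).
Proof.
  intros Ha. set (M1 := sqrt (gam m 0)). set (M2 := 4 / (a * a) / sqrt c).
  assert (Hsc : 0 < sqrt c) by (apply sqrt_lt_R0; easy).
  assert (HM1 : 0 <= M1) by apply sqrt_pos.
  assert (HM2 : 0 <= M2).
  { repeat apply Rmult_le_pos; try lra; left; apply Rinv_0_lt_compat; nra. }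
  assert (Hexp2 : forall v, sqrt (exp (2 * v)) = exp v).
  { intros v. replace (2 * v) with (v + v) by ring. rewrite exp_plus.
    apply sqrt_square. left; apply exp_pos. }
  exists (M1 + M2). intros u. set (x := root_modulus u).
  pose proof (gam_pos u) as Hg. destruct (gam_bounds m u (le_n m)) as [G1 G2].
  assert (Hx : 0 < x) by (apply sqrt_lt_R0; easy).
  pose proof (exp_pos (- beta * Rabs u)) as He.
  destruct (Rle_lt_dec u 0) as [L | L].
  - assert (Hx1 : x <= M1 * exp (beta * u)).
    { unfold M1. rewrite <- Hexp2, <- sqrt_mult.
      - apply sqrt_le_1_alt. replace (2 * (beta * u)) with (2 * beta * u) by ring. apply G2, L.
      - left; apply gam_pos.
      - left; apply exp_pos. }
    replace (- beta * Rabs u) with (beta * u) in * by (rewrite Rabs_left1 by easy; ring).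
    assert (exp (- a * x) <= 1) by (rewrite <- exp_0; apply exp_mono; nra).
    pose proof (exp_pos (- a * x)). nra.
  - assert (Hx2 : sqrt c * exp (beta * u) <= x).
    { rewrite <- Hexp2, <- sqrt_mult; [| lra | left; apply exp_pos].
      apply sqrt_le_1_alt. eapply Rle_trans; [| apply G1].
      apply Rmult_le_compat_l; [lra |]. apply exp_mono. nra. }
    rewrite (Rabs_pos_eq u) in * by lra.
    pose proof (sqr_le_exp (a * x) ltac:(nra)) as Hs.
    assert (Hxe : x * exp (- a * x) <= 4 / (a * a) * / x).
    { replace (- a * x) with (- (a * x)) by ring. rewrite exp_Ropp.
      pose proof (exp_pos (a * x)) as Hp.
      apply Rmult_le_reg_r with (a * a * x * exp (a * x)).
      - repeat apply Rmult_lt_0_compat; easy.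
      - replace (x * / exp (a * x) * (a * a * x * exp (a * x))) with (a * x * (a * x)) by (field; lra).
        replace (4 / (a * a) * / x * (a * a * x * exp (a * x))) with (4 * exp (a * x)) by (field; lra).
        easy. }
    assert (Hix : / x <= / sqrt c * exp (- beta * u)).
    { replace (- beta * u) with (- (beta * u)) by ring.
      rewrite exp_Ropp, <- Rinv_mult. apply Rinv_le_contravar; [| easy].
      apply Rmult_lt_0_compat; [easy | apply exp_pos]. }
    assert (H4 : 0 <= 4 / (a * a)) by (apply Rmult_le_pos; [lra | left; apply Rinv_0_lt_compat; nra]).
    assert (4 / (a * a) * / x <= M2 * exp (- beta * u)).
    { replace (M2 * exp (- beta * u)) with (4 / (a * a) * (/ sqrt c * exp (- beta * u)))
        by (unfold M2, Rdiv; ring).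
      apply Rmult_le_compat_l; [easy | exact Hix]. }
    nra.
Qed.
End Symbol.

(** * Inversion of the Laplace transform along a ray *)

Section Inversion.
Variables (k : C -> C) (psi b M : R).
Hypothesis (Hpsi : PI / 2 < psi < PI) (Hb : 0 < b)
  (Hk : forall u y, 0 <= y <= psi -> holo k (u, y))
  (Hreal : forall u, Im (k (u, 0)) = 0)
  (HM : forall u y, 0 <= y <= psi -> Cmod (k (u, y)) <= M * exp (- b * Rabs u)).

Let kp u := k (u, psi).

Lemma cos_psi : cos psi < 0.
Proof. apply cos_lt_0; lra. Qed.

Local Lemma dom_kp : dominated b M kp.
Proof.
  split; [easy | |].
  - intros u. apply (Rcont_comp k (fun u => (u, psi))); [apply Rcont_horizontal |].
    apply holo_cont, Hk. lra.
  - intros u. apply HM. lra.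
Qed.

(** The contour integral over both rays reduces to an imaginary part because [k] is
    symmetric under conjugation. *)
Definition inverse_laplace (t : R) : R := Im (ray_int psi kp (RtoC t)) / PI.

Lemma Re_ray_real t : Re (ray psi 0 * RtoC t) = t * cos psi.
Proof. unfold ray, Cexp, Cmult, RtoC, Re, Im; simpl. rewrite exp_0. ring. Qed.

Lemma Re_ray_real_neg t : 0 < t -> Re (ray psi 0 * RtoC t) < 0.
Proof. intros Ht. rewrite Re_ray_real. pose proof cos_psi. nra. Qed.

Lemma inverse_laplace_cont : pos_continuous inverse_laplace.
Proof.
  intros t Ht.
  destruct (Cderiv_horizontal (ray_int psi kp) t 0 _
    (ray_int_deriv psi b M kp (RtoC t) dom_kp (Re_ray_real_neg t Ht))) as [_ H].
  apply (ex_derive_continuous (V := R_NormedModule)).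
  apply (ex_derive_ext (fun v => / PI * Im (ray_int psi kp (v, 0)))).
  - intros v. unfold inverse_laplace, RtoC, Rdiv. apply Rmult_comm.
  - apply ex_derive_scal. eexists; apply H.
Qed.

Section Transform.
Variable (s : R).
Hypothesis (Hs : 0 < s).

Let D u := (RtoC s - ray psi u)%C.
Let Hu u := (k (u, psi) / D u)%C.

Local Lemma Re_D u : s <= Re (D u).
Proof.
  unfold D, ray, Cexp, Cminus, Cplus, Copp, RtoC, Re, Im; simpl.
  pose proof cos_psi. pose proof (exp_pos u). nra.
Qed.

Local Lemma D_neq u : D u <> 0.
Proof.
  apply Cmod_gt_0. pose proof (Re_D u). pose proof (Re_le_Cmod (D u)). lra.
Qed.

Local Lemma Rcont_invD u : Rcont (fun u => / D u)%C u.
Proof.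
  apply (Rcont_comp (fun z => / (RtoC s - z))%C (ray psi)); [apply Rcont_ray |].
  apply (Ccont_comp Cinv (fun z => RtoC s - z)%C).
  - apply holo_cont, holo_minus; [apply holo_const | apply holo_id].
  - apply holo_cont, holo_Cinv, D_neq.
Qed.

Local Lemma dom_Hu : dominated b (/ s * M) Hu.
Proof.
  destruct (dom_mult b M (/ s) kp (fun u => / D u)%C dom_kp Rcont_invD) as [H1 H2 H3].
  - intros u. rewrite Cmod_inv by apply D_neq. apply Rinv_le_contravar; [easy |].
    pose proof (Re_D u). pose proof (Re_le_Cmod (D u)). lra.
  - split; [easy | |].
    + intros u. apply Rcont_mult; [apply dom_kp | apply Rcont_invD].
    + intros u. unfold Hu, Cdiv. rewrite Cmult_comm. apply H3.
Qed.

(* A primitive of [exp (- s t) * inverse_laplace t] in closed form: its limits at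
   both ends give the transform without exchanging two integrals. *)
Let G t := - (exp (- s * t) * Im (ray_int psi Hu (RtoC t))) / PI.

Local Lemma G_deriv t : 0 < t -> is_derive G t (exp (- s * t) * inverse_laplace t).
Proof.
  intros Ht. pose proof (Re_ray_real_neg t Ht) as Hn.
  destruct (Cderiv_horizontal (ray_int psi Hu) t 0 _
    (ray_int_deriv psi b _ Hu (RtoC t) dom_Hu Hn)) as [_ H].
  destruct (dom_ray_deriv psi b _ Hu (RtoC t) dom_Hu Hn) as [M' HM'].
  pose proof (dom_ray psi b _ Hu (RtoC t) dom_Hu (Rlt_le _ _ Hn)) as H0.
  assert (E : ray_int psi kp (RtoC t)
    = (RtoC s * ray_int psi Hu (RtoC t)
       + RtoC (-1) * ray_int psi (fun u => ray psi u * Hu u) (RtoC t))%C).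
  { unfold ray_int. rewrite <- (line_cint_scal _ _ (RtoC s) _ H0), <- (line_cint_scal _ _ (RtoC (-1)) _ HM').
    assert (D1 : dominated b (s * (/ s * M)) (fun u => RtoC s * (Cexp (ray psi u * RtoC t) * Hu u))%C).
    { apply dom_mult; [easy | intros; apply Rcont_const |].
      intros _. rewrite Cmod_R, Rabs_pos_eq; lra. }
    assert (D2 : dominated b (1 * M') (fun u => RtoC (-1) *
        (Cexp (ray psi u * RtoC t) * (ray psi u * Hu u)))%C).
    { apply dom_mult; [easy | intros; apply Rcont_const |].
      intros _. rewrite Cmod_R, Rabs_left; lra. }
    rewrite <- (line_cint_plus _ _ _ _ _ _ D1 D2). apply line_cint_ext. intros u.
    replace (kp u) with ((RtoC s - ray psi u) * Hu u)%C.
    2: { unfold Hu, kp. fold (D u). field. apply D_neq. }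
    rewrite RtoC_m1. ring. }
  unfold inverse_laplace. rewrite E.
  assert (EG : forall v : R, (- / PI) * (exp (- s * v) * Im (ray_int psi Hu (v, 0))) = G v)
    by (intros v; unfold G, Rdiv, RtoC; ring).
  apply (is_derive_ext _ _ _ _ EG).
  assert (He : is_derive (fun v => exp (- s * v)) t (- s * exp (- s * t)))
    by (auto_derive; trivial; ring).
  evar_last.
  - apply is_derive_scal.
    apply (is_derive_mult (K := R_AbsRing) (fun v => exp (- s * v))
      (fun v => Im (ray_int psi Hu (v, 0))) t _ _ He H).
    intros; apply Rmult_comm.
  - unfold plus, mult, RtoC, Rdiv; simpl.
    generalize (ray_int psi (fun u => ray psi u * Hu u)%C (t, 0)) (ray_int psi Hu (t, 0)).
    intros x y. unfold Cplus, Cmult, Im; simpl. ring.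
Qed.

Local Lemma G_infty : filterlim G (Rbar_locally p_infty) (locally 0).
Proof.
  set (K := 4 * (/ s * M) / b / PI).
  assert (HK : 0 <= K).
  { pose proof (dom_M_pos _ _ _ dom_Hu). pose proof PI_RGT_0. unfold K, Rdiv.
    apply Rmult_le_pos; [apply Rmult_le_pos; [lra |] |]; left; apply Rinv_0_lt_compat; lra. }
  assert (Hexp : is_lim (fun t => K * exp (- s * t)) p_infty 0).
  { replace (Finite 0) with (Rbar_mult K 0) by (simpl; f_equal; ring).
    apply is_lim_scal_l. apply is_lim_spec. intros eps. simpl.
    exists (- ln eps / s). intros t Ht. rewrite Rminus_0_r, Rabs_pos_eq by (left; apply exp_pos).
    rewrite <- (exp_ln eps) by apply cond_pos. apply exp_increasing.
    apply (Rmult_lt_compat_l s) in Ht; [| easy].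
    replace (s * (- ln eps / s)) with (- ln eps) in Ht by (field; lra). lra. }
  apply (is_lim_le_le_loc (fun t => - (K * exp (- s * t))) (fun t => K * exp (- s * t)) G p_infty 0).
  - exists 0. intros t Ht. pose proof (exp_pos (- s * t)) as He.
    pose proof (ray_int_le psi b _ Hu (RtoC t) dom_Hu (Rlt_le _ _ (Re_ray_real_neg t Ht))) as HR.
    pose proof (Rle_trans _ _ _ (im_le_Cmod _) HR) as HI.
    apply Rabs_le_between. unfold G, Rdiv. rewrite Rabs_mult, Rabs_Ropp, Rabs_mult.
    rewrite (Rabs_pos_eq (exp _)) by lra.
    rewrite (Rabs_pos_eq (/ PI)) by (left; apply Rinv_0_lt_compat, PI_RGT_0).
    replace (K * exp (- s * t)) with (exp (- s * t) * (4 * (/ s * M) / b) * / PI)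
      by (unfold K, Rdiv; ring).
    apply Rmult_le_compat_r; [left; apply Rinv_0_lt_compat, PI_RGT_0 |].
    apply Rmult_le_compat_l; [lra | easy].
  - replace (Finite 0) with (Rbar_opp 0) by (simpl; f_equal; ring). apply is_lim_opp, Hexp.
  - exact Hexp.
Qed.

(** [1 - exp (- w)] is at most [|w|] for [Re w >= 0], which cancels the denominator
    [s - z]: only the integrability of [k] matters. *)
Local Lemma G_zero_le t : 0 < t ->
  Rabs (G t - - (Im (line_cint Hu) / PI)) <= 4 * M / b / PI * t.
Proof.
  intros Ht. pose proof (Re_ray_real_neg t Ht) as Hn.
  pose proof (dom_ray psi b _ Hu (RtoC t) dom_Hu (Rlt_le _ _ Hn)) as H0.
  assert (E : (line_cint Hu + - RtoC (exp (- s * t)) * ray_int psi Hu (RtoC t))%C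
    = line_cint (fun u => ((1 - Cexp (- (D u * RtoC t))) / D u) * kp u)%C).
  { unfold ray_int. rewrite <- (line_cint_scal _ _ (- RtoC (exp (- s * t)))%C _ H0).
    assert (D1 : dominated b (1 * (/ s * M))
      (fun u => - RtoC (exp (- s * t)) * (Cexp (ray psi u * RtoC t) * Hu u))%C).
    { apply dom_mult; [easy | intros; apply Rcont_const |].
      intros _. rewrite Cmod_opp, Cmod_R, Rabs_pos_eq by (left; apply exp_pos).
      rewrite <- exp_0. apply exp_mono. nra. }
    rewrite <- (line_cint_plus _ _ _ _ _ _ dom_Hu D1). apply line_cint_ext. intros u.
    replace (- (D u * RtoC t))%C with (RtoC (- s * t) + ray psi u * RtoC t)%C.
    2: { unfold D. rewrite RtoC_mult, RtoC_opp. ring. }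
    rewrite Cexp_plus, Cexp_real. unfold Hu, kp, Cdiv. ring. }
  assert (DD : dominated b (t * M) (fun u => ((1 - Cexp (- (D u * RtoC t))) / D u) * kp u)%C).
  { apply dom_mult; [apply dom_kp | |].
    - intros u. apply Rcont_mult; [| apply Rcont_invD].
      apply (Rcont_comp (fun z => 1 - Cexp (- ((RtoC s - z) * RtoC t)))%C (ray psi)); [apply Rcont_ray |].
      apply holo_cont, holo_minus; [apply holo_const |].
      apply (holo_comp Cexp (fun z => - ((RtoC s - z) * RtoC t))%C); [| apply holo_Cexp].
      apply holo_opp, holo_mult; [| apply holo_const].
      apply holo_minus; [apply holo_const | apply holo_id].
    - intros u. pose proof (Re_D u). pose proof (Re_le_Cmod (D u)).
      rewrite Cmod_div by apply D_neq.
      replace (1 - Cexp (- (D u * RtoC t)))%C with (- (Cexp (- (D u * RtoC t)) - 1))%C by ring.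
      rewrite Cmod_opp.
      assert (HR : Re (- (D u * RtoC t)) <= 0).
      { replace (Re (- (D u * RtoC t))) with (- (Re (D u) * t)).
        - nra.
        - unfold Re, Copp, Cmult, RtoC; simpl; ring. }
      pose proof (Cexp_minus_1_le _ 0 (Rle_refl 0) HR) as HE.
      rewrite exp_0, Rmult_1_r, Cmod_opp, Cmod_mult, Cmod_R, Rabs_pos_eq in HE by lra.
      apply Rmult_le_reg_r with (Cmod (D u)); [lra |].
      unfold Rdiv. rewrite Rmult_assoc, Rinv_l by lra. lra. }
  replace (G t - - (Im (line_cint Hu) / PI))
    with (Im (line_cint Hu + - RtoC (exp (- s * t)) * ray_int psi Hu (RtoC t)) / PI).
  2: { unfold G. generalize (ray_int psi Hu (RtoC t)) (line_cint Hu). intros x y.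
       unfold Cplus, Cmult, Copp, RtoC, Im; simpl. unfold Rdiv. ring. }
  rewrite E. pose proof (Rle_trans _ _ _ (im_le_Cmod _) (line_cint_le _ _ _ DD)) as HI.
  unfold Rdiv at 1. rewrite Rabs_mult.
  rewrite (Rabs_pos_eq (/ PI)) by (left; apply Rinv_0_lt_compat, PI_RGT_0).
  replace (4 * M / b / PI * t) with (4 * (t * M) / b * / PI) by (unfold Rdiv; ring).
  apply Rmult_le_compat_r; [left; apply Rinv_0_lt_compat, PI_RGT_0 | easy].
Qed.

Local Lemma G_zero : filterlim G (at_right 0) (locally (- (Im (line_cint Hu) / PI))).
Proof.
  intros P [eps HP].
  set (K := 4 * M / b / PI).
  assert (HK : 0 <= K).
  { pose proof (dom_M_pos _ _ _ dom_kp). pose proof PI_RGT_0. unfold K, Rdiv.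
    apply Rmult_le_pos; [apply Rmult_le_pos; [lra |] |]; left; apply Rinv_0_lt_compat; lra. }
  assert (Hd : 0 < eps / (K + 1)) by (apply Rdiv_lt_0_compat; [apply cond_pos | lra]).
  exists (mkposreal _ Hd). intros t Ht Ht0. apply HP.
  change (Rabs (t - 0) < eps / (K + 1)) in Ht. rewrite Rminus_0_r, Rabs_pos_eq in Ht by lra.
  change (Rabs (G t - - (Im (line_cint Hu) / PI)) < eps).
  eapply Rle_lt_trans; [apply G_zero_le, Ht0 |]. fold K.
  apply Rle_lt_trans with ((K + 1) * t); [nra |].
  apply (Rmult_lt_compat_l (K + 1)) in Ht; [| lra].
  replace ((K + 1) * (eps / (K + 1))) with (pos eps) in Ht by (field; lra). easy.
Qed.

(** The increment of the primitive is [Im] of the integral of [k / (s - z)], up to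
    the factor [PI]; Cauchy's formula evaluates it. *)
Lemma laplace_inverse_laplace :
  is_RInt_gen (fun t => exp (- s * t) * inverse_laplace t) (at_right 0) (Rbar_locally p_infty)
    (Re (k (ln s, 0)) / s).
Proof.
  assert (Hpos : filter_prod (at_right 0) (Rbar_locally p_infty)
    (fun ab => 0 < fst ab /\ 0 < snd ab)).
  { exists (fun a => 0 < a) (fun b => 0 < b); [| | intros; split; easy].
    - exists (mkposreal 1 Rlt_0_1). intros t _ Ht; exact Ht.
    - exists 0; easy. }
  assert (HG : forall t, 0 < t -> Derive G t = exp (- s * t) * inverse_laplace t).
  { intros t Ht. apply is_derive_unique, G_deriv, Ht. }
  assert (Hmin : forall a b x, 0 < a -> 0 < b -> Rmin a b <= x -> 0 < x).
  { intros x y z Hx Hy Hz. eapply Rlt_le_trans; [apply Rmin_pos; [apply Hx | apply Hy] | exact Hz]. }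
  replace (Re (k (ln s, 0)) / s) with (0 - - (Im (line_cint Hu) / PI)).
  2: { pose proof (stieltjes k psi b M (ln s) ltac:(lra) Hb Hk Hreal HM) as E.
       rewrite exp_ln in E by easy. unfold line_cint. change (Im (?x, ?y)) with y.
       unfold Hu, D. rewrite E. field. pose proof PI_RGT_0. split; lra. }
  apply (is_RInt_gen_ext (Derive G)).
  - revert Hpos. apply filter_imp. intros [x y] [Hx Hy] z Hz. simpl in *.
    apply HG. apply (Hmin x y); try easy. lra.
  - apply is_RInt_gen_Derive; [| | apply G_zero | apply G_infty].
    + revert Hpos. apply filter_imp. intros [x y] [Hx Hy] z Hz. simpl in *.
      eexists. apply G_deriv, (Hmin x y); easy.
    + revert Hpos. apply filter_imp. intros [x y] [Hx Hy] z Hz. simpl in *.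
      assert (Hz0 : 0 < z) by (apply (Hmin x y); easy).
      apply (continuous_ext_loc _ (fun t => exp (- s * t) * inverse_laplace t)).
      * assert (Hloc : locally z (fun y => 0 < y)) by (apply open_gt; exact Hz0).
        revert Hloc. apply filter_imp. intros t Ht. symmetry. apply HG, Ht.
      * apply (pos_continuous_exp_mult (- s) inverse_laplace inverse_laplace_cont z Hz0).
Qed.
End Transform.
End Inversion.

(** * Differences of wave profiles *)

(** Only differences of two profiles are inverted: each [exp (- x sqrt g) / s] has a
    pole at [s = 0], which cancels in the difference. *)
Definition wave (S : C -> C) (x1 x2 : R) (z : C) : C :=
  (Cexp (- (RtoC x1 * S z)) - Cexp (- (RtoC x2 * S z)))%C.

Section Wave.
Variables (S : C -> C) (r : R -> R) (psi kappa beta : R).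
Hypothesis (Hpsi : PI / 2 < psi < PI) (Hkappa : 0 < kappa) (Hbeta : 0 < beta)
  (HS : forall u y, 0 <= y <= psi -> holo S (u, y))
  (HSreal : forall u, S (u, 0) = RtoC (r u))
  (Hr0 : forall u, 0 <= r u)
  (HSle : forall u y, 0 <= y <= psi -> Cmod (S (u, y)) <= r u)
  (HSRe : forall u y, 0 <= y <= psi -> kappa * r u <= Re (S (u, y)))
  (Hdecay : forall a, 0 < a -> exists M, forall u,
     r u * exp (- a * r u) <= M * exp (- beta * Rabs u)).

Lemma wave_holo x1 x2 u y : 0 <= y <= psi -> holo (wave S x1 x2) (u, y).
Proof.
  intros Hy.
  assert (HE : forall x, holo (fun z => Cexp (- (RtoC x * S z)))%C (u, y)).
  { intros x. apply (holo_comp Cexp (fun z => - (RtoC x * S z))%C); [| apply holo_Cexp].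
    apply holo_opp, holo_mult; [apply holo_const | apply HS, Hy]. }
  apply holo_minus; apply HE.
Qed.

Lemma wave_real x1 x2 u :
  wave S x1 x2 (u, 0) = RtoC (exp (- x1 * r u) - exp (- x2 * r u)).
Proof.
  unfold wave. rewrite HSreal, <- !RtoC_mult, <- !RtoC_opp, !Cexp_real, RtoC_minus.
  rewrite <- !Ropp_mult_distr_l. easy.
Qed.

Lemma Re_opp_scal (x : R) (z : C) : Re (- (RtoC x * z)) = - x * Re z.
Proof. unfold Re, Copp, Cmult, RtoC; simpl; ring. Qed.

Lemma wave_le_ordered x1 x2 u y : 0 < x1 -> x1 <= x2 -> 0 <= y <= psi ->
  Cmod (wave S x1 x2 (u, y)) <= (x2 - x1) * (r u * exp (- (x1 * kappa) * r u)).
Proof.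
  intros H1 H2 Hy. unfold wave. set (s := S (u, y)).
  pose proof (HSle u y Hy) as Hle. pose proof (HSRe u y Hy) as HRe. fold s in Hle, HRe.
  replace (Cexp (- (RtoC x1 * s)) - Cexp (- (RtoC x2 * s)))%C
    with (- (Cexp (- (RtoC x1 * s)) * (Cexp (- (RtoC (x2 - x1) * s)) - 1)))%C.
  2: { replace (- (RtoC x2 * s))%C with (- (RtoC x1 * s) + - (RtoC (x2 - x1) * s))%C
         by (rewrite RtoC_minus; ring).
       rewrite Cexp_plus. ring. }
  rewrite Cmod_opp, Cmod_mult, Cmod_Cexp, Re_opp_scal.
  assert (HR : Re (- (RtoC (x2 - x1) * s)) <= 0).
  { rewrite Re_opp_scal. pose proof (Hr0 u). assert (0 <= kappa * r u) by nra. nra. }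
  pose proof (Cexp_minus_1_le _ 0 (Rle_refl 0) HR) as HE.
  rewrite exp_0, Rmult_1_r, Cmod_opp, Cmod_mult, Cmod_R, Rabs_pos_eq in HE by lra.
  assert (HX : exp (- x1 * Re s) <= exp (- (x1 * kappa) * r u)) by (apply exp_mono; nra).
  replace ((x2 - x1) * (r u * exp (- (x1 * kappa) * r u)))
    with (exp (- (x1 * kappa) * r u) * ((x2 - x1) * r u)) by ring.
  apply Rmult_le_compat; [left; apply exp_pos | apply Cmod_ge_0 | easy |].
  eapply Rle_trans; [exact HE |]. apply Rmult_le_compat_l; lra.
Qed.

Lemma wave_le x1 x2 : 0 < x1 -> 0 < x2 -> exists M, forall u y, 0 <= y <= psi ->
  Cmod (wave S x1 x2 (u, y)) <= M * exp (- beta * Rabs u).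
Proof.
  assert (HO : forall a c, 0 < a -> a <= c -> exists M, forall u y, 0 <= y <= psi ->
    Cmod (wave S a c (u, y)) <= M * exp (- beta * Rabs u)).
  { intros a c Ha Hac. destruct (Hdecay (a * kappa)) as [M HM].
    { apply Rmult_lt_0_compat; easy. }
    exists ((c - a) * M). intros u y Hy. eapply Rle_trans; [apply wave_le_ordered; easy |].
    rewrite Rmult_assoc. apply Rmult_le_compat_l; [lra | apply HM]. }
  intros H1 H2. destruct (Rle_lt_dec x1 x2) as [L | L].
  - apply HO; easy.
  - destruct (HO x2 x1 H2 (Rlt_le _ _ L)) as [M HM]. exists M. intros u y Hy.
    replace (wave S x1 x2 (u, y)) with (- wave S x2 x1 (u, y))%C by (unfold wave; ring).
    rewrite Cmod_opp. apply HM, Hy.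
Qed.

(** Minus the [x]-derivative of the profile, that is, [s] times the transform of
    [phi], on the ray. *)
Definition flux (tau u : R) : C := (S (u, psi) * Cexp (- (RtoC tau * S (u, psi))))%C.

Lemma Rcont_S u : Rcont (fun u => S (u, psi)) u.
Proof.
  apply (Rcont_comp S (fun u => (u, psi))); [apply Rcont_horizontal |].
  apply holo_cont, HS. lra.
Qed.

Lemma Rcont_exp_S x u : Rcont (fun u => Cexp (- (RtoC x * S (u, psi)))) u.
Proof.
  apply (Rcont_comp (fun z => Cexp (- (RtoC x * z)))%C (fun u => S (u, psi))); [apply Rcont_S |].
  apply holo_cont, (holo_comp Cexp (fun z => - (RtoC x * z))%C); [| apply holo_Cexp].
  apply holo_opp, holo_mult; [apply holo_const | apply holo_id].
Qed.

Lemma dom_flux tau : 0 < tau -> exists M, dominated beta M (flux tau).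
Proof.
  intros Ht. destruct (Hdecay (tau * kappa)) as [M HM]; [apply Rmult_lt_0_compat; easy |].
  exists M. split; [easy | |].
  - intros u. apply Rcont_mult; [apply Rcont_S | apply Rcont_exp_S].
  - intros u. eapply Rle_trans; [| apply HM]. unfold flux.
    pose proof (HSle u psi ltac:(lra)). pose proof (HSRe u psi ltac:(lra)).
    rewrite Cmod_mult, Cmod_Cexp, Re_opp_scal.
    apply Rmult_le_compat; [apply Cmod_ge_0 | left; apply exp_pos | easy |].
    apply exp_mono. nra.
Qed.

(** The second-order remainder in [x] is uniformly integrable, so that the
    integral may be differentiated under the integral sign. *)
Lemma wave_taylor tau : 0 < tau -> exists M, forall h, Rabs h <= tau * kappa / 2 ->
  dominated beta (h * h * M)
    (fun u => wave S (tau + h) tau (u, psi) + RtoC h * flux tau u)%C.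
Proof.
  (* The decay [exp (- tau kappa r)] of the profile pays for [exp (|h| r)] with one
     half and for each factor [r] of [r^2] with one quarter. *)
  intros Ht. set (a := tau * kappa / 4).
  assert (Htk : 0 < tau * kappa) by (apply Rmult_lt_0_compat; easy).
  assert (Ha : 0 < a) by (unfold a; lra).
  destruct (Hdecay a Ha) as [M HM]. exists (/ a * M). intros h Hh.
  split; [easy | |].
  - intros u. apply Rcont_plus.
    + apply (Rcont_comp (wave S (tau + h) tau) (fun u => (u, psi))); [apply Rcont_horizontal |].
      apply holo_cont, wave_holo. lra.
    + apply Rcont_mult; [apply Rcont_const |].
      apply Rcont_mult; [apply Rcont_S | apply Rcont_exp_S].
  - intros u. unfold wave, flux. set (s := S (u, psi)).
    pose proof (HSle u psi ltac:(lra)) as Hle. pose proof (HSRe u psi ltac:(lra)) as HRe.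
    fold s in Hle, HRe. pose proof (Hr0 u) as Hr. set (x := r u) in *.
    replace (Cexp (- (RtoC (tau + h) * s)) - Cexp (- (RtoC tau * s))
        + RtoC h * (s * Cexp (- (RtoC tau * s))))%C
      with (Cexp (- (RtoC tau * s)) * (Cexp (- (RtoC h * s)) - 1 - - (RtoC h * s)))%C.
    2: { replace (- (RtoC (tau + h) * s))%C with (- (RtoC tau * s) + - (RtoC h * s))%C
           by (rewrite RtoC_plus; ring).
         rewrite Cexp_plus. ring. }
    rewrite Cmod_mult, Cmod_Cexp, Re_opp_scal.
    pose proof (Cexp_taylor_le (- (RtoC h * s))) as HT.
    rewrite Cmod_opp, Cmod_mult, Cmod_R in HT.
    pose proof (Rabs_pos h) as Hh0. pose proof (Cmod_ge_0 s) as Hs0.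
    set (n := Cmod s) in *.
    eapply Rle_trans; [apply Rmult_le_compat_l; [left; apply exp_pos | exact HT] |].
    replace (exp (- tau * Re s) * (Rabs h * n * (Rabs h * n) * exp (Rabs h * n)))
      with (Rabs h * Rabs h * (n * n * (exp (- tau * Re s) * exp (Rabs h * n)))) by ring.
    replace (Rabs h * Rabs h) with (h * h)
      by (rewrite <- Rabs_mult, Rabs_pos_eq; [easy | nra]).
    rewrite !Rmult_assoc. rewrite <- (Rmult_assoc h h). rewrite <- (Rmult_assoc h h).
    apply Rmult_le_compat_l; [nra |].
    assert (E1 : exp (- tau * Re s) * exp (Rabs h * n) <= exp (- (2 * a * x))).
    { rewrite <- exp_plus. apply exp_mono. unfold a.
      assert (Rabs h * n <= tau * kappa / 2 * x) by (apply Rmult_le_compat; lra).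
      assert (tau * (kappa * x) <= tau * Re s) by (apply Rmult_le_compat_l; lra). lra. }
    assert (E2 : x * exp (- (a * x)) <= / a).
    { rewrite exp_Ropp. pose proof (exp_pos (a * x)) as Hp. pose proof (lin_le_exp (a * x)).
      apply Rmult_le_reg_l with (a * exp (a * x)); [apply Rmult_lt_0_compat; easy |].
      replace (a * exp (a * x) * (x * / exp (a * x))) with (a * x) by (field; lra).
      replace (a * exp (a * x) * / a) with (exp (a * x)) by (field; lra). easy. }
    apply Rle_trans with (x * x * exp (- (2 * a * x))).
    + rewrite <- Rmult_assoc. apply Rmult_le_compat; [nra | | nra | easy].
      apply Rmult_le_pos; left; apply exp_pos.
    + replace (- (2 * a * x)) with (- (a * x) + - (a * x)) by ring. rewrite exp_plus.
      replace (x * x * (exp (- (a * x)) * exp (- (a * x))))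
        with ((x * exp (- (a * x))) * (x * exp (- (a * x)))) by ring.
      assert (E3 : x * exp (- (a * x)) <= M * exp (- beta * Rabs u)).
      { rewrite Ropp_mult_distr_l. apply HM. }
      pose proof (exp_pos (- (a * x))).
      apply Rmult_le_compat; try nra.
Qed.

Lemma wave_kernel_deriv tau t : 0 < tau -> 0 < t ->
  is_derive (fun x => inverse_laplace (wave S x tau) psi t) tau
    (- (Im (ray_int psi (flux tau) (RtoC t)) / PI)).
Proof.
  intros Htau Ht. pose proof PI_RGT_0 as HPI.
  pose proof (Re_ray_real_neg psi Hpsi t Ht) as Hn.
  destruct (wave_taylor tau Htau) as [M HM].
  destruct (dom_flux tau Htau) as [Mf Df].
  pose proof (dom_ray psi beta _ _ (RtoC t) Df (Rlt_le _ _ Hn)) as Df'.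
  assert (Htk : 0 < tau * kappa / 2) by (pose proof (Rmult_lt_0_compat _ _ Htau Hkappa); lra).
  pose proof (dom_M_pos _ _ _ (HM (tau * kappa / 2) ltac:(rewrite Rabs_pos_eq; lra))) as HM0.
  assert (HM1 : 0 <= M).
  { apply Rmult_le_reg_l with (tau * kappa / 2 * (tau * kappa / 2)); [nra | lra]. }
  set (K := 4 * M / beta / PI).
  assert (HK : 0 <= K).
  { unfold K, Rdiv. apply Rmult_le_pos; [apply Rmult_le_pos; [lra |] |];
      left; apply Rinv_0_lt_compat; lra. }
  set (f := fun x => inverse_laplace (wave S x tau) psi t).
  set (l := Im (ray_int psi (flux tau) (RtoC t)) / PI).
  assert (f0 : f tau = 0).
  { unfold f, inverse_laplace, ray_int.
    rewrite (line_cint_ext _ (fun u => 0 * (Cexp (ray psi u * RtoC t) * flux tau u))%C).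
    - rewrite (line_cint_scal _ _ _ _ Df'). unfold Cmult, Im; simpl. unfold Rdiv; ring.
    - intros u. unfold wave. ring. }
  assert (HT : forall h, Rabs h <= Rmin (tau * kappa / 2) (tau / 2) ->
    Rabs (f (tau + h) - f tau - - l * h) <= K * (h * h)).
  { intros h Hh. pose proof (Rle_trans _ _ _ Hh (Rmin_l _ _)) as Hh1.
    pose proof (Rle_trans _ _ _ Hh (Rmin_r _ _)) as Hh2.
    apply Rabs_le_between in Hh2.
    destruct (wave_le (tau + h) tau ltac:(lra) Htau) as [Mk HMk].
    assert (Dk : dominated beta Mk (fun u => wave S (tau + h) tau (u, psi))).
    { split; [easy | | intros; apply HMk; lra].
      intros u. apply (Rcont_comp (wave S (tau + h) tau) (fun u => (u, psi))); [apply Rcont_horizontal |].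
      apply holo_cont, wave_holo. lra. }
    pose proof (dom_ray psi beta _ _ (RtoC t) Dk (Rlt_le _ _ Hn)) as Dk'.
    pose proof (dom_ray psi beta _ _ (RtoC t) (HM h Hh1) (Rlt_le _ _ Hn)) as Dd.
    assert (Dh : dominated beta (Rabs h * Mf)
      (fun u => RtoC h * (Cexp (ray psi u * RtoC t) * flux tau u))%C).
    { apply dom_mult; [easy | intros; apply Rcont_const |].
      intros _. rewrite Cmod_R; lra. }
    pose proof (line_cint_le _ _ _ Dd) as HC.
    rewrite (line_cint_ext _ (fun u => Cexp (ray psi u * RtoC t) * wave S (tau + h) tau (u, psi)
      + RtoC h * (Cexp (ray psi u * RtoC t) * flux tau u))%C) in HC by (intros; ring).
    rewrite (line_cint_plus _ _ _ _ _ _ Dk' Dh), (line_cint_scal _ _ _ _ Df') in HC.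
    rewrite f0. unfold f, inverse_laplace, l, ray_int.
    set (X := line_cint (fun u => Cexp (ray psi u * RtoC t) * wave S (tau + h) tau (u, psi))%C) in *.
    set (Y := line_cint (fun u => Cexp (ray psi u * RtoC t) * flux tau u)%C) in *.
    pose proof (Rle_trans _ _ _ (im_le_Cmod _) HC) as HI.
    replace (Im (X + RtoC h * Y)) with (Im X + h * Im Y) in HI
      by (unfold Im, Cplus, Cmult, RtoC; simpl; ring).
    replace (Im X / PI - 0 - - (Im Y / PI) * h) with ((Im X + h * Im Y) * / PI) by (field; lra).
    rewrite Rabs_mult, (Rabs_pos_eq (/ PI)) by (left; apply Rinv_0_lt_compat; easy).
    replace (K * (h * h)) with (4 * (h * h * M) / beta * / PI) by (unfold K, Rdiv; ring).
    apply Rmult_le_compat_r; [left; apply Rinv_0_lt_compat; easy | easy]. }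
  apply is_derive_Reals. intros eps He.
  assert (Hd : 0 < Rmin (Rmin (tau * kappa / 2) (tau / 2)) (eps / (K + 1))).
  { repeat apply Rmin_pos; try lra. apply Rdiv_lt_0_compat; lra. }
  exists (mkposreal _ Hd). simpl. intros h Nh Hh.
  pose proof (Rlt_le_trans _ _ _ Hh (Rmin_l _ _)) as Hh1.
  pose proof (Rlt_le_trans _ _ _ Hh (Rmin_r _ _)) as Hh2.
  specialize (HT h (Rlt_le _ _ Hh1)). pose proof (Rabs_pos_lt h Nh) as Hp.
  change (Rabs ((f (tau + h) - f tau) / h - - l) < eps).
  replace ((f (tau + h) - f tau) / h - - l) with ((f (tau + h) - f tau - - l * h) * / h)
    by (field; easy).
  rewrite Rabs_mult, Rabs_inv.
  apply Rmult_lt_reg_r with (Rabs h); [easy |].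
  rewrite Rmult_assoc, Rinv_l, Rmult_1_r by lra.
  eapply Rle_lt_trans; [exact HT |].
  replace (h * h) with (Rabs h * Rabs h) by (rewrite <- Rabs_mult, Rabs_pos_eq; [easy | nra]).
  rewrite <- Rmult_assoc. apply Rmult_lt_compat_r; [easy |].
  apply (Rmult_lt_compat_l (K + 1)) in Hh2; [| lra].
  replace ((K + 1) * (eps / (K + 1))) with eps in Hh2 by (field; lra). nra.
Qed.
End Wave.

(** * The extension and the sector *)

Lemma Cderiv_conj (f : C -> C) (z l : C) : Cderiv f (Cconj z) l ->
  Cderiv (fun w => Cconj (f (Cconj w))) z (Cconj l).
Proof.
  intros H. rewrite is_derive_C_eps in H. apply is_derive_C_eps. intros eps He.
  destruct (H eps He) as (d & Hd & Hb). exists d. split; [easy |]. intros h Hh.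
  specialize (Hb (Cconj h)). rewrite Cmod_conj in Hb. specialize (Hb Hh).
  rewrite <- Cplus_conj in Hb. rewrite <- Cmod_conj, !Cminus_conj, Cmult_conj, !Cconj_conj.
  exact Hb.
Qed.

(** The integral over both rays, divided by [2 PI i]; the lower ray is the conjugate
    of the upper one. *)
Definition extension (psi : R) (H : R -> C) (t : C) : C :=
  (RtoC (/ (2 * PI)) * (- Ci) * (ray_int psi H t - Cconj (ray_int psi H (Cconj t))))%C.

Lemma extension_real (psi : R) (H : R -> C) (t : R) :
  extension psi H (RtoC t) = RtoC (Im (ray_int psi H (RtoC t)) / PI).
Proof.
  unfold extension.
  replace (Cconj (RtoC t)) with (RtoC t) by (unfold Cconj, RtoC; simpl; f_equal; ring).
  rewrite im_alt'. generalize (Im (ray_int psi H (RtoC t))). intros y.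
  unfold Ci, Cmult, Copp, Cinv, RtoC; simpl. pose proof PI_RGT_0.
  f_equal; field; lra.
Qed.

Lemma extension_deriv (psi b M : R) (H : R -> C) (t : C) : dominated b M H ->
  Re (ray psi 0 * t) < 0 -> Re (ray psi 0 * Cconj t) < 0 ->
  exists l, Cderiv (extension psi H) t l.
Proof.
  intros HH H1 H2. eexists.
  apply Cderiv_mult; [apply Cderiv_const |].
  eapply (Cderiv_ext (fun w => ray_int psi H w + RtoC (-1) * Cconj (ray_int psi H (Cconj w)))%C _ t).
  - intros w. rewrite RtoC_m1. ring.
  - reflexivity.
  - apply Cderiv_plus; [apply (ray_int_deriv psi b M); easy |].
    apply Cderiv_mult; [apply Cderiv_const |].
    apply Cderiv_conj, (ray_int_deriv psi b M); easy.
Qed.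

Lemma extension_le (psi b M : R) (H : R -> C) (t : C) : dominated b M H ->
  Re (ray psi 0 * t) <= 0 -> Re (ray psi 0 * Cconj t) <= 0 ->
  Cmod (extension psi H t) <= / (2 * PI) * (8 * M / b).
Proof.
  intros HH H1 H2. unfold extension. rewrite !Cmod_mult, Cmod_R, Cmod_opp.
  assert (HP : 0 <= / (2 * PI)) by (left; apply Rinv_0_lt_compat; pose proof PI_RGT_0; lra).
  rewrite Cmod_Ci, Rmult_1_r, Rabs_pos_eq by easy. apply Rmult_le_compat_l; [easy |].
  eapply Rle_trans; [apply Cmod_triangle |]. rewrite Cmod_opp, Cmod_conj.
  pose proof (ray_int_le psi b M H t HH H1). pose proof (ray_int_le psi b M H _ HH H2).
  unfold Rdiv in *. lra.
Qed.

Lemma Carg_polar (z : C) : z <> 0 ->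
  z = (Cmod z * cos (Carg z), Cmod z * sin (Carg z)).
Proof.
  intros Hz. assert (Hm : 0 < Cmod z) by (apply Cmod_gt_0; exact Hz).
  pose proof (Cmod_mul_self z) as Hs. pose proof (re_le_Cmod z) as HR.
  apply Rabs_le_between in HR.
  set (n := Cmod z) in *. set (q := Re z / n).
  assert (Hq : -1 <= q <= 1).
  { unfold q. split; apply Rmult_le_reg_r with n; try easy;
      unfold Rdiv; rewrite Rmult_assoc, Rinv_l by lra; lra. }
  assert (Hn : n * q = Re z) by (unfold q; field; lra).
  assert (Hs2 : n * sqrt (1 - q²) = Rabs (Im z)).
  { rewrite <- (sqrt_square n) at 1 by lra. rewrite <- sqrt_mult.
    - rewrite <- sqrt_Rsqr_abs. f_equal. unfold Rsqr. nra.
    - nra.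
    - unfold Rsqr; nra. }
  unfold Carg. fold n. fold q.
  destruct (Rle_dec 0 (Im z)) as [L | L].
  - rewrite cos_acos, sin_acos, Hn, Hs2, Rabs_pos_eq by easy. destruct z; easy.
  - rewrite cos_neg, sin_neg, cos_acos, sin_acos by easy.
    rewrite Hn, <- Ropp_mult_distr_r, Hs2, Rabs_left by lra.
    rewrite Ropp_involutive. destruct z; easy.
Qed.

(** The product has argument [PI / 2 + theta' + arg z] or [PI / 2 + theta' - arg z],
    strictly between [PI / 2] and [3 PI / 2]. *)
Lemma sector_ray (theta theta' : R) (z : C) : theta <= theta' < PI / 2 -> Sigma theta z ->
  Re (ray (PI / 2 + theta') 0 * z) < 0 /\ Re (ray (PI / 2 + theta') 0 * Cconj z) < 0.
Proof.
  intros Ht [Hz Ha]. apply Rabs_lt_between in Ha.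
  assert (Hm : 0 < Cmod z) by (apply Cmod_gt_0; exact Hz).
  rewrite (Carg_polar z Hz). set (A := Carg z) in *. set (n := Cmod z) in *.
  assert (H1 : cos (PI / 2 + theta' + A) < 0) by (apply cos_lt_0; lra).
  assert (H2 : cos (PI / 2 + theta' - A) < 0) by (apply cos_lt_0; lra).
  unfold ray, Cexp, Cconj, Cmult, Re, Im; simpl. rewrite exp_0.
  rewrite cos_plus in H1. rewrite cos_minus in H2. nra.
Qed.

Lemma closed_half_plane (D : C -> Prop) (a z : C) : Cmod a = 1 ->
  (forall y, D y -> Re (a * y) <= 0) -> closure D z -> Re (a * z) <= 0.
Proof.
  intros Ha HD Hz. apply Rnot_lt_le. intros Hpos.
  assert (He : 0 < Re (a * z) / 2) by lra.
  destruct (Hz (mkposreal _ He)) as (y & Hy & Dy). specialize (HD y Dy).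
  destruct Hy as [Hy1 Hy2].
  change (Rabs (Re y - Re z) < Re (a * z) / 2) in Hy1.
  change (Rabs (Im y - Im z) < Re (a * z) / 2) in Hy2.
  assert (HE : Re (a * z) - Re (a * y) <= Cmod (z - y)).
  { replace (Re (a * z) - Re (a * y)) with (Re (a * (z - y)))
      by (unfold Re, Cminus, Cplus, Copp, Cmult; simpl; ring).
    eapply Rle_trans; [apply Re_le_Cmod |]. rewrite Cmod_mult, Ha. lra. }
  pose proof (Cmod_le_parts (z - y)) as HP.
  replace (Re (z - y)) with (- (Re y - Re z)) in HP by (unfold Re, Cminus, Cplus, Copp; simpl; ring).
  replace (Im (z - y)) with (- (Im y - Im z)) in HP by (unfold Im, Cminus, Cplus, Copp; simpl; ring).
  rewrite !Rabs_Ropp in HP. lra.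
Qed.

(** * The propagation function *)

Lemma propagation_continuous (c alpha : R) (m : nat) (cs als : nat -> R) (w : R -> R -> R) (x : R) :
  1 < alpha -> is_propagation_function c alpha m cs als w -> 0 < x -> pos_continuous (w x).
Proof.
  intros Hal Hw Hx t Ht.
  destruct (prop_equation _ _ _ _ _ _ Hw x t Hx Ht) as (v & vs & (n & Hn & Hd & _) & _).
  apply (ex_derive_continuous (V := R_NormedModule)).
  assert (Hn1 : (1 <= n)%nat).
  { destruct n; [simpl in Hn; lra | lia]. }
  exact (Hd 1%nat t Hn1 Ht).
Qed.

(** Both sides are continuous in [t] and have the same Laplace transform. *)
Lemma propagation_difference (c alpha : R) (m : nat) (cs als : nat -> R) (w : R -> R -> R)
  (S : C -> C) (r : R -> R) (psi b M x1 x2 : R) :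
  PI / 2 < psi < PI -> 0 < b ->
  (forall u y, 0 <= y <= psi -> holo (wave S x1 x2) (u, y)) ->
  (forall u, wave S x1 x2 (u, 0) = RtoC (exp (- x1 * r u) - exp (- x2 * r u))) ->
  (forall u y, 0 <= y <= psi -> Cmod (wave S x1 x2 (u, y)) <= M * exp (- b * Rabs u)) ->
  (forall u, r u = sqrt (g c alpha m cs als (exp u))) ->
  1 < alpha -> is_propagation_function c alpha m cs als w -> 0 < x1 -> 0 < x2 ->
  forall t, 0 < t -> w x1 t - w x2 t = inverse_laplace (wave S x1 x2) psi t.
Proof.
  intros Hpsi Hb Hh Hre HM Hr Hal Hw H1 H2 t Ht.
  assert (HreIm : forall u, Im (wave S x1 x2 (u, 0)) = 0) by (intros u; rewrite Hre; easy).
  pose proof (inverse_laplace_cont (wave S x1 x2) psi b M Hpsi Hb Hh HM) as CI0.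
  pose proof (propagation_continuous _ _ _ _ _ w x1 Hal Hw H1) as C1.
  pose proof (propagation_continuous _ _ _ _ _ w x2 Hal Hw H2) as C2.
  enough (E : w x1 t - w x2 t - inverse_laplace (wave S x1 x2) psi t = 0) by lra.
  apply (laplace_unique (fun t => w x1 t - w x2 t - inverse_laplace (wave S x1 x2) psi t)); [| | easy].
  - intros u Hu.
    apply (continuous_minus (V := R_NormedModule) (fun t => w x1 t - w x2 t)); [| apply CI0, Hu].
    apply (continuous_minus (V := R_NormedModule) (w x1) (w x2)); [apply C1 | apply C2]; easy.
  - intros s Hs. apply null_integral_gen.
    pose proof (prop_laplace _ _ _ _ _ _ Hw x1 s H1 Hs) as L1.
    pose proof (prop_laplace _ _ _ _ _ _ Hw x2 s H2 Hs) as L2.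
    pose proof (laplace_inverse_laplace (wave S x1 x2) psi b M Hpsi Hb Hh HreIm HM s Hs) as L3.
    pose proof (is_RInt_gen_minus _ _ _ _ (is_RInt_gen_minus _ _ _ _ L1 L2) L3) as L.
    rewrite Hre, Hr, exp_ln in L by easy. change (Re (RtoC ?a)) with a in L.
    replace (minus _ _) with 0 in L.
    + revert L. apply is_RInt_gen_ext. apply filter_forall. intros [p q] u _.
      unfold minus, plus, opp; simpl. ring.
    + unfold minus, plus, opp; simpl. field. lra.
Qed.

Theorem theorem3p3 :
  forall (c alpha : R) (m : nat) (cs als : nat -> R) (w : R -> R -> R),
    1 < alpha < 2 ->
    ((1 <= m)%nat -> als 1%nat < alpha) ->
    (forall j : nat, (1 <= j < m)%nat -> als (S j) < als j) ->
    ((1 <= m)%nat -> 0 < als m) ->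
    ((1 <= m)%nat -> alpha - als m <= 1) ->
    0 < c ->
    (forall j : nat, (1 <= j <= m)%nat -> 0 < cs j) ->
    is_propagation_function c alpha m cs als w ->
    forall eps : R, 0 < eps -> 0 < theta0 alpha eps ->
    forall tau : R, 0 < tau ->
    exists F : C -> C,
      (forall t : R, 0 < t -> F (RtoC t) = RtoC (phi w t tau)) /\
      analytic_on (Sigma (theta0 alpha eps)) F /\
      (forall theta : R, 0 < theta < theta0 alpha eps ->
         bounded_on (closure (Sigma theta)) F).
Proof.
  intros c alpha m cs als w Hal Hals1 Hdec Halsm _ Hc Hcs Hw eps Heps Hth tau Htau.
  pose proof PI_RGT_0 as HPI.
  set (psi := PI / 2 + theta0 alpha eps).
  assert (Epsi : alpha * psi = PI - alpha * eps).
  { unfold psi, theta0. field. lra. }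
  assert (Hth2 : theta0 alpha eps < PI / 2) by (unfold psi in Epsi; nra).
  assert (Hpsi : PI / 2 < psi < PI) by (unfold psi; lra).
  (* On the strip [0 <= y <= psi] the symbol has argument in [[0, 2 chi]]. *)
  set (chi := alpha * psi / 2).
  assert (Hchi : 0 < chi < PI / 2) by (unfold chi; nra).
  (* [2 beta] is the smallest exponent of [g]. *)
  assert (Hbeta : exists beta, 0 < beta /\ 2 * beta <= alpha /\
    forall j, (1 <= j <= m)%nat -> 2 * beta <= als j <= alpha).
  { destruct m as [| n].
    - exists (alpha / 2). split; [lra | split; [lra | intros; lia]].
    - assert (Hlow : forall i, (i <= n)%nat -> als (S n) <= als (S n - i)%nat).
      { induction i as [| i IH]; intros Hi; [rewrite Nat.sub_0_r; lra |].
        specialize (IH ltac:(lia)). specialize (Hdec (S n - S i)%nat ltac:(lia)).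
        replace (S (S n - S i))%nat with (S n - i)%nat in Hdec by lia. lra. }
      assert (Hup : forall i, (i <= n)%nat -> als (S i) <= als 1%nat).
      { induction i as [| i IH]; intros Hi; [lra |].
        specialize (IH ltac:(lia)). specialize (Hdec (S i) ltac:(lia)). lra. }
      specialize (Hals1 ltac:(lia)). specialize (Halsm ltac:(lia)).
      pose proof (Hup n (le_n n)).
      exists (als (S n) / 2). split; [lra | split; [lra |]]. intros j Hj.
      pose proof (Hlow (S n - j)%nat ltac:(lia)) as H1.
      replace (S n - (S n - j))%nat with j in H1 by lia.
      pose proof (Hup (j - 1)%nat ltac:(lia)) as H2.
      replace (S (j - 1)) with j in H2 by lia. lra. }
  destruct Hbeta as (beta & Hb & Hb2 & Hbj).
  set (S0 := root c alpha cs als m). set (r := root_modulus c alpha cs als m).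
  set (kappa := cos chi * cos chi).
  assert (Hkappa : 0 < kappa).
  { pose proof (cos_chi chi Hchi). unfold kappa. nra. }
  assert (Hstrip : forall y, 0 <= y <= psi -> 0 <= y /\ alpha * y <= 2 * chi).
  { intros y Hy. unfold chi. split; [lra | nra]. }
  assert (HS : forall u y, 0 <= y <= psi -> holo S0 (u, y)).
  { intros u y Hy. destruct (Hstrip y Hy).
    apply (root_holo c alpha cs als m beta chi); easy. }
  assert (HSreal : forall u, S0 (u, 0) = RtoC (r u)).
  { intros u. apply (root_real c alpha cs als m beta); easy. }
  assert (Hr0 : forall u, 0 <= r u) by (intros u; apply sqrt_pos).
  assert (HSle : forall u y, 0 <= y <= psi -> Cmod (S0 (u, y)) <= r u).
  { intros u y Hy. destruct (Hstrip y Hy). apply (root_le c alpha cs als m beta chi); easy. }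
  assert (HSRe : forall u y, 0 <= y <= psi -> kappa * r u <= Re (S0 (u, y))).
  { intros u y Hy. destruct (Hstrip y Hy). apply (root_Re_ge c alpha cs als m beta chi); easy. }
  assert (Hdecay : forall a, 0 < a -> exists M, forall u,
     r u * exp (- a * r u) <= M * exp (- beta * Rabs u)).
  { intros a Ha. apply (root_decay c alpha cs als m beta); easy. }
  destruct (dom_flux S0 r psi kappa beta Hpsi Hkappa Hb HS HSle HSRe Hdecay tau Htau) as [M HM].
  set (H := flux S0 psi tau) in *.
  exists (extension psi H). split; [| split].
  - intros t Ht. rewrite extension_real. f_equal. unfold phi.
    assert (HD : is_derive (fun x => w x t) tau (- (Im (ray_int psi H (RtoC t)) / PI))).
    { apply (is_derive_ext_loc (fun x => inverse_laplace (wave S0 x tau) psi t + w tau t)).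
      - assert (Hloc : locally tau (fun x => 0 < x)) by (apply open_gt; exact Htau).
        revert Hloc. apply filter_imp. intros x Hx.
        destruct (wave_le S0 r psi kappa beta Hkappa Hr0 HSle HSRe Hdecay x tau Hx Htau) as [Mk HMk].
        rewrite <- (propagation_difference c alpha m cs als w S0 r psi beta Mk x tau); try easy; try lra.
        + intros u y Hy. apply (wave_holo S0 psi); easy.
        + intros u. apply wave_real, HSreal.
      - evar_last.
        + apply (is_derive_plus (V := R_NormedModule) _ (fun _ => w tau t));
            [| apply (is_derive_const (V := R_NormedModule))].
          apply (wave_kernel_deriv S0 r psi kappa beta); easy.
        + apply Rplus_0_r. }
    assert (ED : Derive (fun x => w x t) tau = - (Im (ray_int psi H (RtoC t)) / PI))
      by exact (is_derive_unique _ _ _ HD).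
    rewrite ED. ring.
  - intros z Hz.
    destruct (sector_ray _ (theta0 alpha eps) z (conj (Rle_refl _) Hth2) Hz) as [A1 A2].
    destruct (extension_deriv psi beta M H z HM A1 A2) as [l Hl]. exists l. exact Hl.
  - intros theta Htheta. exists (/ (2 * PI) * (8 * M / beta)). intros z Hz.
    assert (Hray : Cmod (ray psi 0) = 1) by (rewrite Cmod_ray; apply exp_0).
    apply extension_le; [exact HM | |].
    + apply (closed_half_plane (Sigma theta)); [exact Hray | | exact Hz].
      intros y Hy. left. apply (sector_ray theta (theta0 alpha eps)); [lra | exact Hy].
    + replace (Re (ray psi 0 * Cconj z)) with (Re (Cconj (ray psi 0) * z))
        by (unfold Re, Cmult, Cconj; simpl; ring).
      apply (closed_half_plane (Sigma theta)); [rewrite Cmod_conj; exact Hray | | exact Hz].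
      intros y Hy. left.
      replace (Re (Cconj (ray psi 0) * y)) with (Re (ray psi 0 * Cconj y))
        by (unfold Re, Cmult, Cconj; simpl; ring).
      apply (sector_ray theta (theta0 alpha eps)); [lra | exact Hy].
Qed.
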